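(* Let $F$ be a finite field of characteristic $2$. For $\sigma\in F$ set $$H_\sigma=\left\{\frac{\sigma uv+v^2}{u^2+v^2}\ \middle|\ u,v\in F,\ u\neq v\right\}.$$ Let $\gamma_0\in F$ lie outside the additive subgroup $\{t^2+t\mid t\in F\}$ of $F$. For each $\sigma\in F\setminus\{0,1\}$ fix an element $\eta_\sigma\in F$ outside $H_\sigma$. Then the following is the list of $4$-dimensional nilpotent associative algebras over $F$ up to isomorphism (every such algebra is isomorphic to exactly one of them): $A_{4,1}$, $A_{4,2}$, $A_{4,3}^1$, $A_{4,4}^\delta$ ($\delta\in F$), $A_{4,5}$, $A_{4,6}$, $A_{4,8}^{1,1}$, $A_{4,9}^{1,\beta}$ ($\beta\in F$), $A_{4,10}^\alpha$ ($\alpha=0,\gamma_0$), $A_{4,11}$, $A_{4,12}$, $A_{4,13}$, $A_{4,14}$, $A_{4,15}$, $A_{4,16}$, $A_{4,17}^\delta$ ($\delta=0,\gamma_0$), $A_{4,18}^1$, $A_{4,19}^\delta$ ($\delta=0,\gamma_0$), $A_{4,20}$, $A_{4,21}^\delta$ ($\delta\in F$, $\delta\neq1$), $A_{4,26}^{0,0,1}$, $A_{4,26}^{0,1,1}$, $A_{4,26}^{0,\sigma,1}$ ($\sigma\in F\setminus\{0,1\}$), $A_{4,26}^{1+\eta_\sigma^{-1},\,\sigma\eta_\sigma^{-1},\,1}$ ($\sigma\in F\setminus\{0,1\}$).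
   Context: Algebras are associative algebras over $F$, not assumed unital; an algebra is nilpotent if all products of $n$ elements vanish for some $n$. Notation: $\langle a,b,c,d\mid\text{relations}\rangle$ denotes the algebra with vector space basis $a,b,c,d$ whose multiplication is determined by the listed products of basis elements, all other products of basis elements being zero. ($H_\sigma$ is an additive subgroup of $F$ and is a proper subgroup for $\sigma\ne 0,1$.) The algebras are: $A_{4,1}=\langle a,b,c,d\mid\ \rangle$; $A_{4,2}=\langle a,b,c,d\mid a^2=b\rangle$; $A_{4,3}^\delta=\langle a,b,c,d\mid a^2=c, b^2=\delta c\rangle$; $A_{4,4}^\delta=\langle a,b,c,d\mid a^2=c, b^2=\delta c, ab=c\rangle$; $A_{4,5}=\langle a,b,c,d\mid ab=c, ba=-c\rangle$; $A_{4,6}=\langle a,b,c,d\mid a^2=b, ab=ba=c\rangle$; $A_{4,8}^{\alpha,\beta}=\langle a,b,c,d\mid a^2=d, b^2=\alpha d, c^2=\beta d\rangle$; $A_{4,9}^{\alpha,\beta}=\langle a,b,c,d\mid a^2=\alpha d, b^2=d, bc=d, c^2=\beta d\rangle$; $A_{4,10}^\alpha=\langle a,b,c,d\mid a^2=d, ab=d, b^2=\alpha d, bc=d, cb=d\rangle$; $A_{4,11}=\langle a,b,c,d\mid a^2=d, ab=d, cb=d, c^2=-d\rangle$; $A_{4,12}=\langle a,b,c,d\mid a^2=b, ab=ba=d, ac=d, c^2=d\rangle$; $A_{4,13}=\langle a,b,c,d\mid a^2=b, ab=ba=d, c^2=d\rangle$; $A_{4,14}=\langle a,b,c,d\mid a^2=b,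 ab=ba=d, ac=d\rangle$; $A_{4,15}=\langle a,b,c,d\mid a^2=b, ab=ba=c, b^2=ac=ca=d\rangle$; $A_{4,16}=\langle a,b,c,d\mid a^2=c, ba=d\rangle$; $A_{4,17}^\delta=\langle a,b,c,d\mid a^2=c, ab=ba=d, b^2=\delta c+d\rangle$; $A_{4,18}^\delta=\langle a,b,c,d\mid a^2=c, ab=d, ba=-d, b^2=\delta c\rangle$; $A_{4,19}^\delta=\langle a,b,c,d\mid a^2=c, ab=d, ba=c+d, b^2=\delta c\rangle$; $A_{4,20}=\langle a,b,c,d\mid a^2=c, ab=d, ba=c\rangle$; $A_{4,21}^\delta=\langle a,b,c,d\mid a^2=c, ab=d, ba=\delta d\rangle$; $A_{4,26}^{\alpha,\beta,\gamma}=\langle a,b,c,d\mid a^2=c, ab=d, ba=\beta c+\alpha d, b^2=\gamma c\rangle$. *)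

(* Defs.v *)
From HB Require Import structures.
From mathcomp Require Import all_boot all_order all_algebra.

Set Implicit Arguments.
Unset Strict Implicit.
Unset Printing Implicit Defensive.

Import GRing.Theory.
Local Open Scope ring_scope.

(* A finite-dimensional algebra without unit: MathComp's algType and falgType
   are unital.  Associativity is kept as a separate predicate below. *)
Record nuAlgebra (F : fieldType) := NuAlgebra {
  nuSort :> vectType F;
  nuMul : {bilinear nuSort -> nuSort -> nuSort} }.

Arguments nuMul {F} n.

Definition nuAssociative (F : fieldType) (A : nuAlgebra F) : Prop :=
  associative (nuMul A).

(* All left-normed products of n.+1 elements vanish, for some n; for an
   associative algebra the bracketing is irrelevant. *)
Definition nuNilpotent (F : fieldType) (A : nuAlgebra F) : Prop :=
  exists n : nat, forall (x : A) (s : n.-tuple A), foldl (nuMul A) x s = 0.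

Definition nuDim (F : fieldType) (A : nuAlgebra F) : nat := \dim {: A}.

Definition nuIsomorphic (F : fieldType) (A B : nuAlgebra F) : Prop :=
  exists f : {linear A -> B},
    bijective f /\ forall x y : A, f (nuMul A x y) = nuMul B (f x) (f y).

Section Presentation.
Variable F : fieldType.

(* The triple (i, j, v) stands for the relation e_i e_j = v; products of basis
   elements that are not listed are 0.  A pair (i, j) should be listed at most
   once, since the contributions of repeated pairs would add up. *)
Definition presentation4 : Type := seq ('I_4 * 'I_4 * 'rV[F]_4).

Definition presMul (rels : presentation4) (x y : 'rV[F]_4) : 'rV[F]_4 :=
  \sum_(r <- rels) (x 0 r.1.1 * y 0 r.1.2) *: r.2.

Lemma presMul_bilinear (rels : presentation4) :
  bilinear_for *:%R *:%R (presMul rels).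
Proof.
split=> [y|x] k u v; rewrite /= /presMul scaler_sumr -big_split /=;
  apply: eq_bigr => r _; rewrite !mxE scalerA -scalerDl; congr (_ *: _).
- by rewrite mulrDl mulrA.
- by rewrite mulrDr mulrCA.
Qed.

HB.instance Definition _ (rels : presentation4) :=
  bilinear_isBilinear.Build F 'rV[F]_4 'rV[F]_4 'rV[F]_4 *:%R *:%R
    (presMul rels) (presMul_bilinear rels).

Definition pres (rels : presentation4) : nuAlgebra F :=
  @NuAlgebra F 'rV[F]_4 (presMul rels).

Local Notation a := (@Ordinal 4 0 isT).
Local Notation b := (@Ordinal 4 1 isT).
Local Notation c := (@Ordinal 4 2 isT).
Local Notation d := (@Ordinal 4 3 isT).
Local Notation "''e' i" := (delta_mx 0 i : 'rV[F]_4) (at level 8, i at level 2).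

Implicit Types alpha beta gamma delta : F.

Definition A4_1 : presentation4 := [::].
Definition A4_2 : presentation4 := [:: (a, a, 'e b)].
Definition A4_3 delta : presentation4 :=
  [:: (a, a, 'e c); (b, b, delta *: 'e c)].
Definition A4_4 delta : presentation4 :=
  [:: (a, a, 'e c); (b, b, delta *: 'e c); (a, b, 'e c)].
Definition A4_5 : presentation4 := [:: (a, b, 'e c); (b, a, - 'e c)].
Definition A4_6 : presentation4 :=
  [:: (a, a, 'e b); (a, b, 'e c); (b, a, 'e c)].
Definition A4_8 alpha beta : presentation4 :=
  [:: (a, a, 'e d); (b, b, alpha *: 'e d); (c, c, beta *: 'e d)].
Definition A4_9 alpha beta : presentation4 :=
  [:: (a, a, alpha *: 'e d); (b, b, 'e d); (b, c, 'e d);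
      (c, c, beta *: 'e d)].
Definition A4_10 alpha : presentation4 :=
  [:: (a, a, 'e d); (a, b, 'e d); (b, b, alpha *: 'e d);
      (b, c, 'e d); (c, b, 'e d)].
Definition A4_11 : presentation4 :=
  [:: (a, a, 'e d); (a, b, 'e d); (c, b, 'e d); (c, c, - 'e d)].
Definition A4_12 : presentation4 :=
  [:: (a, a, 'e b); (a, b, 'e d); (b, a, 'e d); (a, c, 'e d);
      (c, c, 'e d)].
Definition A4_13 : presentation4 :=
  [:: (a, a, 'e b); (a, b, 'e d); (b, a, 'e d); (c, c, 'e d)].
Definition A4_14 : presentation4 :=
  [:: (a, a, 'e b); (a, b, 'e d); (b, a, 'e d); (a, c, 'e d)].
Definition A4_15 : presentation4 :=
  [:: (a, a, 'e b); (a, b, 'e c); (b, a, 'e c); (b, b, 'e d);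
      (a, c, 'e d); (c, a, 'e d)].
Definition A4_16 : presentation4 := [:: (a, a, 'e c); (b, a, 'e d)].
Definition A4_17 delta : presentation4 :=
  [:: (a, a, 'e c); (a, b, 'e d); (b, a, 'e d);
      (b, b, delta *: 'e c + 'e d)].
Definition A4_18 delta : presentation4 :=
  [:: (a, a, 'e c); (a, b, 'e d); (b, a, - 'e d); (b, b, delta *: 'e c)].
Definition A4_19 delta : presentation4 :=
  [:: (a, a, 'e c); (a, b, 'e d); (b, a, 'e c + 'e d);
      (b, b, delta *: 'e c)].
Definition A4_20 : presentation4 :=
  [:: (a, a, 'e c); (a, b, 'e d); (b, a, 'e c)].
Definition A4_21 delta : presentation4 :=
  [:: (a, a, 'e c); (a, b, 'e d); (b, a, delta *: 'e d)].
Definition A4_26 alpha beta gamma : presentation4 :=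
  [:: (a, a, 'e c); (a, b, 'e d); (b, a, beta *: 'e c + alpha *: 'e d);
      (b, b, gamma *: 'e c)].

End Presentation.

Arguments A4_1 {F}.
Arguments A4_2 {F}.
Arguments A4_5 {F}.
Arguments A4_6 {F}.
Arguments A4_11 {F}.
Arguments A4_12 {F}.
Arguments A4_13 {F}.
Arguments A4_14 {F}.
Arguments A4_15 {F}.
Arguments A4_16 {F}.
Arguments A4_20 {F}.

Definition Hset (F : finFieldType) (sigma : F) : {set F} :=
  [set (sigma * u * v + v ^+ 2) / (u ^+ 2 + v ^+ 2) | u in F, v in F & u != v].

(* The algebras presented by the entries of L, indexed by position, represent
   each isomorphism class of algebras satisfying P exactly once. *)
Definition listsUpToIso (F : fieldType) (P : nuAlgebra F -> Prop)
    (L : seq (presentation4 F)) : Prop :=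
  (forall i : 'I_(size L), P (pres (tnth (in_tuple L) i))) /\
  (forall A : nuAlgebra F, P A ->
     exists! i : 'I_(size L), nuIsomorphic A (pres (tnth (in_tuple L) i))).

(* Main.v *)
From HB Require Import structures.
From Stdlib Require Import Ring_polynom Ring_theory.
From Stdlib Require InitialRing.
Require Import Defs.
From mathcomp Require Import all_boot all_order all_algebra ring.

Set Implicit Arguments.
Unset Strict Implicit.
Unset Printing Implicit Defensive.

Import GRing.Theory.
Local Open Scope ring_scope.

(** The powers A, A^2, A^3, ... of a nilpotent algebra of dimension four decrease
    strictly, so that A^2 has dimension at most three.

    If A^3 = 0, then the multiplication is a tuple of linearly independent bilinear
    forms on A / A^2 with values in A^2 ([class2_formAlg]), and two such algebras
    are isomorphic exactly when their tuples agree up to a change of basis of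
    A / A^2 and of A^2 ([formEquiv_iso], [formEquiv_of_iso]).  There are two cases
    besides the zero multiplication.

    When A^2 is a line, one has to classify nonzero bilinear forms on F^3 up to
    congruence and scalars.  All elements of F are squares, so the symmetric forms
    are settled by diagonalisation ([symmetric_NF]).  A nonsymmetric form M comes
    with the line that is the radical of M - M^T, here called its axis, and the
    normal form depends on how M behaves on the axis ([nonsymmetric_NF]); the
    invariants are the rank, the value of M on the axis, the determinant of M and
    an Arf invariant ([ternary_unique]).

    When A^2 is a plane, one has to classify planes of bilinear forms on F^2.  Either
    all members of the plane are symmetric, or exactly one of them is, up to
    scalars.  In the second case the symmetric member leaves only few changes of
    basis, which are used to normalise another member ([pencil_classification]); the
    same computation shows that the normal forms are inequivalent
    ([pencil_unique]).  Several parameters are only defined modulo the additive group of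
    all t^2 + t, which has index two ([artin_schreier]); the set Hset sigma is a
    multiple of this group ([HsetP]), and gamma0 and eta sigma serve to choose
    representatives of the nontrivial class.

    If A^3 is not zero, then some a has a^3 nonzero.  Either a generates A, or
    dim A^2 = 2 and A has a basis a, a^2, a^3, c in which only a c and c^2 are left
    to normalise ([uniserial], [biserial_basis]).  The resulting five algebras
    differ in the vanishing of products of four elements, in commutativity, and
    in the existence of an element x with x A^2 = 0 and x^2 nonzero
    ([deep_label]).

    The computations are polynomial identities modulo 2 after a choice of base
    change; they are checked by a reflexive tactic. *)

(** * Polynomial identities in characteristic two *)

Section CharTwoRing.
Variable (R : comNzRingType) (char2 : 2%N \in [pchar R]).

(** The normalisation of ring expressions is run over the field with two
    elements, represented by the booleans with exclusive or and conjunction, so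
    that it also decides the identities that hold only modulo 2. *)
Definition bool_inj (b : bool) : R := if b then 1 else 0.

Lemma char2_ring_theory :
  ring_theory 0 1 +%R *%R (fun x y : R => x - y) -%R eq.
Proof.
split=> *; rewrite ?add0r ?mul1r ?mulrDl ?subrr //.
- exact: addrC.
- exact: addrA.
- exact: mulrC.
- exact: mulrA.
Qed.

Lemma bool_inj_morph :
  ring_morph 0 1 +%R *%R (fun x y : R => x - y) -%R eq
    false true addb andb addb id eqb bool_inj.
Proof.
split=> //; try by case=> [] [] //=;
  rewrite /bool_inj ?addr0 ?add0r ?subr0 ?sub0r ?mulr0 ?mul0r ?mulr1 ?oppr0
    ?subrr ?(oppr_pchar2 char2) ?(addrr_pchar2 char2).
by case=> //=; rewrite /bool_inj ?(oppr_pchar2 char2) ?oppr0.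
Qed.

Lemma char2_power_theory :
  power_theory 1 *%R eq nat_of_bin (fun (x : R) n => x ^+ n).
Proof.
split=> x [|p] //=; elim: p => [p IH|p IH|] //=.
- by rewrite natTrecE exprS -addnn exprD IH.
- by rewrite natTrecE -addnn exprD IH.
Qed.

Definition char2_ring_correct :=
  ring_correct (Eqsth R) (Eq_ext +%R *%R -%R)
    (Rth_ARth (Eqsth R) (Eq_ext +%R *%R -%R) char2_ring_theory)
    bool_inj_morph char2_power_theory
    (InitialRing.triv_div_th (Eqsth R) (Eq_ext +%R *%R -%R)
      (Rth_ARth (Eqsth R) (Eq_ext +%R *%R -%R) char2_ring_theory)
      bool_inj_morph).
End CharTwoRing.

(** The same inverse can be written through different instances of the unit
    ring structure, hence the comparison below the inverse. *)
Ltac same_atom x y :=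
  lazymatch x with
  | @GRing.inv _ ?x' =>
    lazymatch y with @GRing.inv _ ?y' => constr_eq x' y' end
  | _ => constr_eq x y
  end.

Ltac atoms_add x l :=
  lazymatch l with
  | nil => constr:(x :: nil)
  | cons ?y ?l' =>
    match goal with
    | _ => let _ := match goal with _ => same_atom x y end in l
    | _ => let l'' := atoms_add x l' in constr:(y :: l'')
    end
  end.

Ltac atoms_index x l :=
  lazymatch l with
  | cons ?y ?l' =>
    match goal with
    | _ => let _ := match goal with _ => same_atom x y end in constr:(BinNums.xH)
    | _ => let p := atoms_index x l' in
           let q := eval compute in (BinPos.Pos.succ p) in q
    end
  end.

Ltac poly_atoms t l :=
  lazymatch t with
  | @GRing.add _ ?x ?y => let l1 := poly_atoms x l in poly_atoms y l1
  | @GRing.mul _ ?x ?y => let l1 := poly_atoms x l in poly_atoms y l1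
  | @GRing.opp _ ?x => poly_atoms x l
  | @GRing.exp _ ?x _ => poly_atoms x l
  | @GRing.zero _ => l
  | @GRing.one _ => l
  | @eq _ ?x ?y => let l1 := poly_atoms x l in poly_atoms y l1
  | _ => atoms_add t l
  end.

Ltac poly_reify t l :=
  lazymatch t with
  | @GRing.add _ ?x ?y =>
    let a := poly_reify x l in let b := poly_reify y l in
    constr:(PEadd a b)
  | @GRing.mul _ ?x ?y =>
    let a := poly_reify x l in let b := poly_reify y l in
    constr:(PEmul a b)
  | @GRing.opp _ ?x => let a := poly_reify x l in constr:(PEopp a)
  | @GRing.exp _ ?x ?n =>
    let a := poly_reify x l in
    let m := eval compute in (bin_of_nat n) in constr:(PEpow a m)
  | @GRing.zero _ => constr:(PEc false)
  | @GRing.one _ => constr:(PEc true)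
  | _ => let p := atoms_index t l in constr:(@PEX bool p)
  end.

Ltac hyps_atoms hs l :=
  lazymatch hs with
  | (?hs', ?h) => let l1 := hyps_atoms hs' l in
    let t := type of h in poly_atoms t l1
  | tt => l
  end.

Ltac hyps_reify hs l :=
  lazymatch hs with
  | (?hs', ?h) => let r := hyps_reify hs' l in
    lazymatch type of h with
    | ?x = ?y => let a := poly_reify x l in let b := poly_reify y l in
      constr:((a, b) :: r)
    end
  | tt => constr:(@nil (PExpr bool * PExpr bool))
  end.

Ltac hyps_proof hs :=
  lazymatch hs with
  | (tt, ?h) => exact h
  | (?hs', ?h) => split; [exact h | hyps_proof hs']
  | tt => exact I
  end.

(** [char2_ring char2 (tt, h1, h2)] proves an equation between polynomial
    expressions modulo 2, using h1 and h2 as rewriting rules; their left hand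
    sides must be monomials.  Division is treated by passing x * x^-1 = 1 as a
    rule for each x that is inverted.  The last rule is applied first, so rules
    that eliminate a variable must come after those for inverses. *)
Ltac char2_ring char2 hs :=
  lazymatch goal with
  | |- @eq ?R ?x ?y =>
    let t := constr:(x = y) in
    let l := hyps_atoms hs (@nil R) in
    let l := poly_atoms t l in
    let lpe := hyps_reify hs l in
    let a := poly_reify x l in
    let b := poly_reify y l in
    refine (@char2_ring_correct _ char2 100 l lpe a b _ _);
    [hyps_proof hs | vm_compute; reflexivity]
  end.

(** * Isomorphisms *)

Section Isomorphism.
Variable F : fieldType.
Implicit Types A B C : nuAlgebra F.

Lemma bijective_linear_inv (U V : vectType F) (f : {linear U -> V}) :
  bijective f -> exists g : {linear V -> U}, cancel f g /\ cancel g f.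
Proof.
case=> g fK gK.
have lin_g : linear g by move=> k u v; apply: (can_inj fK); rewrite linearP !gK.
pose gL := GRing.isLinear.Build _ _ _ _ g lin_g.
by exists (HB.pack g gL : {linear V -> U}).
Qed.

Lemma nuIsoE A B (f : {linear A -> B}) (g : {linear B -> A}) :
  cancel f g -> cancel g f ->
  (forall x y, f (nuMul A x y) = nuMul B (f x) (f y)) -> nuIsomorphic A B.
Proof. by move=> fK gK fM; exists f; split=> //; exists g. Qed.

Lemma nuIsoP A B : nuIsomorphic A B ->
  exists (f : {linear A -> B}) (g : {linear B -> A}),
  [/\ cancel f g, cancel g f,
      (forall x y, f (nuMul A x y) = nuMul B (f x) (f y)) &
      (forall x y, g (nuMul B x y) = nuMul A (g x) (g y))].
Proof.
case=> f [/bijective_linear_inv[g [fK gK]] fM]; exists f, g; split=> // x y.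
by apply: (can_inj fK); rewrite fM !gK.
Qed.

Lemma nuIso_sym A B : nuIsomorphic A B -> nuIsomorphic B A.
Proof.
by case/nuIsoP=> f [g [fK gK _ gM]]; apply: (nuIsoE gK fK gM).
Qed.

Lemma nuIso_trans A B C :
  nuIsomorphic A B -> nuIsomorphic B C -> nuIsomorphic A C.
Proof.
case=> f [bf fM] [g [bg gM]]; exists (g \o f); split; first exact: bij_comp.
by move=> x y /=; rewrite fM gM.
Qed.

Lemma linear_inj_bij (U V : vectType F) (f : {linear U -> V}) :
  injective f -> \dim {:U} = \dim {:V} -> bijective f.
Proof.
move=> f_inj dimUV; have kf : lker (linfun f) == 0%VS.
  by apply/lker0P => x y; rewrite !lfunE => /f_inj.
have imf : limg (linfun f) = fullv.
  by apply/eqP; rewrite eqEdim subvf /= limg_dim_eq ?dimUV // (eqP kf) capv0.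
exists (fun v => (linfun f)^-1%VF v) => x.
  by rewrite -[f x](lfunE f) lker0_lfunK.
have /memv_imgP[u _ ->] : x \in limg (linfun f) by rewrite imf memvf.
by rewrite lker0_lfunK // lfunE.
Qed.

End Isomorphism.

(** * Algebras given by tuples of bilinear forms *)

Section FormAlgebra.
Variables (F : fieldType) (m n : nat).
Implicit Types B : 'I_n -> 'M[F]_m.

Definition bform (M : 'M[F]_m) (x y : 'rV[F]_m) : F := (x *m M *m y^T) 0 0.

Lemma bform_linl M x x' y k :
  bform M (k *: x + x') y = k * bform M x y + bform M x' y.
Proof. by rewrite /bform !mulmxDl -!scalemxAl mxE [in LHS]mxE. Qed.

Lemma bform_linr M x y y' k :
  bform M x (k *: y + y') = k * bform M x y + bform M x y'.
Proof.
by rewrite /bform linearP mulmxDr -scalemxAr mxE [in LHS]mxE.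
Qed.

Lemma bform_congr M (P : 'M[F]_m) v w :
  bform (P *m M *m P^T) v w = bform M (v *m P) (w *m P).
Proof. by rewrite /bform trmx_mul !mulmxA. Qed.

Lemma bformE M x y : bform M x y = \sum_i \sum_j x 0 i * M i j * y 0 j.
Proof.
rewrite /bform mxE exchange_big; apply: eq_bigr => j _.
by rewrite [(_ *m M) _ _]mxE [y^T _ _]mxE mulr_suml.
Qed.

Definition formMul B (x y : 'rV[F]_m * 'rV[F]_n) : 'rV[F]_m * 'rV[F]_n :=
  (0, \row_k bform (B k) x.1 y.1).

Lemma formMul_bilinear B : bilinear_for *:%R *:%R (formMul B).
Proof.
split=> [y|x] k u v; congr pair; rewrite /= ?scaler0 ?addr0 //; apply/rowP=> l;
  by rewrite !mxE ?bform_linl ?bform_linr.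
Qed.

HB.instance Definition _ B :=
  bilinear_isBilinear.Build F ('rV[F]_m * 'rV[F]_n)%type
    ('rV[F]_m * 'rV[F]_n)%type ('rV[F]_m * 'rV[F]_n)%type *:%R *:%R
    (formMul B) (formMul_bilinear B).

(** Every algebra in which all products of three elements vanish is of this
    form: the first summand is a complement of the square of the algebra, the
    second one is the square, and B lists the coordinates of the product. *)
Definition formAlg B : nuAlgebra F :=
  @NuAlgebra F ('rV[F]_m * 'rV[F]_n)%type (formMul B).

(** P changes the basis of the space on which the forms live, T replaces the
    forms by another basis of their span. *)
Definition formEquiv B B' : Prop :=
  exists (P : 'M[F]_m) (T : 'M[F]_n), [/\ P \in unitmx, T \in unitmx &
    forall k, B' k = \sum_l T k l *: (P *m B l *m P^T)].

End FormAlgebra.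

Section FormEquiv.
Variables (F : fieldType) (m n : nat).
Implicit Types B : 'I_n -> 'M[F]_m.

Lemma formEquiv_refl B : formEquiv B B.
Proof.
exists 1%:M, 1%:M; split; rewrite ?unitmx1 // => k.
rewrite (bigD1 k) //= big1 ?addr0 => [|l /negPf lk].
  by rewrite mxE eqxx scale1r trmx1 mulmx1 mul1mx.
by rewrite mxE eq_sym lk scale0r.
Qed.

Lemma formEquiv_sym B B' : formEquiv B B' -> formEquiv B' B.
Proof.
case=> P [T [uP uT defB']]; exists (invmx P), (invmx T).
split; rewrite ?unitmx_inv // => k.
have congrK M : invmx P *m (P *m M *m P^T) *m (invmx P)^T = M.
  by rewrite !mulmxA mulVmx // mul1mx -mulmxA -trmx_mul mulVmx // trmx1 mulmx1.
under eq_bigr => l _.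
  rewrite defB' mulmx_sumr mulmx_suml scaler_sumr.
  under eq_bigr => i _ do rewrite -scalemxAr -scalemxAl congrK scalerA.
  over.
rewrite exchange_big /=.
under eq_bigr => i _ do rewrite -scaler_suml.
have VT i : \sum_l invmx T k l * T l i = (k == i)%:R.
  by have := congr1 (fun M : 'M_n => M k i) (mulVmx uT); rewrite !mxE.
under eq_bigr => i _ do rewrite VT.
rewrite (bigD1 k) //= eqxx scale1r big1 ?addr0 // => i.
by rewrite eq_sym => /negPf->; rewrite scale0r.
Qed.

Lemma formEquiv_trans B1 B2 B3 :
  formEquiv B1 B2 -> formEquiv B2 B3 -> formEquiv B1 B3.
Proof.
case=> P [T [uP uT defB2]] [P' [T' [uP' uT' defB3]]].
exists (P' *m P), (T' *m T); split; rewrite ?unitmx_mul ?uP ?uT ?uP' ?uT' //.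
move=> k; rewrite defB3.
under eq_bigr => l _.
  rewrite defB2 mulmx_sumr mulmx_suml scaler_sumr.
  under eq_bigr => i _ do rewrite -scalemxAr -scalemxAl scalerA.
  over.
rewrite exchange_big /=; apply: eq_bigr => i _.
rewrite -scaler_suml mxE trmx_mul !mulmxA; congr (_ *: _).
Qed.

Lemma formEquiv_iso B B' :
  formEquiv B B' -> nuIsomorphic (formAlg B) (formAlg B').
Proof.
case=> P [T [uP uT defB']].
pose f (x : formAlg B) : formAlg B' := (x.1 *m invmx P, x.2 *m T^T).
have lin_f : linear f.
  by move=> k x y; rewrite /f /= !mulmxDl -!scalemxAl.
pose g (x : formAlg B') : formAlg B := (x.1 *m P, x.2 *m (invmx T)^T).
have lin_g : linear g.
  by move=> k x y; rewrite /g /= !mulmxDl -!scalemxAl.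
pose fL := GRing.isLinear.Build _ _ _ _ f lin_f.
pose gL := GRing.isLinear.Build _ _ _ _ g lin_g.
pose f' : {linear formAlg B -> formAlg B'} := HB.pack f fL.
pose g' : {linear formAlg B' -> formAlg B} := HB.pack g gL.
apply: (@nuIsoE _ _ _ f' g').
- case=> x u; rewrite /= /f /g /= mulmxKV // -mulmxA -trmx_mul mulVmx //.
  by rewrite trmx1 mulmx1.
- case=> x u; rewrite /= /f /g /= mulmxK // -mulmxA -trmx_mul mulmxV //.
  by rewrite trmx1 mulmx1.
case=> x u [y v]; rewrite /= /f /formMul /= mul0mx; congr pair.
apply/rowP=> k; rewrite !mxE /bform defB' mulmx_sumr mulmx_suml summxE.
apply: eq_bigr => l _; rewrite -scalemxAr -scalemxAl [RHS]mxE mulrC.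
rewrite [T^T _ _]mxE mxE; congr (_ * _).
rewrite -[in LHS](mulmxKV uP x) -[in LHS](mulmxKV uP y).
by rewrite trmx_mul !mulmxA.
Qed.

(** Equivalently, the products span the whole second summand of the algebra. *)
Definition formFree B : Prop :=
  forall t : 'rV[F]_n, \sum_k t 0 k *: B k = 0 -> t = 0.

Lemma bform_delta (M : 'M[F]_m) i j :
  bform M (delta_mx 0 i) (delta_mx 0 j) = M i j.
Proof.
by rewrite /bform -rowE trmx_delta -colE !mxE.
Qed.

Lemma pair_linear_blocks 
    (h : {linear ('rV[F]_m * 'rV[F]_n)%type -> ('rV[F]_m * 'rV[F]_n)%type}) :
  exists P G Q T, forall x u, h (x, u) = (x *m P + u *m G, x *m Q + u *m T).
Proof.
have fstP k v w : (k *: v + w, 0) = k *: (v, 0) + (w, 0) :> ('rV[F]_m * 'rV[F]_n)%type.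
  by rewrite -[RHS]/(k *: v + w, k *: 0 + 0) scaler0 addr0.
have sndP k v w : (0, k *: v + w) = k *: (0, v) + (0, w) :> ('rV[F]_m * 'rV[F]_n)%type.
  by rewrite -[RHS]/(k *: 0 + 0, k *: v + w) scaler0 addr0.
have toMatrix p q (g : 'rV[F]_p -> 'rV[F]_q) :
    linear g -> exists M, forall v, g v = v *m M.
  move=> lin_g; pose gL := GRing.isLinear.Build _ _ _ _ g lin_g.
  pose g' : {linear 'rV[F]_p -> 'rV[F]_q} := HB.pack g gL.
  by exists (lin1_mx g') => v; rewrite mul_rV_lin1.
have [P defP] : exists P, forall x, (h (x, 0)).1 = x *m P.
  by apply: (toMatrix _ _ (fun x => (h (x, 0)).1)) => k v w; rewrite fstP linearP.
have [G defG] : exists G, forall u, (h (0, u)).1 = u *m G.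
  by apply: (toMatrix _ _ (fun u => (h (0, u)).1)) => k v w; rewrite sndP linearP.
have [Q defQ] : exists Q, forall x, (h (x, 0)).2 = x *m Q.
  by apply: (toMatrix _ _ (fun x => (h (x, 0)).2)) => k v w; rewrite fstP linearP.
have [T defT] : exists T, forall u, (h (0, u)).2 = u *m T.
  by apply: (toMatrix _ _ (fun u => (h (0, u)).2)) => k v w; rewrite sndP linearP.
exists P, G, Q, T => x u; rewrite -defP -defG -defQ -defT.
have -> : (x, u) = (x, 0) + (0, u) :> ('rV[F]_m * 'rV[F]_n)%type.
  by rewrite -[RHS]/(x + 0, 0 + u) addr0 add0r.
by rewrite linearD [LHS]surjective_pairing.
Qed.

(** A homomorphism sends products to products, and these span the second
    summand of the source and lie in that of the target; so the block G from the
    second to the first summand vanishes. *)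
Lemma formFree_blocks B B' (f : {linear formAlg B -> formAlg B'}) :
  formFree B -> (forall x y, f (nuMul _ x y) = nuMul _ (f x) (f y)) ->
  exists P Q T, forall x u, f (x, u) = (x *m P, x *m Q + u *m T).
Proof.
move=> freeB fM; have [P [G [Q [T fE]]]] := pair_linear_blocks f.
suff G0 : G = 0.
  by exists P, Q, T => x u; rewrite fE G0 mulmx0 addr0.
apply/matrixP=> k j; rewrite [RHS]mxE.
suff /rowP/(_ k) : row j G^T = 0 by rewrite !mxE.
apply: freeB.
apply/matrixP=> i i'; rewrite summxE mxE.
have /(congr1 fst) := fM (delta_mx 0 i, 0) (delta_mx 0 i', 0).
rewrite /= /formMul fE /= mul0mx add0r.
move/rowP/(_ j); rewrite !mxE => E0; rewrite -[RHS]E0; apply: eq_bigr => l _.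
by rewrite !mxE bform_delta mulrC.
Qed.

(** Both an isomorphism and its inverse are block triangular, so their diagonal
    blocks are mutually inverse and provide the two changes of basis. *)
Lemma formEquiv_of_iso B B' : formFree B -> formFree B' ->
  nuIsomorphic (formAlg B) (formAlg B') -> formEquiv B B'.
Proof.
move=> freeB freeB' /nuIsoP[f [g [fK gK fM gM]]].
have [P [Q [T fE]]] := formFree_blocks freeB fM.
have [P' [Q' [T' gE]]] := formFree_blocks freeB' gM.
have PP' : P *m P' = 1%:M.
  apply/row_matrixP=> i; have := congr1 fst (fK (delta_mx 0 i, 0)).
  by rewrite /= fE gE /= row1 rowE mulmxA.
have TT' : T *m T' = 1%:M.
  apply/row_matrixP=> i; have := congr1 snd (fK (0, delta_mx 0 i)).
  by rewrite /= fE gE /= !mul0mx !add0r row1 rowE mulmxA.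
apply: formEquiv_sym.
have [uP _] := mulmx1_unit PP'; have [_ uT] := mulmx1_unit TT'.
exists P, T'^T; split; rewrite ?unitmx_tr // => k.
apply/matrixP=> i j; rewrite summxE.
have /(congr1 snd) := fM (delta_mx 0 i, 0) (delta_mx 0 j, 0).
rewrite /= /formMul !fE /= mul0mx add0r => /(congr1 (mulmx^~ T')).
rewrite -mulmxA TT' mulmx1 => /rowP/(_ k); rewrite !mxE bform_delta => ->.
apply: eq_bigr => l _; rewrite [RHS]mxE [T'^T _ _]mxE mulrC; congr (_ * _).
by rewrite mxE -[RHS]bform_delta /bform trmx_mul !mulmxA.
Qed.

End FormEquiv.

(** * Finite fields of characteristic 2 *)

Section CharTwoField.
Variables (F : finFieldType) (char2 : 2%N \in [pchar F]).

Lemma addrr2 (x : F) : x + x = 0.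
Proof. exact: addrr_pchar2. Qed.

Lemma oppr2 (x : F) : - x = x.
Proof. exact: oppr_pchar2. Qed.

Lemma eq_of_add2 (x y : F) : x + y = 0 -> x = y.
Proof. by move/eqP; rewrite addr_eq0 oppr2 => /eqP. Qed.

Lemma add2_neq0 (x y : F) : (x + y != 0) = (x != y).
Proof. by rewrite addr_eq0 oppr2. Qed.

Lemma sqrt2 (x : F) : exists y, y ^+ 2 = x.
Proof.
have inj2 : injective (fun y : F => y ^+ 2).
  move=> y z /= eq_yz; apply: eq_of_add2; apply/eqP.
  rewrite -sqrf_eq0; apply/eqP.
  have -> : (y + z) ^+ 2 = y ^+ 2 + z ^+ 2 by char2_ring char2 tt.
  by rewrite eq_yz addrr2.
by have [g _ gK] := injF_bij inj2; exists (g x).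
Qed.

Lemma sqrt2_neq0 (x : F) : x != 0 -> exists2 y, y != 0 & y ^+ 2 = x.
Proof.
by have [y yx] := sqrt2 x => x0; exists y; rewrite // -sqrf_eq0 yx.
Qed.

(** The map t |-> t^2 + t is additive with kernel {0, 1}, so its image has
    index two and gamma0 represents the nontrivial coset. *)
Lemma artin_schreier (gamma0 : F) :
  gamma0 \notin [set t ^+ 2 + t | t : F] ->
  forall y, exists t, y + t ^+ 2 + t \in [:: 0; gamma0].
Proof.
move=> g0 y; pose AS := [set t ^+ 2 + t | t : F].
pose AS' := [set gamma0 + x | x in AS].
have dis : [disjoint AS & AS'].
  apply/pred0P=> x /=; apply/negP=> /andP[/imsetP[t _ ->]].
  case/imsetP=> _ /imsetP[u _ ->] E; case/imsetP: g0; exists (t + u) => //.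
  have -> : gamma0 = (t ^+ 2 + t) + (u ^+ 2 + u).
    by rewrite E; char2_ring char2 tt.
  by char2_ring char2 tt.
have cardAS' : #|AS'| = #|AS| by apply: card_imset; exact: addrI.
(* r chooses a preimage of each t^2 + t, which is t or t + 1. *)
have cardAS : (#|F| <= #|AS| + #|AS|)%N.
  pose r (x : F) := odflt 0 [pick t | t ^+ 2 + t == x].
  have rP t : r (t ^+ 2 + t) = t \/ r (t ^+ 2 + t) = t + 1.
    rewrite /r; case: pickP => [u /eqP Eu|/(_ t)]; last by rewrite eqxx.
    have : (u + t) * (u + t + 1) = 0.
      have -> : (u + t) * (u + t + 1) = (u ^+ 2 + u) + (t ^+ 2 + t).
        by char2_ring char2 tt.
      by rewrite Eu addrr2.
    move/eqP; rewrite mulf_eq0 => /orP[]/eqP E; [left|right]; apply: eq_of_add2.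
      by [].
    by rewrite addrA.
  pose R := [set r x | x in AS].
  have cR : (#|R| <= #|AS|)%N by exact: leq_imset_card.
  have cR' : (#|[set (x + 1)%R | x in R]| <= #|AS|)%N.
    exact: leq_trans (leq_imset_card _ _) cR.
  apply: leq_trans (leq_add cR cR').
  apply: leq_trans (_ : #|R :|: [set (x + 1)%R | x in R]| <= _)%N; last first.
    by rewrite cardsU leq_subr.
  rewrite -cardsT; apply/subset_leq_card/subsetP=> t _; rewrite inE.
  have rR : r (t ^+ 2 + t) \in R by apply/imset_f/imset_f.
  case: (rP t) => E; first by rewrite -E rR.
  apply/orP; right; apply/imsetP; exists (r (t ^+ 2 + t)) => //.
  by rewrite E; char2_ring char2 tt.
have : y \in AS :|: AS'.
  suff -> : AS :|: AS' = [set: F] by rewrite inE.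
  apply/eqP; rewrite eqEcard subsetT cardsU (disjoint_setI0 dis) cards0 subn0.
  by rewrite cardsT cardAS'.
rewrite inE => /orP[/imsetP[t _ ->]|/imsetP[_ /imsetP[t _ ->] ->]]; exists t.
  by rewrite !inE; apply/orP; left; apply/eqP; char2_ring char2 tt.
by rewrite !inE; apply/orP; right; apply/eqP; char2_ring char2 tt.
Qed.

End CharTwoField.

(** * Bilinear forms on a space of dimension three *)

Section TernaryForms.
Variables (F : finFieldType) (char2 : 2%N \in [pchar F]).
Implicit Types M N : 'M[F]_3.

Definition similarForms n (M N : 'M[F]_n) : Prop :=
  exists (P : 'M[F]_n) (s : F),
    [/\ P \in unitmx, s != 0 & N = s *: (P *m M *m P^T)].

Lemma similar_formEquiv n (M N : 'M[F]_n) :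
  similarForms M N <-> formEquiv (fun _ : 'I_1 => M) (fun _ => N).
Proof.
split=> [[P [s [uP s0 ->]]]|[P [T [uP uT defN]]]].
  exists P, s%:M; split=> // [|k]; last by rewrite big_ord1 !ord1 mxE eqxx.
  by rewrite unitmxE det_scalar expr1 unitfE.
exists P, (T 0 0); split=> //; last by rewrite (defN 0) big_ord1.
by move: uT; rewrite unitmxE {1}[T]mx11_scalar det_scalar expr1 unitfE.
Qed.

Lemma similar_refl n (M : 'M[F]_n) : similarForms M M.
Proof. exact/similar_formEquiv/formEquiv_refl. Qed.

Lemma similar_sym n (M N : 'M[F]_n) : similarForms M N -> similarForms N M.
Proof. by move/similar_formEquiv/formEquiv_sym/similar_formEquiv. Qed.

Lemma similar_trans n (N M M' : 'M[F]_n) :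
  similarForms M N -> similarForms N M' -> similarForms M M'.
Proof.
move=> /similar_formEquiv MN /similar_formEquiv NM'.
exact/similar_formEquiv/(formEquiv_trans MN NM').
Qed.

Definition mx3 (a b c d e f g h i : F) : 'M[F]_3 :=
  \matrix_(k, l) nth 0 (nth [::] [:: [:: a; b; c]; [:: d; e; f]; [:: g; h; i]] k) l.

Definition row3 (a b c : F) : 'rV[F]_3 := \row_k nth 0 [:: a; b; c] k.

Definition o0 : 'I_3 := @Ordinal 3 0 isT.
Definition o1 : 'I_3 := @Ordinal 3 1 isT.
Definition o2 : 'I_3 := @Ordinal 3 2 isT.

Lemma ord3P (P : 'I_3 -> Prop) : P o0 -> P o1 -> P o2 -> forall i, P i.
Proof.
move=> P0 P1 P2 [[|[|[|//]]] lti].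
- by rewrite (_ : Ordinal lti = o0) //; apply: val_inj.
- by rewrite (_ : Ordinal lti = o1) //; apply: val_inj.
- by rewrite (_ : Ordinal lti = o2) //; apply: val_inj.
Qed.

Lemma sum3 (f : 'I_3 -> F) : \sum_i f i = f o0 + f o1 + f o2.
Proof.
rewrite !big_ord_recl big_ord0 addr0 addrA.
by congr (_ + _ + _); congr f; apply: val_inj.
Qed.

Lemma mx3_eta M :
  M = mx3 (M o0 o0) (M o0 o1) (M o0 o2) (M o1 o0) (M o1 o1) (M o1 o2)
          (M o2 o0) (M o2 o1) (M o2 o2).
Proof. by apply/matrixP; elim/ord3P; elim/ord3P; rewrite mxE. Qed.

Lemma row3_eta (v : 'rV[F]_3) : v = row3 (v 0 o0) (v 0 o1) (v 0 o2).
Proof. by apply/rowP; elim/ord3P; rewrite mxE. Qed.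

Lemma mulmx3 (a b c d e f g h i a' b' c' d' e' f' g' h' i' : F) :
  mx3 a b c d e f g h i *m mx3 a' b' c' d' e' f' g' h' i' =
  mx3 (a * a' + b * d' + c * g') (a * b' + b * e' + c * h')
      (a * c' + b * f' + c * i')
      (d * a' + e * d' + f * g') (d * b' + e * e' + f * h')
      (d * c' + e * f' + f * i')
      (g * a' + h * d' + i * g') (g * b' + h * e' + i * h')
      (g * c' + h * f' + i * i').
Proof. by apply/matrixP; elim/ord3P; elim/ord3P; rewrite mxE sum3 !mxE. Qed.

Lemma trmx3 (a b c d e f g h i : F) :
  (mx3 a b c d e f g h i)^T = mx3 a d g b e h c f i.
Proof. by apply/matrixP; elim/ord3P; elim/ord3P; rewrite !mxE. Qed.

Lemma scalemx3 (s a b c d e f g h i : F) :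
  s *: mx3 a b c d e f g h i =
  mx3 (s * a) (s * b) (s * c) (s * d) (s * e) (s * f) (s * g) (s * h) (s * i).
Proof. by apply/matrixP; elim/ord3P; elim/ord3P; rewrite !mxE. Qed.

Lemma mul_row3 (x y z a b c d e f g h i : F) :
  row3 x y z *m mx3 a b c d e f g h i =
  row3 (x * a + y * d + z * g) (x * b + y * e + z * h) (x * c + y * f + z * i).
Proof. by apply/rowP; elim/ord3P; rewrite mxE sum3 !mxE. Qed.

Lemma det2 (M : 'M[F]_2) :
  \det M = M ord0 ord0 * M ord_max ord_max - M ord0 ord_max * M ord_max ord0.
Proof.
rewrite (expand_det_row _ ord0) big_ord_recl big_ord1 /cofactor !det_mx11 !mxE.
have -> : lift ord0 ord0 = ord_max :> 'I_2 by exact: val_inj.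
have -> : lift ord_max ord0 = ord0 :> 'I_2 by exact: val_inj.
by rewrite /= addn0 expr0 expr1 mul1r mulN1r mulrN.
Qed.

Lemma det_mx3 (a b c d e f g h i : F) :
  \det (mx3 a b c d e f g h i) =
  a * (e * i - f * h) - b * (d * i - f * g) + c * (d * h - e * g).
Proof.
rewrite (expand_det_row _ ord0) !big_ord_recl big_ord0 /cofactor !det2.
by rewrite !mxE /=; ring.
Qed.

(** The entrywise form of the definition: once the rows of P, its determinant D
    and the factor s are given, only polynomial identities remain. *)
Lemma similar3I (D s p1 p2 p3 q1 q2 q3 r1 r2 r3
    a b c d e f g h i a' b' c' d' e' f' g' h' i' : F) :
  D != 0 -> s != 0 ->
  D = p1 * (q2 * r3 - q3 * r2) - p2 * (q1 * r3 - q3 * r1)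
    + p3 * (q1 * r2 - q2 * r1) ->
  a' = s * ((p1 * a + p2 * d + p3 * g) * p1 + (p1 * b + p2 * e + p3 * h) * p2
    + (p1 * c + p2 * f + p3 * i) * p3) ->
  b' = s * ((p1 * a + p2 * d + p3 * g) * q1 + (p1 * b + p2 * e + p3 * h) * q2
    + (p1 * c + p2 * f + p3 * i) * q3) ->
  c' = s * ((p1 * a + p2 * d + p3 * g) * r1 + (p1 * b + p2 * e + p3 * h) * r2
    + (p1 * c + p2 * f + p3 * i) * r3) ->
  d' = s * ((q1 * a + q2 * d + q3 * g) * p1 + (q1 * b + q2 * e + q3 * h) * p2
    + (q1 * c + q2 * f + q3 * i) * p3) ->
  e' = s * ((q1 * a + q2 * d + q3 * g) * q1 + (q1 * b + q2 * e + q3 * h) * q2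
    + (q1 * c + q2 * f + q3 * i) * q3) ->
  f' = s * ((q1 * a + q2 * d + q3 * g) * r1 + (q1 * b + q2 * e + q3 * h) * r2
    + (q1 * c + q2 * f + q3 * i) * r3) ->
  g' = s * ((r1 * a + r2 * d + r3 * g) * p1 + (r1 * b + r2 * e + r3 * h) * p2
    + (r1 * c + r2 * f + r3 * i) * p3) ->
  h' = s * ((r1 * a + r2 * d + r3 * g) * q1 + (r1 * b + r2 * e + r3 * h) * q2
    + (r1 * c + r2 * f + r3 * i) * q3) ->
  i' = s * ((r1 * a + r2 * d + r3 * g) * r1 + (r1 * b + r2 * e + r3 * h) * r2
    + (r1 * c + r2 * f + r3 * i) * r3) ->
  similarForms (mx3 a b c d e f g h i) (mx3 a' b' c' d' e' f' g' h' i').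
Proof.
move=> D0 s0 detP; do 9 move=> ->.
exists (mx3 p1 p2 p3 q1 q2 q3 r1 r2 r3), s; split=> //.
  by rewrite unitmxE unitfE det_mx3 -detP.
by rewrite trmx3 !mulmx3 scalemx3.
Qed.

Lemma similar_swap12 a b c d e f g h i :
  similarForms (mx3 a b c d e f g h i) (mx3 e d f b a c h g i).
Proof.
by apply: (@similar3I 1 1 0 1 0 1 0 0 0 0 1); rewrite ?oner_neq0 //;
  char2_ring char2 tt.
Qed.

Lemma similar_swap13 a b c d e f g h i :
  similarForms (mx3 a b c d e f g h i) (mx3 i h g f e d c b a).
Proof.
by apply: (@similar3I 1 1 0 0 1 0 1 0 1 0 0); rewrite ?oner_neq0 //;
  char2_ring char2 tt.
Qed.

Lemma similar_swap23 a b c d e f g h i :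
  similarForms (mx3 a b c d e f g h i) (mx3 a c b g i h d f e).
Proof.
by apply: (@similar3I 1 1 1 0 0 0 0 1 0 1 0); rewrite ?oner_neq0 //;
  char2_ring char2 tt.
Qed.

(** ** Symmetric forms *)

Definition symNF M := [\/ M = mx3 1 0 0 0 0 0 0 0 0, M = mx3 1 0 0 0 1 0 0 0 0,
  M = mx3 0 1 0 1 0 0 0 0 0 | M = mx3 1 0 0 0 1 0 0 0 1].

Lemma similar_alternating b c f : [|| b != 0, c != 0 | f != 0] ->
  similarForms (mx3 0 b c b 0 f c f 0) (mx3 0 1 0 1 0 0 0 0 0).
Proof.
wlog b0 : b c f / b != 0 => [hwlog|_].
  have [->|b0] := eqVneq b 0; last by move=> _; apply: hwlog; rewrite ?b0.
  have [->|c0] := eqVneq c 0 => /= [f0|_].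
    apply: similar_trans (similar_swap13 _ _ _ _ _ _ _ _ _) _.
    by apply: hwlog; rewrite ?f0.
  apply: similar_trans (similar_swap23 _ _ _ _ _ _ _ _ _) _.
  by apply: hwlog; rewrite ?c0.
apply: (@similar3I 1 b^-1 1 0 0 0 1 0 (f / b) (c / b) 1);
  rewrite ?invr_eq0 ?oner_neq0 //; by char2_ring char2 (tt, mulfV b0).
Qed.

(** A nonalternating symmetric form is diagonalisable, and all diagonal entries
    are squares.  The plane spanned by an alternating block becomes
    diagonalisable after adding a line on which the form does not vanish. *)
Lemma symmetric_NF a b c e f i : mx3 a b c b e f c f i != 0 ->
  exists2 N, symNF N & similarForms (mx3 a b c b e f c f i) N.
Proof.
wlog a0 : a b c e f i / a != 0 => [hwlog M0|_].
  have [a0|] := eqVneq a 0; last by move=> a0; apply: hwlog.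
  have [e0|e0] := eqVneq e 0; last first.
    have [|N nfN sN] := hwlog e b f a c i e0.
      by apply: contraNneq e0 => /matrixP/(_ o0 o0); rewrite !mxE /= => ->.
    by exists N => //; apply: similar_trans sN; apply: similar_swap12.
  have [i0|i0] := eqVneq i 0; last first.
    have [|N nfN sN] := hwlog i f c e b a i0.
      by apply: contraNneq i0 => /matrixP/(_ o0 o0); rewrite !mxE /= => ->.
    by exists N => //; apply: similar_trans sN; apply: similar_swap13.
  rewrite {a}a0 {e}e0 {i}i0 in M0 *.
  exists (mx3 0 1 0 1 0 0 0 0 0); first by constructor 3.
  apply: similar_alternating; apply: contraNT M0.
  rewrite !negb_or !negbK => /and3P[/eqP-> /eqP-> /eqP->].
  by apply/eqP/matrixP; elim/ord3P; elim/ord3P; rewrite !mxE.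
suff [N nfN sN] : exists2 N, symNF N &
    similarForms (mx3 1 0 0 0 ((e + b * b / a) / a) ((f + b * c / a) / a)
             0 ((f + b * c / a) / a) ((i + c * c / a) / a)) N.
  exists N => //; apply: similar_trans sN.
  by apply: (@similar3I 1 a^-1 1 0 0 (b / a) 1 0 (c / a) 0 1);
    rewrite ?invr_eq0 ?oner_neq0 //; char2_ring char2 (tt, mulfV a0).
move: (_ / a) (_ / a) (_ / a) => {a0 a b c e f i} i f e.
wlog e0 : e f i / (e == 0) ==> (i == 0) => [hwlog|].
  have [e0|e0] := eqVneq e 0; last by apply: hwlog; rewrite (negPf e0).
  have [i0|i0] := eqVneq i 0; first by apply: hwlog; rewrite i0 eqxx implybT.
  have [|N nfN sN] := hwlog i f e; first by rewrite (negPf i0).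
  by exists N => //; apply: similar_trans sN; apply: similar_swap23.
have [e1|e1] := eqVneq e 0.
  move: e0; rewrite e1 eqxx /= => /eqP->.
  have [->|f0] := eqVneq f 0.
    by exists (mx3 1 0 0 0 0 0 0 0 0); [constructor 1|apply: similar_refl].
  exists (mx3 1 0 0 0 1 0 0 0 1); first by constructor 4.
  (* An orthonormal basis of the sum of a line and a hyperbolic plane. *)
  by apply: (@similar3I f^-1 1 1 1 0 1 0 f^-1 1 1 f^-1);
    rewrite ?invr_eq0 ?oner_neq0 //; char2_ring char2 (tt, mulfV f0).
have [x x0 xe] := sqrt2_neq0 char2 e1.
suff [N nfN sN] : exists2 N, symNF N &
    similarForms (mx3 1 0 0 0 1 0 0 0 (i + f * f * x^-1 ^+ 2)) N.
  exists N => //; apply: similar_trans sN.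
  by apply: (@similar3I x^-1 1 1 0 0 0 x^-1 0 0 (f * x^-1 ^+ 2) 1);
    rewrite ?invr_eq0 ?oner_neq0 //;
    char2_ring char2 (tt, mulfV x0, esym xe).
move: (i + _) => {e0}{}i; have [->|i0] := eqVneq i 0.
  by exists (mx3 1 0 0 0 1 0 0 0 0); [constructor 2|apply: similar_refl].
have [y y0 yi] := sqrt2_neq0 char2 i0.
exists (mx3 1 0 0 0 1 0 0 0 1); first by constructor 4.
by apply: (@similar3I y^-1 1 1 0 0 0 1 0 0 0 y^-1);
  rewrite ?invr_eq0 ?oner_neq0 //; char2_ring char2 (tt, esym yi, mulfV y0).
Qed.

(** ** Nonsymmetric forms *)

(** The third basis vector is replaced by the radical of the alternating form
    M - M^T; the new form is symmetric except for one pair of entries. *)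
Lemma nonsym_adapt a b c d e f g h i : b != d ->
  exists p q r, similarForms (mx3 a b c d e f g h i) (mx3 a b p d e q p q r).
Proof.
rewrite -(add2_neq0 char2) => bd.
do 3 eexists; apply: (@similar3I (b + d) 1 1 0 0 0 1 0 (f + h) (c + g) (b + d));
  rewrite ?oner_neq0 //; try reflexivity; char2_ring char2 tt.
Qed.

(** If the quadratic form vanished on e1, e2 and e1 + e2, then the form would be
    alternating on their span. *)
Lemma nonsym_nonisotropic a b d e r : b != d -> exists a' b' e',
  [/\ a' != 0, b' != 0 &
    similarForms (mx3 a b 0 d e 0 0 0 r) (mx3 a' b' 0 0 e' 0 0 0 r)].
Proof.
wlog a0 : a b d e / a != 0 => [hwlog bd|].
  have [a0|] := eqVneq a 0; last by move=> a0; apply: hwlog.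
  have [e0|e0] := eqVneq e 0; last first.
    have [|a' [b' [e' [a'0 b'0 sim]]]] := hwlog e d b a e0; first by rewrite eq_sym.
    by exists a', b', e'; split=> //; apply: similar_trans sim; apply: similar_swap12.
  have [|a' [b' [e' [a'0 b'0 sim]]]] := hwlog (b + d) b d e _ bd.
    by rewrite (add2_neq0 char2).
  exists a', b', e'; split=> //; apply: similar_trans sim.
  by apply: (@similar3I 1 1 1 1 0 0 1 0 0 0 1); rewrite ?oner_neq0 //;
    char2_ring char2 (tt, a0, e0).
rewrite -(add2_neq0 char2) => bd; exists a, (b + d).
eexists; split=> //; apply: (@similar3I 1 1 1 0 0 (d / a) 1 0 0 0 1);
  rewrite ?oner_neq0 //; try reflexivity; by char2_ring char2 (tt, mulfV a0).
Qed.

Definition nonsymNF (gamma0 : F) M :=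
  [\/ exists delta, M = mx3 1 1 0 0 delta 0 0 0 0,
      exists beta, M = mx3 1 0 0 0 1 1 0 0 beta,
      exists2 alpha, alpha \in [:: 0; gamma0] & M = mx3 1 1 0 0 alpha 1 0 1 0 |
      M = mx3 1 1 0 0 0 0 0 1 1].

(** Here the radical of M - M^T splits off as an orthogonal summand. *)
Lemma nonsym_split a b d e r : b != d ->
  (exists delta, similarForms (mx3 a b 0 d e 0 0 0 r) (mx3 1 1 0 0 delta 0 0 0 0)) \/
  (exists beta, similarForms (mx3 a b 0 d e 0 0 0 r) (mx3 1 0 0 0 1 1 0 0 beta)).
Proof.
move=> bd; have [a' [b' [e' [a0 b0 sim]]]] := nonsym_nonisotropic a e r bd.
have [r0|r0] := eqVneq r 0; [left|right].
  eexists; apply: similar_trans sim _.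
  by apply: (@similar3I (a' / b') a'^-1 1 0 0 0 (a' / b') 0 0 0 1);
    rewrite ?mulf_neq0 ?invr_eq0 //; try reflexivity;
    char2_ring char2 (tt, r0, mulfV a0, mulfV b0).
have [x x0 xr] := sqrt2_neq0 char2 r0; have [y y0 ya] := sqrt2_neq0 char2 a0.
eexists; apply: similar_trans sim _.
by apply: (@similar3I (y ^+ 3 * x^-1 / b') (y^-1 ^+ 2)
    0 0 (y / x) 1 0 0 0 (y ^+ 2 / b') 0);
  rewrite ?mulf_neq0 ?invr_eq0 ?expf_neq0 ?mulf_neq0 //; try reflexivity;
  char2_ring char2 (tt, mulfV x0, mulfV y0, mulfV b0, esym xr, esym ya).
Qed.

(** Here the radical of M - M^T is isotropic but not orthogonal to everything.
    If the form is nondegenerate, then its quadratic form induces on the quotient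
    by the radical a nondegenerate one, x^2 + x y + alpha y^2 up to similarity;
    it is determined by the class of alpha modulo the t^2 + t. *)
Lemma nonsym_isotropic gamma0 a b p d e q :
  gamma0 \notin [set t ^+ 2 + t | t : F] -> b != d -> q != 0 ->
  exists2 N, nonsymNF gamma0 N & similarForms (mx3 a b p d e q p q 0) N.
Proof.
move=> hg bd q0; have m0 : b + d != 0 by rewrite (add2_neq0 char2).
suff [x [m [y [m'0 sim]]]] : exists x m y, m != 0 /\
    similarForms (mx3 a b p d e q p q 0) (mx3 x m 0 0 y 1 0 1 0).
  have [x0|x0] := eqVneq x 0.
    exists (mx3 1 1 0 0 0 0 0 1 1); first by constructor 4.
    apply: similar_trans sim _; apply: (@similar_trans _ (mx3 0 1 0 0 0 1 0 1 0)).
      by apply: (@similar3I m^-1 1 m^-1 0 0 (y / m) 1 0 0 0 1);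
        rewrite ?mulf_neq0 ?invr_eq0 ?oner_neq0 //;
        char2_ring char2 (tt, x0, mulfV m'0).
    apply: similar_sym.
    by apply: (@similar3I 1 1 1 1 1 0 1 1 1 0 1); rewrite ?oner_neq0 //;
      char2_ring char2 tt.
  have [t tin] := artin_schreier char2 hg (x * y * m^-1 ^+ 2).
  exists (mx3 1 1 0 0 (x * y * m^-1 ^+ 2 + t ^+ 2 + t) 1 0 1 0).
    by constructor 3; eexists; [exact: tin|].
  apply: similar_trans sim _.
  apply: (@similar_trans _ (mx3 1 1 0 0 (x * y * m^-1 ^+ 2) 1 0 1 0)).
    by apply: (@similar3I x x^-1 1 0 0 0 (x / m) 0 0 0 m);
      rewrite ?invr_eq0 //; char2_ring char2 (tt, mulfV x0, mulfV m'0).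
  by apply: (@similar3I 1 1 1 0 t t 1 0 0 0 1); rewrite ?oner_neq0 //;
    char2_ring char2 tt.
pose a1 := a + p / q * (b + d) + (p / q) ^+ 2 * e.
pose b1 := b + p / q * e; pose d1 := d + p / q * e.
exists a1, (b1 + d1), e; split.
  by rewrite (_ : b1 + d1 = b + d) //; rewrite /b1 /d1; char2_ring char2 tt.
apply: (@similar_trans _ (mx3 a1 b1 0 d1 e 1 0 1 0)); rewrite /a1 /b1 /d1.
  by apply: (@similar3I q^-1 1 1 (p / q) 0 0 1 0 0 0 q^-1);
    rewrite ?invr_eq0 ?oner_neq0 //; char2_ring char2 (tt, mulfV q0).
by apply: (@similar3I 1 1 1 0 (d + p / q * e) 0 1 0 0 0 1);
  rewrite ?oner_neq0 //; char2_ring char2 tt.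
Qed.

Lemma nonsymmetric_NF gamma0 M : gamma0 \notin [set t ^+ 2 + t | t : F] ->
  M^T != M -> exists2 N, nonsymNF gamma0 N & similarForms M N.
Proof.
move=> hg nsM.
suff adapted a b p d e q r : b != d ->
    exists2 N, nonsymNF gamma0 N & similarForms (mx3 a b p d e q p q r) N.
  have adapted' a b c d e f g h i : b != d ->
      exists2 N, nonsymNF gamma0 N & similarForms (mx3 a b c d e f g h i) N.
    move=> bd; have [p [q [r sim]]] := nonsym_adapt a c e f g h i bd.
    have [N nfN simN] := adapted a b p d e q r bd.
    by exists N => //; apply: similar_trans simN.
  move: nsM; rewrite [M]mx3_eta trmx3.
  have [E01|bd] := eqVneq (M o0 o1) (M o1 o0); last by move=> _; apply: adapted'.
  have [E02|cg] := eqVneq (M o0 o2) (M o2 o0); last first.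
    have [N nfN sim] := adapted' (M o0 o0) (M o0 o2) (M o0 o1)
      _ (M o2 o2) (M o2 o1) (M o1 o0) (M o1 o2) (M o1 o1) cg.
    by exists N => //; apply: similar_trans sim; apply: similar_swap23.
  have [E12|fh] := eqVneq (M o1 o2) (M o2 o1); last first.
    have [N nfN sim] := adapted' (M o2 o2) (M o2 o1) (M o2 o0)
      _ (M o1 o1) (M o1 o0) (M o0 o2) (M o0 o1) (M o0 o0) (contra_neq esym fh).
    by exists N => //; apply: similar_trans sim; apply: similar_swap13.
  by rewrite E01 E02 E12 eqxx.
move=> bd; have [r0|r0] := eqVneq r 0; last first.
  have bd' : b - p * q / r != d - p * q / r by rewrite (inj_eq (addIr _)).
  have [] := nonsym_split (a - p * p / r) (e - q * q / r) r bd'.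
    case=> delta sim; exists (mx3 1 1 0 0 delta 0 0 0 0).
      by constructor 1; exists delta.
    apply: similar_trans sim.
    by apply: (@similar3I 1 1 1 0 (p / r) 0 1 (q / r) 0 0 1); rewrite ?oner_neq0 //;
      char2_ring char2 (tt, mulfV r0).
  case=> beta sim; exists (mx3 1 0 0 0 1 1 0 0 beta).
    by constructor 2; exists beta.
  apply: similar_trans sim.
  by apply: (@similar3I 1 1 1 0 (p / r) 0 1 (q / r) 0 0 1); rewrite ?oner_neq0 //;
    char2_ring char2 (tt, mulfV r0).
rewrite r0; have [q0|q0] := eqVneq q 0; last exact: nonsym_isotropic.
have [p0|p0] := eqVneq p 0; last first.
  have db : d != b by rewrite eq_sym.
  have [N nfN sim] := nonsym_isotropic e q a hg db p0.
  by exists N => //; apply: similar_trans sim; apply: similar_swap12.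
rewrite p0 q0; have [[x sim]|[x sim]] := nonsym_split a e 0 bd.
  by exists (mx3 1 1 0 0 x 0 0 0 0) => //; constructor 1; exists x.
by exists (mx3 1 0 0 0 1 1 0 0 x) => //; constructor 2; exists x.
Qed.

End TernaryForms.

Section TernaryInvariants.
Variables (F : finFieldType) (char2 : 2%N \in [pchar F]).
Implicit Types M N : 'M[F]_3.

(** ** Invariants of ternary forms *)

Lemma similar_symmetric M N : similarForms M N -> (N^T == N) = (M^T == M).
Proof.
suff imp M' N' : similarForms M' N' -> M'^T == M' -> N'^T == N'.
  by move=> sim; apply/idP/idP; apply: imp => //; apply: similar_sym.
case=> P [s [_ _ ->]] /eqP symM'.
by rewrite linearZ /= !trmx_mul trmxK symM' mulmxA.
Qed.

Lemma similar_rank M N : similarForms M N -> \rank N = \rank M.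
Proof.
case=> P [s [uP s0 ->]]; rewrite mxrank_scale_nz //.
rewrite mxrankMfree ?row_free_unit ?unitmx_tr // eqmxMfull //.
by rewrite row_full_unit.
Qed.

Lemma bform_similar M (P : 'M[F]_3) s v w :
  bform (s *: (P *m M *m P^T)) v w = s * bform M (v *m P) (w *m P).
Proof. by rewrite -bform_congr /bform -scalemxAr -scalemxAl mxE. Qed.

Lemma similar_alternate M N : similarForms M N ->
  (forall v, bform M v v = 0) -> forall v, bform N v v = 0.
Proof. by case=> P [s [_ _ ->]] altM v; rewrite bform_similar altM mulr0. Qed.

(** This vector spans the radical of the alternating form M - M^T, when the
    latter is nonzero. *)
Definition axis M : 'rV[F]_3 :=
  row3 (M o1 o2 - M o2 o1) (M o2 o0 - M o0 o2) (M o0 o1 - M o1 o0).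

(** The axis is a quadratic covariant: up to the determinant it transforms like
    a vector, so that the value of the form on it and the determinant of the form
    are multiplied by the same factor. *)
Lemma axis_similar (P M : 'M[F]_3) s :
  axis (s *: (P *m M *m P^T)) *m P = (s * \det P) *: axis M.
Proof.
rewrite [P]mx3_eta [M]mx3_eta trmx3 !mulmx3 scalemx3 det_mx3 /axis.
rewrite !mxE /= mul_row3; apply/rowP; elim/ord3P; rewrite !mxE /=; ring.
Qed.

Lemma similar_axis0 M N : similarForms M N -> (axis N *m N == 0) = (axis M *m M == 0).
Proof.
case=> P [s [uP s0 ->]]; have d0 : \det P != 0 by rewrite -unitfE -unitmxE.
rewrite -!scalemxAr scaler_eq0 (negPf s0) /= !mulmxA axis_similar -!scalemxAl.
rewrite scaler_eq0 mulf_eq0 (negPf s0) (negPf d0) /=.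
have uPT : P^T \in unitmx by rewrite unitmx_tr.
by rewrite -[LHS](inj_eq (can_inj (mulmxKV uPT))) mul0mx mulmxK.
Qed.

Lemma axis_norm_similar (P M : 'M[F]_3) s : \det P != 0 ->
  let N := s *: (P *m M *m P^T) in
  bform N (axis N) (axis N) = s ^+ 3 * \det P ^+ 2 * bform M (axis M) (axis M).
Proof.
move=> d0 N; rewrite {1}/N bform_similar axis_similar.
rewrite -[X in bform _ X]addr0 bform_linl -[X in bform _ _ X]addr0 bform_linr.
by rewrite /bform mul0mx mul0mx trmx0 mulmx0 !mxE; ring.
Qed.

Lemma det_similar (P M : 'M[F]_3) s :
  \det (s *: (P *m M *m P^T)) = s ^+ 3 * \det P ^+ 2 * \det M.
Proof. by rewrite detZ !det_mulmx det_tr; ring. Qed.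

Lemma similar_axis_norm M N : similarForms M N -> exists2 k, k != 0 &
  \det N = k * \det M /\ bform N (axis N) (axis N) = k * bform M (axis M) (axis M).
Proof.
case=> P [s [uP s0 ->]]; have d0 : \det P != 0 by rewrite -unitfE -unitmxE.
exists (s ^+ 3 * \det P ^+ 2); first by rewrite mulf_neq0 ?expf_neq0.
by rewrite det_similar axis_norm_similar.
Qed.

Lemma bform_mx3 (x y z x' y' z' a b c d e f g h i : F) :
  bform (mx3 a b c d e f g h i) (row3 x y z) (row3 x' y' z') =
  (x * a + y * d + z * g) * x' + (x * b + y * e + z * h) * y'
  + (x * c + y * f + z * i) * z'.
Proof. by rewrite /bform mul_row3 mxE sum3 !mxE. Qed.

Lemma axis_mx3 (a b c d e f g h i : F) :
  axis (mx3 a b c d e f g h i) = row3 (f - h) (g - c) (b - d).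
Proof. by rewrite /axis !mxE. Qed.

(** The normal forms, numbered by the position of their family among the 24
    families of the list, from 0. *)
Definition ternary (k : nat) (x : F) : 'M[F]_3 :=
  match k with
  | 1%N => mx3 1 0 0 0 0 0 0 0 0
  | 2%N => mx3 1 0 0 0 1 0 0 0 0
  | 3%N => mx3 1 1 0 0 x 0 0 0 0
  | 4%N => mx3 0 1 0 1 0 0 0 0 0
  | 6%N => mx3 1 0 0 0 1 0 0 0 1
  | 7%N => mx3 1 0 0 0 1 1 0 0 x
  | 8%N => mx3 1 1 0 0 x 1 0 1 0
  | _ => mx3 1 1 0 0 0 0 0 1 1
  end.

Definition ternary_labels : seq nat := [:: 1; 2; 3; 4; 6; 7; 8; 9]%N.

Lemma mx3_eqE (a b c d e f g h i a' b' c' d' e' f' g' h' i' : F) :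
  (mx3 a b c d e f g h i == mx3 a' b' c' d' e' f' g' h' i') =
  [&& a == a', b == b', c == c', d == d', e == e', f == f', g == g', h == h' & i == i'].
Proof.
apply/eqP/idP => [E|]; last first.
  by do 8 case/andP=> /eqP->; move/eqP->.
have entry k l : mx3 a b c d e f g h i k l = mx3 a' b' c' d' e' f' g' h' i' k l.
  by rewrite E.
move: (entry o0 o0) (entry o0 o1) (entry o0 o2) (entry o1 o0) (entry o1 o1)
  (entry o1 o2) (entry o2 o0) (entry o2 o1) (entry o2 o2).
by rewrite !mxE /= => -> -> -> -> -> -> -> -> ->; rewrite !eqxx.
Qed.

Lemma ternary_sym k x : k \in ternary_labels ->
  ((ternary k x)^T == ternary k x) = (k \in [:: 1; 2; 4; 6]%N).
Proof.
by rewrite !inE; (do !case/orP) => /eqP-> /=; rewrite trmx3 mx3_eqE !eqxx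
  ?oner_eq0 ?[0 == 1]eq_sym ?oner_eq0 ?andbF.
Qed.

Lemma ternary_rank k x : k \in [:: 1; 2; 6]%N ->
  \rank (ternary k x) = if k == 6%N then 3 else k.
Proof.
rewrite !inE; (do !case/orP) => /eqP->; rewrite [RHS]/=.
- have -> : ternary 1 x = pid_mx 1.
    by apply/matrixP; elim/ord3P; elim/ord3P; rewrite !mxE.
  by rewrite rank_pid_mx.
- have -> : ternary 2 x = pid_mx 2.
    by apply/matrixP; elim/ord3P; elim/ord3P; rewrite !mxE.
  by rewrite rank_pid_mx.
have -> : ternary 6 x = 1%:M.
  by apply/matrixP; elim/ord3P; elim/ord3P; rewrite !mxE.
by rewrite mxrank1.
Qed.

Lemma row3_eq0 (a b c : F) : (row3 a b c == 0) = [&& a == 0, b == 0 & c == 0].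
Proof.
apply/eqP/and3P => [/rowP E|[/eqP-> /eqP-> /eqP->]].
  by move: (E o0) (E o1) (E o2); rewrite !mxE => /= -> -> ->.
by apply/rowP; elim/ord3P; rewrite !mxE.
Qed.

Lemma ternary_nonsym_axis k x : k \in [:: 3; 7; 8; 9]%N ->
  let M := ternary k x in
  ((axis M *m M == 0) = (k == 3)%N) * ((bform M (axis M) (axis M) == 0) = (k != 7)%N).
Proof.
rewrite !inE; (do !case/orP) => /eqP-> /=; rewrite axis_mx3 mul_row3 bform_mx3 row3_eq0;
 split; rewrite /= !(mulr0, mul0r, mulr1, mul1r, addr0, add0r, subr0, sub0r, oppr0,
   addrr2 char2, oppr2 char2, subrr, eqxx, oner_eq0, andbF) //.

Qed.

(** Symmetric normal forms are told apart by the rank and by being alternating;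
    the others by whether the axis lies in the left radical, is isotropic, and
    whether the form is degenerate. *)
Lemma ternary_label k x k' x' : k \in ternary_labels -> k' \in ternary_labels ->
  similarForms (ternary k x) (ternary k' x') -> k = k'.
Proof.
move=> kin k'in sim; have := similar_symmetric sim; rewrite !ternary_sym //.
have [ksym k'sym|kns /negbT k'ns] := boolP (k \in [:: 1; 2; 4; 6]%N).
  have alt4 l y l' y' : l' \in ternary_labels ->
      similarForms (ternary l y) (ternary l' y') -> l = 4%N -> l' = 4%N.
    move=> l'in sim' l4; rewrite l4 /= in sim'.
    have := similar_alternate sim' _ (row3 1 0 0).
    suff alt (v : 'rV[F]_3) : bform (mx3 0 1 0 1 0 0 0 0 0) v v = 0.
      move=> /(_ alt); move: l'in {sim'}; rewrite !inE; (do !case/orP) => /eqP-> //=;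
      by rewrite bform_mx3 !(mulr0, mul0r, mulr1, addr0) => /eqP; rewrite oner_eq0.
    by rewrite [v]row3_eta bform_mx3; char2_ring char2 tt.
  have [k4|k4] := eqVneq k 4%N; first by rewrite (alt4 _ _ _ _ k'in sim k4).
  have [k4'|k4'] := eqVneq k' 4%N.
    by rewrite (alt4 _ _ _ _ kin (similar_sym sim) k4').
  have := similar_rank sim; rewrite !ternary_rank.
  - move: ksym k'sym k4 k4'; rewrite !inE.
    by (do !case/orP) => /eqP->; (do !case/orP) => /eqP->.
  - by move: ksym k4; rewrite !inE; case: (k == 4)%N; rewrite ?orbF.
  by move: k'sym k4'; rewrite !inE; case: (k' == 4)%N; rewrite ?orbF.
have {}kns : k \in [:: 3; 7; 8; 9]%N.
  by move: kin kns; rewrite !inE; (do !case/orP) => /eqP->.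
have {}k'ns : k' \in [:: 3; 7; 8; 9]%N.
  by move: k'in k'ns; rewrite !inE; (do !case/orP) => /eqP->.
have := similar_axis0 sim; have [e k0 [detE normE]] := similar_axis_norm sim.
have : (bform (ternary k' x') (axis (ternary k' x')) (axis (ternary k' x')) == 0)
  = (bform (ternary k x) (axis (ternary k x)) (axis (ternary k x)) == 0).
  by rewrite normE mulf_eq0 (negPf k0).
have : (\det (ternary k' x') == 0) = (\det (ternary k x) == 0).
  by rewrite detE mulf_eq0 (negPf k0).
rewrite !ternary_nonsym_axis //.
move: kns k'ns {kin k'in sim detE normE}; rewrite !inE.
have det8 y : (\det (ternary 8 y) == 0) = false.
  rewrite det_mx3 !(mulr0, mul0r, mulr1, mul1r, subr0, sub0r, addr0).
  by rewrite oppr_eq0 oner_eq0.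
have det9 y : (\det (ternary 9 y) == 0) = true.
  by apply/eqP; rewrite det_mx3; char2_ring char2 tt.
by (do !case/orP) => /eqP-> ; (do !case/orP) => /eqP-> //; rewrite ?det8 ?det9.
Qed.

(** Both the determinant of the upper left block and the square of its
    alternating part are multiplied by the same factor, so their quotient delta
    is an invariant. *)
Lemma ternary3_inj delta delta' :
  similarForms (ternary 3 delta) (ternary 3 delta') -> delta = delta'.
Proof.
case=> P [s [_ _ /eqP]]; rewrite [P]mx3_eta trmx3 /= !mulmx3 scalemx3 mx3_eqE.
move: (P _ _) (P _ _) (P _ _) (P _ _) (P _ _) (P _ _) (P _ _) (P _ _) (P _ _).
move=> i h g f e d c b a.
case/and5P=> /eqP E00 /eqP E01 _ /eqP E10 /andP[/eqP E11 _].
have E : s * (a * e + b * d) = 1.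
  have := congr2 +%R E01 E10; rewrite addr0 => ->; char2_ring char2 tt.
transitivity ((s * (a * e + b * d)) ^+ 2 * delta).
  by rewrite E expr1n mul1r.
have := congr2 +%R (congr2 *%R E00 E11) (congr2 *%R E01 E10).
by rewrite mulr0 addr0 mul1r => ->; char2_ring char2 tt.
Qed.

(** Here beta is the quotient of the determinant of the form by its value on the
    axis, which is 1. *)
Lemma ternary7_inj beta beta' :
  similarForms (ternary 7 beta) (ternary 7 beta') -> beta = beta'.
Proof.
case/similar_axis_norm=> k _; rewrite !det_mx3 !axis_mx3 !bform_mx3 => -[Eb Ek].
rewrite !(mulr0, mul0r, mulr1, mul1r, addr0, subr0) in Eb Ek.
by rewrite Eb -Ek mul1r.
Qed.

(** The quadratic form of the first form is isotropic outside its axis; that of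
    the second one is not, because gamma0 is not of the form t^2 + t. *)
Lemma ternary8_neq gamma0 : gamma0 \notin [set t ^+ 2 + t | t : F] ->
  ~ similarForms (ternary 8 0) (ternary 8 gamma0).
Proof.
move=> hg /(similar_sym)[P [s [uP s0]]] E.
pose v := row3 0 1 0 *m P.
have : bform (ternary 8 gamma0) v v = 0.
  have := bform_similar (ternary 8 gamma0) P s (row3 0 1 0) (row3 0 1 0).
  rewrite -E /= bform_mx3 => /esym/eqP.
  rewrite !(mulr0, mul0r, mulr1, mul1r, addr0) mulf_eq0 (negPf s0).
  by move/eqP.
have : bform (ternary 8 gamma0) v (row3 1 0 0 *m P) !=
    bform (ternary 8 gamma0) (row3 1 0 0 *m P) v.
  have := bform_similar (ternary 8 gamma0) P s (row3 0 1 0) (row3 1 0 0).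
  have := bform_similar (ternary 8 gamma0) P s (row3 1 0 0) (row3 0 1 0).
  rewrite -E /= !bform_mx3 !(mulr0, mul0r, mulr1, mul1r, addr0, add0r) -/v.
  move=> E1 E0; apply: contraTneq (oner_neq0 F) => E01; apply/negPn.
  by rewrite E1 -E01 -E0.
rewrite [v]row3_eta; move: (v _ _) (v _ _) (v _ _) => z y x {v}.
rewrite [_ *m P]row3_eta; move: ((_ *m P) _ _) ((_ *m P) _ _) ((_ *m P) _ _).
rewrite /= !bform_mx3 => z' y' x' asym iso.
have y0 : y != 0.
  apply: contraNneq asym => y0; have x0 : x = 0.
    apply/eqP; rewrite -sqrf_eq0 -[X in _ == X]iso; apply/eqP.
    by char2_ring char2 (tt, y0).
  by rewrite !bform_mx3; apply/eqP; char2_ring char2 (tt, x0, y0).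
case/negP: hg; apply/imsetP; exists (x / y) => //.
apply: (eq_of_add2 char2); apply/eqP.
rewrite -[_ == 0](mulIr_eq0 _ (mulIf (expf_neq0 2 y0))) -[X in _ == X]iso.
by apply/eqP; char2_ring char2 (tt, mulfV y0).
Qed.

Lemma ternary_unique gamma0 k x k' x' : gamma0 \notin [set t ^+ 2 + t | t : F] ->
  let params l := if l == 8%N then [:: 0; gamma0] else
    if (l == 3%N) || (l == 7%N) then enum F else [:: 0] in
  k \in ternary_labels -> x \in params k -> k' \in ternary_labels -> x' \in params k' ->
  similarForms (ternary k x) (ternary k' x') -> (k, x) = (k', x').
Proof.
move=> hg params kin xin k'in x'in sim; have eqk := ternary_label kin k'in sim.
rewrite -eqk in sim x'in *; congr pair; move: xin x'in; rewrite /params.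
have [k8|_] := eqVneq k 8%N.
  rewrite k8 !inE in sim *; have neq := ternary8_neq hg.
  case/orP=> /eqP Ex; case/orP=> /eqP Ex'; rewrite {x}Ex {x'}Ex' // in sim *.
  by case: neq; apply: similar_sym.
have [k3 _ _|_] := eqVneq k 3%N; first by rewrite k3 in sim; apply: ternary3_inj.
have [k7 _ _|_] := eqVneq k 7%N; first by rewrite k7 in sim; apply: ternary7_inj.
by rewrite !inE => /eqP-> /eqP->.
Qed.

End TernaryInvariants.

(** * Pencils of bilinear forms on a plane *)

Section Pencils.
Variables (F : finFieldType) (char2 : 2%N \in [pchar F]).
Implicit Types C D : 'M[F]_2.

Definition u0 : 'I_2 := @Ordinal 2 0 isT.
Definition u1 : 'I_2 := @Ordinal 2 1 isT.

Lemma ord2P (P : 'I_2 -> Prop) : P u0 -> P u1 -> forall i, P i.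
Proof.
move=> P0 P1 [[|[|//]] lti].
- by rewrite (_ : Ordinal lti = u0) //; apply: val_inj.
- by rewrite (_ : Ordinal lti = u1) //; apply: val_inj.
Qed.

Lemma sum2 (V : nmodType) (f : 'I_2 -> V) : \sum_i f i = f u0 + f u1.
Proof.
rewrite !big_ord_recl big_ord0 addr0.
by congr (_ + _); congr f; apply: val_inj.
Qed.

Definition mx2 (a b c d : F) : 'M[F]_2 :=
  \matrix_(k, l) nth 0 (nth [::] [:: [:: a; b]; [:: c; d]] k) l.

Definition pencil C D (k : 'I_2) : 'M[F]_2 := if k == u0 then C else D.

Lemma mx2_eta C : C = mx2 (C u0 u0) (C u0 u1) (C u1 u0) (C u1 u1).
Proof. by apply/matrixP; elim/ord2P; elim/ord2P; rewrite mxE. Qed.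

Lemma mulmx2 (a b c d a' b' c' d' : F) :
  mx2 a b c d *m mx2 a' b' c' d' =
  mx2 (a * a' + b * c') (a * b' + b * d') (c * a' + d * c') (c * b' + d * d').
Proof. by apply/matrixP; elim/ord2P; elim/ord2P; rewrite mxE sum2 !mxE. Qed.

Lemma trmx2 (a b c d : F) : (mx2 a b c d)^T = mx2 a c b d.
Proof. by apply/matrixP; elim/ord2P; elim/ord2P; rewrite !mxE. Qed.

Lemma scalemx2 (s a b c d : F) :
  s *: mx2 a b c d = mx2 (s * a) (s * b) (s * c) (s * d).
Proof. by apply/matrixP; elim/ord2P; elim/ord2P; rewrite !mxE. Qed.

Lemma addmx2 (a b c d a' b' c' d' : F) :
  mx2 a b c d + mx2 a' b' c' d' = mx2 (a + a') (b + b') (c + c') (d + d').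
Proof. by apply/matrixP; elim/ord2P; elim/ord2P; rewrite !mxE. Qed.

Lemma det_mx2 (a b c d : F) : \det (mx2 a b c d) = a * d - b * c.
Proof. by rewrite det2 !mxE. Qed.

Lemma mx2_eqE (a b c d a' b' c' d' : F) :
  (mx2 a b c d == mx2 a' b' c' d') = [&& a == a', b == b', c == c' & d == d'].
Proof.
apply/eqP/and4P => [E|[/eqP-> /eqP-> /eqP-> /eqP->] //].
have entry k l : mx2 a b c d k l = mx2 a' b' c' d' k l by rewrite E.
move: (entry u0 u0) (entry u0 u1) (entry u1 u0) (entry u1 u1).
by rewrite !mxE /= => -> -> -> ->.
Qed.

(** The entrywise form of the definition, with the matrices (p q; r s) and
    (t u; v w) for the changes of basis of the plane and of the pencil. *)
Lemma pencilI (detP detT p q r s t u v w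
    c11 c12 c21 c22 d11 d12 d21 d22
    c11' c12' c21' c22' d11' d12' d21' d22' : F) :
  detP != 0 -> detT != 0 -> detP = p * s - q * r -> detT = t * w - u * v ->
  c11' = t * (p * c11 * p + q * c21 * p + p * c12 * q + q * c22 * q)
    + u * (p * d11 * p + q * d21 * p + p * d12 * q + q * d22 * q) ->
  c12' = t * (p * c11 * r + q * c21 * r + p * c12 * s + q * c22 * s)
    + u * (p * d11 * r + q * d21 * r + p * d12 * s + q * d22 * s) ->
  c21' = t * (r * c11 * p + s * c21 * p + r * c12 * q + s * c22 * q)
    + u * (r * d11 * p + s * d21 * p + r * d12 * q + s * d22 * q) ->
  c22' = t * (r * c11 * r + s * c21 * r + r * c12 * s + s * c22 * s)
    + u * (r * d11 * r + s * d21 * r + r * d12 * s + s * d22 * s) ->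
  d11' = v * (p * c11 * p + q * c21 * p + p * c12 * q + q * c22 * q)
    + w * (p * d11 * p + q * d21 * p + p * d12 * q + q * d22 * q) ->
  d12' = v * (p * c11 * r + q * c21 * r + p * c12 * s + q * c22 * s)
    + w * (p * d11 * r + q * d21 * r + p * d12 * s + q * d22 * s) ->
  d21' = v * (r * c11 * p + s * c21 * p + r * c12 * q + s * c22 * q)
    + w * (r * d11 * p + s * d21 * p + r * d12 * q + s * d22 * q) ->
  d22' = v * (r * c11 * r + s * c21 * r + r * c12 * s + s * c22 * s)
    + w * (r * d11 * r + s * d21 * r + r * d12 * s + s * d22 * s) ->
  formEquiv (pencil (mx2 c11 c12 c21 c22) (mx2 d11 d12 d21 d22))
            (pencil (mx2 c11' c12' c21' c22') (mx2 d11' d12' d21' d22')).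
Proof.
move=> P0 T0 defP defT; do 8 move=> ->.
exists (mx2 p q r s), (mx2 t u v w).
rewrite !unitmxE !unitfE !det_mx2 -defP -defT; split=> //.
elim/ord2P; rewrite sum2 /= trmx2 !mulmx2 !mxE /= !scalemx2 addmx2;
  by apply/eqP; rewrite mx2_eqE; apply/and4P; split; apply/eqP; ring.
Qed.

Lemma pencilE C D C' D' : formEquiv (pencil C D) (pencil C' D') ->
  exists (P T : 'M[F]_2), [/\ \det P != 0, \det T != 0,
    C' = P *m (T u0 u0 *: C + T u0 u1 *: D) *m P^T &
    D' = P *m (T u1 u0 *: C + T u1 u1 *: D) *m P^T].
Proof.
case=> P [T [uP uT E]]; exists P, T; rewrite -!unitfE -!unitmxE; split=> //.
  by rewrite mulmxDr mulmxDl -!scalemxAr -!scalemxAl; have := E u0; rewrite sum2.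
by rewrite mulmxDr mulmxDl -!scalemxAr -!scalemxAl; have := E u1; rewrite sum2.
Qed.

Lemma formFree_equiv m n (B B' : 'I_n -> 'M[F]_m) :
  formEquiv B B' -> formFree B -> formFree B'.
Proof.
case=> P [T [uP uT E]] freeB t; under eq_bigr => k _ do rewrite E scaler_sumr.
rewrite exchange_big /=.
under eq_bigr => l _.
  under eq_bigr => k _ do rewrite scalerA.
  rewrite -scaler_suml scalemxAl scalemxAr; over.
rewrite -mulmx_suml -mulmx_sumr => E0.
have {}E0 : \sum_l (t *m T) 0 l *: B l = 0.
  apply: (can_inj (mulKmx uP)); rewrite mulmx0.
  apply: (can_inj (mulmxK (_ : P^T \in unitmx))); rewrite ?unitmx_tr // mul0mx -[RHS]E0.
  by congr (_ *m _ *m _); apply: eq_bigr => l _; rewrite mxE.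
by rewrite -[t](mulmxK uT) (freeB _ E0) mul0mx.
Qed.

Lemma formFree_pencil C D : formFree (pencil C D) <->
  forall t u, t *: C + u *: D = 0 -> t = 0 /\ u = 0.
Proof.
split=> [free t u E|free t].
  have /rowP E0 : \row_k (if k == u0 then t else u) = 0.
    by apply: free; rewrite sum2 !mxE.
  by move: (E0 u0) (E0 u1); rewrite !mxE.
rewrite sum2 /pencil /= => /free[t0 t1].
by apply/rowP; elim/ord2P; rewrite mxE.
Qed.

Variables (gamma0 : F) (hgamma0 : gamma0 \notin [set t ^+ 2 + t | t : F]).
Variables (eta : F -> F) (heta : forall sigma : F,
  sigma != 0 -> sigma != 1 -> eta sigma \notin Hset sigma).

(** Members spanning the pencils of normal form, numbered by the position of their
    family among the 24 families of the list, from 0. *)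
Definition pencilC (k : nat) (x : F) : 'M[F]_2 :=
  match k with
  | 15%N => mx2 1 0 0 x
  | 16%N => mx2 1 0 0 1
  | 17%N => mx2 1 0 1 x
  | 18%N => mx2 1 0 1 0
  | 20%N => mx2 1 0 0 1
  | 21%N => mx2 1 0 1 1
  | 22%N => mx2 1 0 x 1
  | 23%N => mx2 1 0 (x * (eta x)^-1) 1
  | _ => mx2 1 0 0 0
  end.

Definition pencilD (k : nat) (x : F) : 'M[F]_2 :=
  match k with
  | 14%N => mx2 0 0 1 0
  | 15%N => mx2 0 1 1 1
  | 16%N => mx2 0 1 1 0
  | 17%N => mx2 0 1 1 0
  | 19%N => mx2 0 1 x 0
  | 23%N => mx2 0 1 (1 + (eta x)^-1) 0
  | _ => mx2 0 1 0 0
  end.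

Definition pencil_params (k : nat) : seq F :=
  match k with
  | 15%N | 17%N => [:: 0; gamma0]
  | 19%N => enum [pred delta : F | delta != 1]
  | 22%N | 23%N => enum [pred sigma : F | (sigma != 0) && (sigma != 1)]
  | _ => [:: 0]
  end.

Definition pencil_classified C D : Prop := exists k x,
  [/\ k \in iota 14 10, x \in pencil_params k &
      formEquiv (pencil C D) (pencil (pencilC k x) (pencilD k x))].

Lemma classified_equiv C D C' D' : formEquiv (pencil C D) (pencil C' D') ->
  pencil_classified C' D' -> pencil_classified C D.
Proof.
move=> E [k [x [kin xin E']]]; exists k, x; split=> //.
exact: formEquiv_trans E E'.
Qed.

(** ** Symmetric pencils *)

Lemma classify_J x y : [|| x != 0 | y != 0] ->
  pencil_classified (mx2 x 0 0 y) (mx2 0 1 1 0).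
Proof.
move=> xy; exists 16%N, 0; split; rewrite ?inE //=.
have [x0|x0] := eqVneq x 0; first have [y0|y0] := eqVneq y 0.
- by rewrite x0 y0 eqxx in xy.
- have [q q0 qy] := sqrt2_neq0 char2 y0.
  by apply: (@pencilI q^-1 q 0 q^-1 1 q^-1 1 q 0 q); rewrite ?invr_eq0 //;
    char2_ring char2 (tt, mulfV q0, esym qy, x0).
have [p p0 px] := sqrt2_neq0 char2 x0; have [y0|y0] := eqVneq y 0.
  by apply: (@pencilI p^-1 p p^-1 0 p^-1 1 1 p 0 p); rewrite ?invr_eq0 //;
    char2_ring char2 (tt, mulfV p0, esym px, y0).
have [q q0 qy] := sqrt2_neq0 char2 y0.
by apply: (@pencilI (p^-1 * q^-1) (p * q) p^-1 0 0 q^-1 1 0 0 (p * q));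
  rewrite ?mulf_neq0 ?invr_eq0 //;
  char2_ring char2 (tt, mulfV p0, mulfV q0, esym px, esym qy).
Qed.

(** In a plane of symmetric forms without alternating member there are unique
    members with diagonals (1, 0) and (0, 1).  Replacing e1 by e1 + t e2 changes m
    to m + t + l t^2, so that l m can be changed by any element of the form
    t^2 + t. *)
Lemma classify_diagonal l m : pencil_classified (mx2 1 l l 0) (mx2 0 m m 1).
Proof.
have scaled l' m' : m' != 0 -> l' * m' \in [:: 0; gamma0] ->
    pencil_classified (mx2 1 l' l' 0) (mx2 0 m' m' 1).
  move=> m0 lm; exists 15%N, (l' * m'); split=> //=.
  apply: (@pencilI m'^-1 (m' ^+ 2) m'^-1 0 0 1 (m' ^+ 2) (l' * m') 0 1);
    rewrite ?invr_eq0 ?expf_neq0 //; by char2_ring char2 (tt, mulfV m0).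
have swap l' m' : pencil_classified (mx2 1 m' m' 0) (mx2 0 l' l' 1) ->
    pencil_classified (mx2 1 l' l' 0) (mx2 0 m' m' 1).
  apply: classified_equiv.
  by apply: (@pencilI 1 1 0 1 1 0 0 1 1 0); rewrite ?oner_neq0 //; char2_ring char2 tt.
have shift l' m' t : pencil_classified (mx2 1 l' l' 0)
      (mx2 0 (m' + t + l' * t ^+ 2) (m' + t + l' * t ^+ 2) 1) ->
    pencil_classified (mx2 1 l' l' 0) (mx2 0 m' m' 1).
  apply: classified_equiv.
  by apply: (@pencilI 1 1 1 t 0 1 1 0 (t ^+ 2) 1); rewrite ?oner_neq0 //; char2_ring char2 tt.
have zero l' : pencil_classified (mx2 1 l' l' 0) (mx2 0 0 0 1).
  apply: swap; have [l0|l0] := eqVneq l' 0; last first.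
    by apply: scaled; rewrite ?mul0r ?inE ?eqxx.
  apply: (shift _ _ 1); apply: scaled; rewrite ?mul0r ?addr0 ?inE ?eqxx //.
  by rewrite l0 add0r oner_neq0.
have [l0|l0] := eqVneq l 0.
  have [m0|m0] := eqVneq m 0; first by rewrite m0.
  by apply: scaled; rewrite // l0 mul0r inE eqxx.
have [t tin] := artin_schreier char2 hgamma0 (l * m).
apply: (shift _ _ (t / l)); set m' := m + _ + _.
have lm' : l * m' = l * m + t ^+ 2 + t by rewrite /m'; char2_ring char2 (tt, mulfV l0).
have [->|m0] := eqVneq m' 0; first exact: zero.
by apply: scaled; rewrite ?lm'.
Qed.

(** Either the diagonals of the members fill a plane, or some member is
    alternating. *)
Lemma classify_symmetric c1 c2 c3 d1 d2 d3 :
  formFree (pencil (mx2 c1 c2 c2 c3) (mx2 d1 d2 d2 d3)) ->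
  pencil_classified (mx2 c1 c2 c2 c3) (mx2 d1 d2 d2 d3).
Proof.
have noDiag x1 x2 x3 y : formFree (pencil (mx2 x1 x2 x2 x3) (mx2 0 y y 0)) ->
    pencil_classified (mx2 x1 x2 x2 x3) (mx2 0 y y 0).
  move/formFree_pencil=> free.
  have y0 : y != 0.
    apply/eqP=> y0; have [|_ /eqP] := free 0 1; last by rewrite oner_eq0.
    rewrite scale0r scale1r add0r y0.
    by rewrite -[RHS](scale0r (mx2 0 0 0 0)) scalemx2 !mulr0.
  have x13 : [|| x1 != 0 | x3 != 0].
    apply/contraT; rewrite negb_or !negbK => /andP[/eqP x1_0 /eqP x3_0].
    have [|/eqP] := free y x2; last by rewrite (negPf y0).
    rewrite x1_0 x3_0 !scalemx2 addmx2 !mulr0 addr0 mulrC (addrr2 char2).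
    by rewrite -(scale0r (mx2 0 0 0 0)) scalemx2 !mulr0.
  apply: classified_equiv (classify_J x13).
  by apply: (@pencilI 1 y^-1 1 0 0 1 1 (x2 / y) 0 y^-1);
    rewrite ?invr_eq0 ?oner_neq0 //; char2_ring char2 (tt, mulfV y0).
move=> free; have [D0|D0] := eqVneq (c1 * d3 + c3 * d1) 0; last first.
  pose D := c1 * d3 + c3 * d1.
  apply: classified_equiv
    (classify_diagonal ((d3 * c2 + c3 * d2) / D) ((d1 * c2 + c1 * d2) / D)).
  have DV : c1 * d3 = D - c3 * d1 by rewrite /D; ring.
  by apply: (@pencilI 1 D^-1 1 0 0 1 (d3 / D) (c3 / D) (d1 / D) (c1 / D));
    rewrite ?invr_eq0 ?oner_neq0 //; char2_ring char2 (tt, mulfV (D0 : D != 0), DV).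
have [d1_0|d1_0] := eqVneq d1 0; last first.
  have E : formEquiv (pencil (mx2 c1 c2 c2 c3) (mx2 d1 d2 d2 d3))
     (pencil (mx2 d1 d2 d2 d3) (mx2 0 (c2 + c1 / d1 * d2) (c2 + c1 / d1 * d2) 0)).
    have c3E : c3 = c1 * d3 / d1.
      apply: (mulIf d1_0); apply: (eq_of_add2 char2); rewrite -[RHS]D0.
      by char2_ring char2 (tt, mulfV d1_0).
    by apply: (@pencilI 1 1 1 0 0 1 0 1 1 (c1 / d1)); rewrite ?oner_neq0 //;
      char2_ring char2 (tt, mulfV d1_0, c3E).
  exact: classified_equiv E (noDiag _ _ _ _ (formFree_equiv E free)).
have [d3_0|d3_0] := eqVneq d3 0; last first.
  have c1_0 : c1 = 0.
    by apply: (mulIf d3_0); rewrite mul0r -[RHS]D0 d1_0 mulr0 addr0.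
  have E : formEquiv (pencil (mx2 c1 c2 c2 c3) (mx2 d1 d2 d2 d3))
     (pencil (mx2 d1 d2 d2 d3) (mx2 0 (c2 + c3 / d3 * d2) (c2 + c3 / d3 * d2) 0)).
    by apply: (@pencilI 1 1 1 0 0 1 0 1 1 (c3 / d3)); rewrite ?oner_neq0 //;
      char2_ring char2 (tt, mulfV d3_0, c1_0, d1_0).
  exact: classified_equiv E (noDiag _ _ _ _ (formFree_equiv E free)).
by rewrite d1_0 d3_0 in free *; apply: noDiag.
Qed.

(** ** Nonsymmetric pencils *)

(** Modulo the alternating form the other member is a nondegenerate quadratic
    form, which is determined up to similarity by its Arf invariant. *)
Lemma classify_alternating x y : pencil_classified (mx2 0 1 1 0) (mx2 x 1 0 y).
Proof.
wlog x0 : x y / x != 0 => [hwlog|].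
  have [x0|] := eqVneq x 0; last exact: hwlog.
  have [y0|y0] := eqVneq y 0.
    apply: classified_equiv (hwlog 1 0 _); last exact: oner_neq0.
    by apply: (@pencilI 1 1 1 1 0 1 1 0 0 1); rewrite ?oner_neq0 //;
      char2_ring char2 (tt, x0, y0).
  apply: classified_equiv (hwlog y x y0).
  by apply: (@pencilI 1 1 0 1 1 0 1 0 1 1); rewrite ?oner_neq0 //; char2_ring char2 tt.
have [p p0 px] := sqrt2_neq0 char2 x0.
have [t tin] := artin_schreier char2 hgamma0 (p ^+ 2 * y).
exists 17%N, (p ^+ 2 * y + t ^+ 2 + t); split=> //.
apply: (@pencilI 1 1 p^-1 0 (t / p) p (1 + t) 1 1 0); rewrite ?oner_neq0 //;
  by char2_ring char2 (tt, mulfV p0, esym px).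
Qed.

(** The radical of the symmetric member is spanned by e2.  If e2 is isotropic for
    the whole pencil, then the ratio of the two off-diagonal entries is an
    invariant; otherwise e1 can be chosen to make one of them vanish. *)
Lemma classify_rank1 u y : pencil_classified (mx2 1 0 0 0) (mx2 0 u (u + 1) y).
Proof.
have [y0|y0] := eqVneq y 0; last first.
  exists 21%N, 0; split; rewrite ?inE //=.
  pose n := (u + 1) / y.
  pose k := (n * y) ^+ 2 + n * y.
  apply: (@pencilI y^-1 y 1 n 1 (n + y^-1) (1 + k) y k y);
    rewrite ?invr_eq0 ?oner_neq0 //; rewrite /k /n; char2_ring char2 (tt, mulfV y0).
have [u_0|u_0] := eqVneq u 0.
  exists 14%N, 0; split; rewrite ?inE //= u_0 y0 add0r; exact: formEquiv_refl.
exists 19%N, ((u + 1) / u); split=> //=.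
  rewrite mem_enum inE; apply: contraTneq (oner_neq0 F) => E; apply/negPn/eqP.
  have {}E : u + 1 = u by rewrite -[LHS](mulfVK u_0) E mul1r.
  by apply: (addrI u); rewrite addr0.
by apply: (@pencilI 1 u^-1 1 0 0 1 1 0 0 u^-1); rewrite ?invr_eq0 ?oner_neq0 //;
  char2_ring char2 (tt, mulfV u_0, y0).
Qed.

(** With w = v / (u + v) the definition of Hset becomes a polynomial in w, and
    Hset is recognised as a multiple of the group of all t^2 + t. *)
Lemma HsetP (sigma w : F) : sigma * w * (1 + w) + w ^+ 2 \in Hset sigma.
Proof.
apply/imset2P; exists (1 + w) w => //.
  by rewrite inE -(add2_neq0 char2) (_ : 1 + w + w = 1) ?oner_neq0 //; char2_ring char2 tt.
rewrite (_ : (1 + w) ^+ 2 + w ^+ 2 = 1) ?divr1; last by char2_ring char2 tt.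
by char2_ring char2 tt.
Qed.

(** The only vectors isotropic for the symmetric member are the multiples of e1,
    so that the remaining changes of basis are e2 |-> e2 + nu e1 and scalars.
    They preserve x and change z by x nu^2 + (x + 1) nu.  This additive function
    of nu is injective, hence onto, for x = 0 and x = 1, and it has image of
    index two for the other values of x. *)
Lemma classify_rank2 x z : pencil_classified (mx2 0 1 1 1) (mx2 x z (z + 1) 0).
Proof.
have shift z' nu : pencil_classified (mx2 0 1 1 1)
      (mx2 x (z' + x * nu ^+ 2 + (x + 1) * nu)
         (z' + x * nu ^+ 2 + (x + 1) * nu + 1) 0) ->
    pencil_classified (mx2 0 1 1 1) (mx2 x z' (z' + 1) 0).
  apply: classified_equiv.
  by apply: (@pencilI 1 1 1 0 nu 1 1 0 (x * nu ^+ 2 + nu) 1); rewrite ?oner_neq0 //;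
    char2_ring char2 tt.
have [x0|x0] := eqVneq x 0.
  apply: (shift z z); exists 18%N, 0; split; rewrite ?inE //=.
  by apply: (@pencilI 1 1 0 1 1 0 1 1 0 1); rewrite ?oner_neq0 //;
    char2_ring char2 (tt, x0).
have [x1|x1] := eqVneq x 1.
  have [nu nuz] := sqrt2 char2 z.
  apply: (shift z nu); exists 20%N, 0; split; rewrite ?inE //=.
  by apply: (@pencilI 1 1 0 1 1 1 1 0 0 1); rewrite ?oner_neq0 //;
    char2_ring char2 (tt, x1, esym nuz).
pose sigma := 1 + x^-1.
have s0 : sigma != 0.
  by rewrite (add2_neq0 char2) eq_sym -(inj_eq invr_inj) invrK invr1.
have s1 : sigma != 1.
  by rewrite -[X in _ != X]addr0 (inj_eq (addrI _)) invr_eq0.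
have smem : sigma \in enum [pred sigma : F | (sigma != 0) && (sigma != 1)].
  by rewrite mem_enum inE s0.
have x1' : x + 1 != 0 by rewrite (add2_neq0 char2).
have H1 : eta sigma != 0.
  apply: contraNneq (heta s0 s1) => ->.
  by have := HsetP sigma 0; rewrite mulr0 mul0r add0r expr0n.
(* With nu = (x + 1) / x * t, the change of z becomes kappa * (t^2 + t); as 1 lies
   in Hset, the choice of eta says that eta + 1 represents the nontrivial class. *)
pose kappa := (x + 1) ^+ 2 / x.
have k0 : kappa != 0 by rewrite mulf_neq0 ?expf_neq0 ?invr_eq0.
have hk : (eta sigma + 1) / kappa \notin [set t ^+ 2 + t | t : F].
  apply: contra (heta s0 s1) => /imsetP[t _ E].
  have -> : eta sigma = kappa * (t ^+ 2 + t) + 1.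
    by rewrite -E mulrC mulfVK // -addrA (addrr2 char2) addr0.
  pose w := 1 + (x + 1) * t.
  suff -> : kappa * (t ^+ 2 + t) + 1 = sigma * w * (1 + w) + w ^+ 2 by apply: HsetP.
  by rewrite /kappa /sigma /w; char2_ring char2 (tt, mulfV x0).
have [t] := artin_schreier char2 hk (z / kappa).
have tE : z + kappa * (t ^+ 2 + t) = kappa * (z / kappa + t ^+ 2 + t).
  by char2_ring char2 (tt, mulfV k0).
rewrite !inE => /orP tz.
have {}tz : z + kappa * (t ^+ 2 + t) = 0 \/ z + kappa * (t ^+ 2 + t) = eta sigma + 1.
  rewrite tE; case: tz => /eqP->; [left|right]; first by rewrite mulr0.
  by rewrite mulrC mulfVK.
apply: (shift z ((x + 1) / x * t)).
have -> : z + x * ((x + 1) / x * t) ^+ 2 + (x + 1) * ((x + 1) / x * t) =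
    z + kappa * (t ^+ 2 + t).
  by rewrite /kappa; char2_ring char2 (tt, mulfV x0).
case: tz => ->.
  exists 22%N, sigma; split=> //=.
  by apply: (@pencilI x^-1 x 0 1 x^-1 1 1 (x + 1) 0 x);
    rewrite ?invr_eq0 //; rewrite /sigma; char2_ring char2 (tt, mulfV x0).
exists 23%N, sigma; split=> //=; move: (eta sigma) H1 => e e0.
by apply: (@pencilI x^-1 (x / e) 0 1 x^-1 1 1 ((x + 1) / e) 0 (x / e));
  rewrite ?mulf_neq0 ?invr_eq0 //; rewrite /sigma;
  char2_ring char2 (tt, mulfV x0, mulfV e0).
Qed.

(** The three cases are those of an alternating, a degenerate and a nondegenerate
    nonalternating symmetric member. *)
Lemma classify_nonsymmetric s1 s2 s3 n1 n2 n3 n4 :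
  mx2 s1 s2 s2 s3 != 0 -> n2 + n3 = 1 ->
  pencil_classified (mx2 s1 s2 s2 s3) (mx2 n1 n2 n3 n4).
Proof.
move=> + n23; have {n23 n2}-> : n2 = n3 + 1 by rewrite -n23; char2_ring char2 tt.
wlog s13 : s1 s3 n1 n3 n4 / (s1 == 0) ==> (s3 == 0) => [hwlog S0|S0].
  have [s1_0|s1_0] := eqVneq s1 0; last by apply: hwlog => //; rewrite (negPf s1_0).
  have [s3_0|s3_0] := eqVneq s3 0; first by apply: hwlog => //; rewrite s3_0 eqxx implybT.
  apply: (@classified_equiv _ _ (mx2 s3 s2 s2 s1) (mx2 n4 (n3 + 1 + 1) (n3 + 1) n1)).
    by apply: (@pencilI 1 1 0 1 1 0 1 0 0 1); rewrite ?oner_neq0 //; char2_ring char2 tt.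
  apply: hwlog; first by rewrite (negPf s3_0).
  by apply: contra s3_0 => /eqP/matrixP/(_ u0 u0); rewrite !mxE => /eqP.
have [s1_0|s1_0] := eqVneq s1 0.
  have s2_0 : s2 != 0.
    apply: contraNneq S0 => s2_0; move: s13; rewrite s1_0 eqxx => /eqP s3_0.
    rewrite s2_0 s3_0; apply/eqP/matrixP; elim/ord2P; elim/ord2P; by rewrite !mxE.
  apply: classified_equiv (classify_alternating n1 n4).
  move: s13; rewrite s1_0 eqxx => /eqP s3_0.
  by apply: (@pencilI 1 s2^-1 1 0 0 1 s2^-1 0 (n3 / s2) 1);
    rewrite ?invr_eq0 ?oner_neq0 //; char2_ring char2 (tt, mulfV s2_0, s3_0).
pose s := s3 / s1 + (s2 / s1) ^+ 2.
have [s0|s0] := eqVneq s 0.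
  apply: classified_equiv (classify_rank1 (n3 + 1 + n1 * (s2 / s1))
    (n4 + n1 * (s2 / s1) ^+ 2 + s2 / s1)).
  have s3E : s3 = s2 ^+ 2 / s1.
    apply: (eq_of_add2 char2); rewrite -(mulr0 s1) -s0 /s.
    by char2_ring char2 (tt, mulfV s1_0).
  by apply: (@pencilI 1 s1^-1 1 0 (s2 / s1) 1 s1^-1 0 (n1 / s1) 1);
    rewrite ?invr_eq0 ?oner_neq0 //; char2_ring char2 (tt, mulfV s1_0, s3E).
have [p p0 ps] := sqrt2_neq0 char2 s0.
(* In the basis a, b' / p with b' = b + (s2 / s1) a the symmetric member is the
   identity; the isotropic vector of the latter is a + b' / p. *)
have s3E : s3 = s1 * p ^+ 2 + s2 ^+ 2 / s1.
  by rewrite ps /s; char2_ring char2 (tt, mulfV s1_0).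
apply: classified_equiv (classify_rank2
  (p * n1 + 1 + (n4 + s2 / s1 + (s2 / s1) ^+ 2 * n1) / p) (n3 + s2 / s1 * n1)).
by apply: (@pencilI p^-1 (s1^-1 * p)
    (1 + s2 / s1 / p) p^-1 1 0 s1^-1 0 (p * n1 / s1) p);
  rewrite ?mulf_neq0 ?invr_eq0 //; char2_ring char2 (tt, mulfV s1_0, mulfV p0, s3E).
Qed.

(** The difference of the two off-diagonal entries is a linear function on the
    pencil, so a nonsymmetric pencil has a symmetric member. *)
Theorem pencil_classification C D : formFree (pencil C D) -> pencil_classified C D.
Proof.
rewrite [C]mx2_eta [D]mx2_eta; move: (C _ _) (C _ _) (C _ _) (C _ _) => c4 c3 c2 c1.
move: (D _ _) (D _ _) (D _ _) (D _ _) => d4 d3 d2 d1 free.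
have [Dsym|Dns] := eqVneq d2 d3; first have [Csym|Cns] := eqVneq c2 c3.
- by rewrite Csym Dsym in free *; apply: classify_symmetric.
- apply: (@classified_equiv _ _ (mx2 d1 d2 d2 d4) (mx2 (c1 / (c2 + c3))
    (c2 / (c2 + c3)) (c3 / (c2 + c3)) (c4 / (c2 + c3)))).
    rewrite -(add2_neq0 char2) in Cns.
    by apply: (@pencilI 1 (c2 + c3)^-1 1 0 0 1 0 1 (c2 + c3)^-1 0);
      rewrite ?invr_eq0 ?oner_neq0 // -?Dsym; char2_ring char2 tt.
  apply: classify_nonsymmetric; last by rewrite -mulrDl mulfV // (add2_neq0 char2).
  apply/eqP=> D0; move/formFree_pencil/(_ 0 1): free.
  rewrite scale0r scale1r add0r -Dsym D0 => /(_ erefl)[_ /eqP].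
  by rewrite oner_eq0.
rewrite -(add2_neq0 char2) in Dns; pose e := d2 + d3.
pose r := (c2 + c3) / e.
have E3 : c3 + r * d3 = c2 + r * d2.
  apply: (eq_of_add2 char2); rewrite /r.
  have -> : c3 + (c2 + c3) / e * d3 + (c2 + (c2 + c3) / e * d2) =
      (c2 + c3) * (1 + e / e).
    by rewrite /e; char2_ring char2 tt.
  by rewrite mulfV // (addrr2 char2) mulr0.
apply: (@classified_equiv _ _
   (mx2 (c1 + r * d1) (c2 + r * d2) (c2 + r * d2) (c4 + r * d4))
   (mx2 (d1 / e) (d2 / e) (d3 / e) (d4 / e))).
  rewrite -{2}E3; apply: (@pencilI 1 e^-1 1 0 0 1 1 r 0 e^-1);
    rewrite ?invr_eq0 ?oner_neq0 //; char2_ring char2 tt.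
apply: classify_nonsymmetric; last by rewrite -mulrDl mulfV.
apply/eqP=> S0; move/formFree_pencil/(_ 1 r): free.
rewrite !scalemx2 addmx2 !mul1r E3 S0 => /(_ erefl)[/eqP].
by rewrite oner_eq0.
Qed.

End Pencils.

Section PencilInvariants.
Variables (F : finFieldType) (char2 : 2%N \in [pchar F]).
Variables (gamma0 : F) (hgamma0 : gamma0 \notin [set t ^+ 2 + t | t : F]).
Variables (eta : F -> F) (heta : forall sigma : F,
  sigma != 0 -> sigma != 1 -> eta sigma \notin Hset sigma).
Implicit Types C D : 'M[F]_2.

Local Notation pencilNF k x := (pencil (pencilC eta k x) (pencilD eta k x)).

(** ** Inequivalence of nonsymmetric pencils *)

(** The symmetric member of a nonsymmetric pencil is unique up to a scalar, which
    gives one zero entry of the matrix T; in both pencils the off-diagonal entries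
    of the second member differ by 1, which determines another entry. *)
Lemma nonsym_pencilE (s1 s2 s3 n1 n2 n4 s1' s2' s3' n1' n2' n4' : F) :
  formEquiv (pencil (mx2 s1 s2 s2 s3) (mx2 n1 n2 (n2 + 1) n4))
    (pencil (mx2 s1' s2' s2' s3') (mx2 n1' n2' (n2' + 1) n4')) ->
  exists p q r s t v w,
    [/\ p * s + q * r != 0, t != 0, w * (p * s + q * r) = 1 &
    [/\ s1' = t * (p ^+ 2 * s1 + q ^+ 2 * s3),
        s2' = t * (p * r * s1 + (p * s + q * r) * s2 + q * s * s3) &
        s3' = t * (r ^+ 2 * s1 + s ^+ 2 * s3)] /\
    [/\ n1' = v * (p ^+ 2 * s1 + q ^+ 2 * s3) + w * (p ^+ 2 * n1 + p * q + q ^+ 2 * n4),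
        n2' = v * (p * r * s1 + (p * s + q * r) * s2 + q * s * s3)
          + w * (p * r * n1 + p * s * n2 + q * r * (n2 + 1) + q * s * n4) &
        n4' = v * (r ^+ 2 * s1 + s ^+ 2 * s3) + w * (r ^+ 2 * n1 + r * s + s ^+ 2 * n4)]].
Proof.
case/pencilE=> P [T []]; rewrite [P]mx2_eta det_mx2 [T]mx2_eta det_mx2.
move: (P u0 u0) (P u0 u1) (P u1 u0) (P u1 u1) => p q r s.
rewrite ![mx2 _ _ _ _ _ _]mxE /=.
move: (T u0 u0) (T u0 u1) (T u1 u0) (T u1 u1) => t u v w.
rewrite trmx2 !scalemx2 !addmx2 !mulmx2 => P0 T0 /eqP.
rewrite mx2_eqE => /and4P[/eqP E1 /eqP E2 /eqP E3 /eqP E4] /eqP.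
rewrite mx2_eqE => /and4P[/eqP E5 /eqP E6 /eqP E7 /eqP E8].
have E23 := congr2 +%R E2 E3; rewrite (addrr2 char2) in E23.
have E67 := congr2 +%R E6 E7.
have u0 : u = 0.
  apply/eqP; rewrite -[_ == 0](mulIr_eq0 _ (mulIf P0)) [X in _ == X]E23.
  by apply/eqP; char2_ring char2 tt.
have w1 : w * (p * s + q * r) = 1.
  have -> : 1 = n2' + (n2' + 1) by char2_ring char2 tt.
  by rewrite E67; char2_ring char2 tt.
exists p, q, r, s, t, v, w; split=> //.
- by rewrite -(oppr2 char2 (q * r)).
- by apply: contraNneq T0 => t0; rewrite t0 u0 !mul0r subrr.
split; split; rewrite ?E1 ?E2 ?E4 ?E5 ?E6 ?E8; char2_ring char2 (tt, u0).
Qed.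

(** Normal forms of nonsymmetric pencils in which the first form is the symmetric
    member, sorted by its type: alternating, degenerate, or neither. *)
Definition nfAlt (d : F) := pencil (mx2 0 1 1 0) (mx2 1 1 (1 + 1) d).
Definition nfRank1 (u y : F) := pencil (mx2 1 0 0 0) (mx2 0 u (u + 1) y).
Definition nfRank2 (x z : F) := pencil (mx2 0 1 1 1) (mx2 x z (z + 1) 0).

Lemma nfAlt_rank1 d u y : ~ formEquiv (nfAlt d) (nfRank1 u y).
Proof.
case/nonsym_pencilE=> p [q [r [s [t [v [w [_ _ _ [[E _ _] _]]]]]]]].
by move/eqP: E; rewrite !(mulr0, addr0) oner_eq0.
Qed.

Lemma nfAlt_rank2 d x z : ~ formEquiv (nfAlt d) (nfRank2 x z).
Proof.
case/nonsym_pencilE=> p [q [r [s [t [v [w [_ _ _ [[_ _ E] _]]]]]]]].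
by move/eqP: E; rewrite !(mulr0, addr0) oner_eq0.
Qed.

Lemma nfRank1_rank2 u y x z : ~ formEquiv (nfRank1 u y) (nfRank2 x z).
Proof.
case/nonsym_pencilE=> p [q [r [s [t [v [w [_ _ _ [[E1 E2 E3] _]]]]]]]].
have /eqP := congr2 +%R (congr2 *%R E2 E2) (congr2 *%R E1 E3).
rewrite mulr1 mul0r addr0 (_ : _ + _ = 0) ?oner_eq0 //; char2_ring char2 tt.
Qed.

(** The second pencil has a common isotropic vector, the first one does not. *)
Lemma nfAlt_neq : ~ formEquiv (nfAlt gamma0) (nfAlt 0).
Proof.
case/nonsym_pencilE=> p [q [r [s [t [v [w [P0 t0 w1 [_ [_ _ E]]]]]]]]].
have w0 : w != 0 by apply: contraTneq (oner_neq0 F) => w0; rewrite -w1 w0 mul0r eqxx.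
have {E}Q0 : r ^+ 2 + r * s + s ^+ 2 * gamma0 = 0.
  apply/eqP; rewrite -[_ == 0](mulIr_eq0 _ (mulIf w0)) [X in _ == X]E.
  by apply/eqP; char2_ring char2 tt.
have s0 : s != 0.
  apply: contraNneq P0 => s0; have r0 : r = 0.
    by apply/eqP; rewrite -sqrf_eq0 -[X in _ == X]Q0 s0; apply/eqP; ring.
  by rewrite r0 s0 !mulr0 addr0.
case/negP: hgamma0; apply/imsetP; exists (r / s) => //.
apply: (eq_of_add2 char2); apply/eqP.
rewrite -[_ == 0](mulIr_eq0 _ (mulIf (expf_neq0 2 s0))) -[X in _ == X]Q0.
by apply/eqP; char2_ring char2 (tt, mulfV s0).
Qed.

Lemma nfRank1_inj u y u' y' : formEquiv (nfRank1 u y) (nfRank1 u' y') ->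
  (y = 0 -> y' = 0) /\ (y = 0 -> u' = u).
Proof.
case/nonsym_pencilE=> p [q [r [s [t [v [w [P0 t0 w1 [[_ _ E3] [_ E5 E6]]]]]]]]].
have r0 : r = 0.
  apply/eqP; rewrite -sqrf_eq0 -(mulrI_eq0 _ (mulfI t0)) [X in _ == X]E3.
  by apply/eqP; ring.
split=> y0; first by rewrite E6 r0 y0; ring.
by rewrite E5 r0 y0 -[RHS]mul1r -w1 r0; ring.
Qed.

Lemma nfRank2_inj x z x' z' : formEquiv (nfRank2 x z) (nfRank2 x' z') ->
  x' = x /\ exists nu, z' = z + x * nu ^+ 2 + (x + 1) * nu.
Proof.
case/nonsym_pencilE=> p [q [r [s [t [v [w [P0 t0 w1 [[E1 E2 E3] [E4 E5 E6]]]]]]]]].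
have q0 : q = 0.
  apply/eqP; rewrite -sqrf_eq0 -(mulrI_eq0 _ (mulfI t0)) [X in _ == X]E1.
  by apply/eqP; ring.
rewrite q0 in w1 E2 E3 E4 E5 E6 P0.
have s0 : s != 0 by apply: contraNneq P0 => ->; rewrite mulr0 mul0r addr0.
have ps : p = s.
  apply: (mulIf s0); apply: (mulfI t0); apply: etrans (_ : 1 = _).
    by rewrite E2; ring.
  by rewrite E3; ring.
rewrite ps in w1 E2 E3 E4 E5 E6.
split; first by rewrite E4 -[RHS]mul1r -w1; ring.
exists (r / s); have w1' : w * s ^+ 2 = 1 by rewrite -w1; ring.
have E6' : v * s ^+ 2 = w * (r ^+ 2 * x + r * s).
  apply: (eq_of_add2 char2); rewrite [RHS]E6; char2_ring char2 tt.
have -> : z + x * (r / s) ^+ 2 + (x + 1) * (r / s) =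
    (w * s ^+ 2) * (z + x * (r / s) ^+ 2 + (x + 1) * (r / s)).
  by rewrite w1' mul1r.
have -> : z' = v * s ^+ 2 + w * (s * r * x + s * s * z) by rewrite E5; ring.
by rewrite E6'; char2_ring char2 (tt, mulfV s0).
Qed.

(** The normal form of each nonsymmetric pencil of the list, with the values of
    the invariants. *)
Variant nonsym_spec (k : nat) (x : F) : Prop :=
  | SpecAlt of k = 17%N & x \in [:: 0; gamma0] &
      formEquiv (pencilNF k x) (nfAlt x)
  | SpecRank1 u y of formEquiv (pencilNF k x) (nfRank1 u y) &
      [\/ [/\ k = 14%N, x = 0, u = 0 & y = 0],
          [/\ k = 19%N, x != 1, u * (1 + x) = 1 & y = 0] |
          [/\ k = 21%N, x = 0 & y = 1]]
  | SpecRank2 x' z of formEquiv (pencilNF k x) (nfRank2 x' z) &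
      [\/ [/\ k = 18%N, x = 0 & x' = 0], [/\ k = 20%N, x = 0 & x' = 1],
          [/\ k = 22%N, (x != 0) && (x != 1), x' * (1 + x) = 1 & z = 0] |
          [/\ k = 23%N, (x != 0) && (x != 1), x' * (1 + x) = 1 & z = eta x + 1]].

Lemma nonsymP k x : k \in [:: 14; 17; 18; 19; 20; 21; 22; 23]%N ->
  x \in pencil_params gamma0 k -> nonsym_spec k x.
Proof.
rewrite !inE => kin xin; move: kin xin.
case/orP=> [/eqP->|]; first rewrite inE => /eqP->.
  apply: (SpecRank1 (u := 0) (y := 0)); last by constructor 1.
  by apply: formEquiv_sym; rewrite /nfRank1 add0r; apply: formEquiv_refl.
case/orP=> [/eqP-> xin|].
  apply: SpecAlt => //; apply: formEquiv_sym.
  by apply: (@pencilI _ 1 1 1 0 0 1 1 1 1 0); rewrite ?oner_neq0 //; char2_ring char2 tt.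
case/orP=> [/eqP->|]; first rewrite inE => /eqP->.
  apply: (SpecRank2 (x' := 0) (z := 0)); last by constructor 1.
  apply: formEquiv_sym.
  by apply: (@pencilI _ 1 1 0 1 1 0 1 1 0 1); rewrite ?oner_neq0 //; char2_ring char2 tt.
case/orP=> [/eqP->|]; first rewrite mem_enum inE => x1.
  have x1' : 1 + x != 0 by rewrite (add2_neq0 char2) eq_sym.
  apply: (SpecRank1 (u := (1 + x)^-1) (y := 0)).
    apply: formEquiv_sym.
    have xE : x = 1 + (1 + x) by char2_ring char2 tt.
    rewrite /= {2}xE; move: (1 + x) x1' {xE x1} => e e0.
    by apply: (@pencilI _ 1 e 1 0 0 1 1 0 0 e); rewrite ?oner_neq0 //;
      char2_ring char2 (tt, mulfV e0).
  by constructor 2; rewrite mulVf.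
case/orP=> [/eqP->|]; first rewrite inE => /eqP->.
  apply: (SpecRank2 (x' := 1) (z := 0)); last by constructor 2.
  apply: formEquiv_sym.
  by apply: (@pencilI _ 1 1 0 1 1 1 1 0 0 1); rewrite ?oner_neq0 //; char2_ring char2 tt.
case/orP=> [/eqP->|]; first rewrite inE => /eqP->.
  apply: (SpecRank1 (u := 1) (y := 1)); last by constructor 3.
  apply: formEquiv_sym.
  by apply: (@pencilI _ 1 1 1 0 1 1 1 1 0 1); rewrite ?oner_neq0 //; char2_ring char2 tt.
have xE : x = 1 + (1 + x) by char2_ring char2 tt.
case/orP=> /eqP->; rewrite mem_enum inE => /andP[x0 x1].
  have x1' : 1 + x != 0 by rewrite (add2_neq0 char2) eq_sym.
  apply: (SpecRank2 (x' := (1 + x)^-1) (z := 0)); last first.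
    by constructor 3; rewrite x0 x1 mulVf.
  apply: formEquiv_sym; rewrite /= [in mx2 1 0 x 1]xE.
  move: (1 + x) x1' {xE x1} => e e0.
  by apply: (@pencilI _ e e^-1 0 1 e 1 1 (e^-1 + 1) 0 e^-1); rewrite ?invr_eq0 //;
    char2_ring char2 (tt, mulfV e0).
have x1' : 1 + x != 0 by rewrite (add2_neq0 char2) eq_sym.
apply: (SpecRank2 (x' := (1 + x)^-1) (z := eta x + 1)); last first.
  by constructor 4; rewrite x0 x1 mulVf.
have h0 : eta x != 0.
  apply: contraNneq (heta x0 x1) => ->.
  by have := HsetP char2 x 0; rewrite mulr0 mul0r add0r expr0n.
apply: formEquiv_sym; rewrite /=; move: (eta x) h0 => h h0.
rewrite [in x * h^-1]xE; move: (1 + x) x1' {xE x1} => e e0.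
by apply: (@pencilI _ e (e^-1 / h) 0 1 e 1 1 ((e^-1 + 1) / h) 0 (e^-1 / h));
  rewrite ?mulf_neq0 ?invr_eq0 //; char2_ring char2 (tt, mulfV e0, mulfV h0).
Qed.

(** This is the defining property of eta, read in terms of the changes of z that
    are possible in [nfRank2]. *)
Lemma eta_separates x nu x' : x != 0 -> x != 1 -> x' * (1 + x) = 1 ->
  eta x + 1 != x' * nu ^+ 2 + (x' + 1) * nu.
Proof.
move=> x0 x1 xx'; apply: contraNneq (heta x0 x1) => E.
have x1' : 1 + x != 0 by rewrite (add2_neq0 char2) eq_sym.
have -> : eta x = x' * nu ^+ 2 + (x' + 1) * nu + 1 by rewrite -E; char2_ring char2 tt.
pose w := 1 + nu * x'.
suff -> : x' * nu ^+ 2 + (x' + 1) * nu + 1 = x * w * (1 + w) + w ^+ 2 by apply: HsetP.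
have xE : x = 1 + (1 + x) by char2_ring char2 tt.
rewrite /w {}[in RHS]xE; move: (1 + x) xx' {x1' E} => e xx'.
by char2_ring char2 (tt, xx').
Qed.

Theorem nonsym_pencil_unique k x k' x' :
  k \in [:: 14; 17; 18; 19; 20; 21; 22; 23]%N -> x \in pencil_params gamma0 k ->
  k' \in [:: 14; 17; 18; 19; 20; 21; 22; 23]%N -> x' \in pencil_params gamma0 k' ->
  formEquiv (pencilNF k x) (pencilNF k' x') -> (k, x) = (k', x').
Proof.
move=> kin xin kin' xin' E.
have trans B B' : formEquiv (pencilNF k x) B -> formEquiv (pencilNF k' x') B' ->
    formEquiv B B'.
  by move=> EB EB'; apply: formEquiv_trans (formEquiv_sym EB) (formEquiv_trans E EB').
have [k17 xg EB|u y EB sp|y z EB sp] := nonsymP kin xin;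
  have [k17' xg' EB'|u' y' EB' sp'|y' z' EB' sp'] := nonsymP kin' xin';
  have {}E := trans _ _ EB EB'.
- rewrite k17 k17'; congr pair; move: xg xg' E; rewrite !inE.
  case/orP=> /eqP->; case/orP=> /eqP-> // E; last by case: nfAlt_neq.
  by case: nfAlt_neq; apply: formEquiv_sym.
- by case: (nfAlt_rank1 E).
- by case: (nfAlt_rank2 E).
- by case: (nfAlt_rank1 (formEquiv_sym E)).
- have [yy' uu'] := nfRank1_inj E; have [y'y u'u] := nfRank1_inj (formEquiv_sym E).
  case: sp => [[k14 x0 u_0 y0]|[k19 x1 ux y0]|[k21 x0 y1]];
  case: sp' => [[k14' x0' u_0' y0']|[k19' x1' ux' y0']|[k21' x0' y1']].
  + by rewrite k14 k14' x0 x0'.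
  + move/eqP: ux'; rewrite (uu' y0) u_0 mul0r eq_sym; by rewrite oner_eq0.
  + by move/eqP: y1'; rewrite (yy' y0) eq_sym oner_eq0.
  + move/eqP: ux; rewrite (u'u y0') u_0' mul0r eq_sym; by rewrite oner_eq0.
  + rewrite k19 k19'; congr pair; apply: (addrI 1).
    have u_0 : u != 0.
      by apply: contraTneq (oner_neq0 F) => u_0; rewrite -ux u_0 mul0r eqxx.
    by apply: (mulfI u_0); rewrite ux -(uu' y0) ux'.
  + by move/eqP: y1'; rewrite (yy' y0) eq_sym oner_eq0.
  + by move/eqP: y1; rewrite (y'y y0') eq_sym oner_eq0.
  + by move/eqP: y1; rewrite (y'y y0') eq_sym oner_eq0.
  + by rewrite k21 k21' x0 x0'.
- by case: (nfRank1_rank2 E).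
- by case: (nfAlt_rank2 (formEquiv_sym E)).
- by case: (nfRank1_rank2 (formEquiv_sym E)).
have [eqy [nu eqz]] := nfRank2_inj E.
have inv0 (a b : F) : a * b = 1 -> a != 0.
  by move=> ab; apply: contraTneq (oner_neq0 F) => a0; rewrite -ab a0 mul0r eqxx.
have inv1 (a b : F) : b != 0 -> a * (1 + b) = 1 -> a != 1.
  move=> b0 ab; apply: contraNneq b0 => a1; apply/eqP/(addrI 1).
  by rewrite addr0 -[RHS]ab a1 mul1r.
case: sp => [[-> -> y0]|[-> -> y1]|[-> /andP[x0 x1] yx z0]|[-> /andP[x0 x1] yx zx]];
  case: sp' => [[-> -> y0']|[-> -> y1']|[-> /andP[x0' x1'] yx' z0']|
                [-> /andP[x0' x1'] yx' zx']] //.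
- by move/eqP: eqy; rewrite y0 y1' oner_eq0.
- by have := inv0 _ _ yx'; rewrite eqy y0 eqxx.
- by have := inv0 _ _ yx'; rewrite eqy y0 eqxx.
- by move/eqP: eqy; rewrite y1 y0' eq_sym oner_eq0.
- by have := inv1 _ _ x0' yx'; rewrite eqy y1 eqxx.
- by have := inv1 _ _ x0' yx'; rewrite eqy y1 eqxx.
- by have := inv0 _ _ yx; rewrite -eqy y0' eqxx.
- by have := inv1 _ _ x0 yx; rewrite -eqy y1' eqxx.
- congr pair; apply: (addrI 1).
  by apply: (mulfI (inv0 _ _ yx)); rewrite yx -eqy yx'.
- by have := eta_separates nu x0' x1' yx'; rewrite -zx' eqz z0 eqy add0r eqxx.
- by have := inv0 _ _ yx; rewrite -eqy y0' eqxx.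
- by have := inv1 _ _ x0 yx; rewrite -eqy y1' eqxx.
- have := eta_separates nu x0 x1 yx; rewrite -zx; case/eqP.
  by apply: (eq_of_add2 char2); rewrite addrA -eqz z0'.
congr pair; apply: (addrI 1).
by apply: (mulfI (inv0 _ _ yx)); rewrite yx -eqy yx'.
Qed.

(** ** Inequivalence of symmetric pencils *)

(** The determinant on the first pencil is anisotropic, while the second pencil
    contains a form of rank one. *)
Lemma pencil15_sym_neq : ~ formEquiv (pencilNF 15 gamma0) (pencilNF 15 0).
Proof.
case/pencilE=> P [T []]; rewrite [T]mx2_eta det_mx2 ![mx2 _ _ _ _ _ _]mxE /=.
move: (T u0 u0) (T u0 u1) (T u1 u0) (T u1 u1) => t u v w P0 T0 E _.
(* The member with matrix E11 is degenerate, but t * C + u * D is not. *)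
have : \det (t *: mx2 1 0 0 gamma0 + u *: mx2 0 1 1 1) == 0.
  move/(congr1 determinant): E; rewrite !det_mulmx det_tr det_mx2 => /esym/eqP.
  by rewrite !mulr0 subr0 !mulf_eq0 (negPf P0) /= orbF.
rewrite !scalemx2 addmx2 det_mx2 => /eqP E0.
have t0 : t != 0.
  apply: contraNneq T0 => t0; have u_0 : u = 0.
    apply/eqP; rewrite -sqrf_eq0 -[X in _ == X]E0; apply/eqP.
    by char2_ring char2 (tt, t0).
  by rewrite t0 u_0 !mul0r subrr.
case/negP: hgamma0; apply/imsetP; exists (u / t) => //.
apply: (eq_of_add2 char2); apply/eqP.
rewrite -[_ == 0](mulIr_eq0 _ (mulIf (expf_neq0 2 t0))) -[X in _ == X]E0.
by apply/eqP; char2_ring char2 (tt, mulfV t0).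
Qed.

Lemma bform_mx2 (a b c d : F) v :
  bform (mx2 a b c d) v v =
  v 0 u0 ^+ 2 * a + v 0 u0 * v 0 u1 * (b + c) + v 0 u1 ^+ 2 * d.
Proof.
rewrite /bform mxE sum2 2![(v *m _) _ _]mxE !sum2 ![v^T _ _]mxE.
by rewrite ![mx2 _ _ _ _ _ _]mxE /=; ring.
Qed.

(** Only the second pencil contains an alternating form. *)
Lemma pencil15_16_neq delta x : ~ formEquiv (pencilNF 15 delta) (pencilNF 16 x).
Proof.
case/pencilE=> P [T [P0 T0 _ /= ED]].
move: T0; rewrite [T]mx2_eta det_mx2; move: ED.
move: (T u0 u0) (T u0 u1) (T u1 u0) (T u1 u1) => t u v w.
rewrite !scalemx2 addmx2 => ED /negP[].
have uP : P \in unitmx by rewrite unitmxE unitfE.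
have alt y : bform (mx2 (v * 1 + w * 0) (v * 0 + w * 1)
                      (v * 0 + w * 1) (v * delta + w * 1)) y y = 0.
  have : bform (mx2 0 1 1 0) (y *m invmx P) (y *m invmx P) = 0.
    by rewrite bform_mx2; char2_ring char2 tt.
  by rewrite ED bform_congr mulmxKV.
have v0 : v = 0.
  have := alt (delta_mx 0 u0); rewrite bform_mx2 !mxE /= => E.
  by rewrite -[RHS]E; ring.
have w0 : w = 0.
  have := alt (delta_mx 0 u1); rewrite bform_mx2 !mxE /= => E.
  by rewrite -[RHS]E v0; ring.
by rewrite v0 w0 !mulr0 subrr.
Qed.

Lemma pencil_nonsym (B : 'I_2 -> 'M[F]_2) s1 s2 s3 n1 n2 n4 :
  (forall k, (B k)^T = B k) ->
  ~ formEquiv B (pencil (mx2 s1 s2 s2 s3) (mx2 n1 n2 (n2 + 1) n4)).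
Proof.
move=> symB [P [T [_ _ E]]].
have : (mx2 n1 n2 (n2 + 1) n4)^T == mx2 n1 n2 (n2 + 1) n4.
  rewrite -[mx2 n1 _ _ _]/(pencil (mx2 s1 s2 s2 s3) (mx2 n1 n2 (n2 + 1) n4) u1) E.
  apply/eqP; rewrite linear_sum /=; apply: eq_bigr => l _.
  by rewrite linearZ /= !trmx_mul trmxK symB mulmxA.
rewrite trmx2 mx2_eqE => /and3P[_ /eqP E1 _].
have /eqP : 1 = 0 :> F by apply: (addrI n2); rewrite addr0.
by rewrite oner_eq0.
Qed.

Theorem pencil_unique k x k' x' :
  k \in iota 14 10 -> x \in pencil_params gamma0 k ->
  k' \in iota 14 10 -> x' \in pencil_params gamma0 k' ->
  formEquiv (pencilNF k x) (pencilNF k' x') -> (k, x) = (k', x').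
Proof.
have split l : l \in iota 14 10 ->
    (l \in [:: 14; 17; 18; 19; 20; 21; 22; 23]%N) || (l \in [:: 15; 16]%N).
  by rewrite !inE; (do !case/orP) => /eqP->.
have symP l y : l \in [:: 15; 16]%N -> forall i, (pencilNF l y i)^T = pencilNF l y i.
  by rewrite !inE => /orP[]/eqP->; elim/ord2P; rewrite /pencil /= trmx2.
have mixed l y l' y' : l \in [:: 15; 16]%N ->
    l' \in [:: 14; 17; 18; 19; 20; 21; 22; 23]%N -> y' \in pencil_params gamma0 l' ->
    ~ formEquiv (pencilNF l y) (pencilNF l' y').
  move=> lin l'in y'in E.
  by case: (nonsymP l'in y'in) => [_ _ E'|u z E' _|u z E' _];
    apply: (pencil_nonsym (symP l y lin)); apply: formEquiv_trans E E'.
move=> /split/orP[kin|kin] xin /split/orP[kin'|kin'] xin' E.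
- exact: nonsym_pencil_unique.
- by case: (mixed _ _ _ _ kin' kin xin (formEquiv_sym E)).
- by case: (mixed _ _ _ _ kin kin' xin' E).
move: kin kin' xin xin' E; rewrite !inE.
case/orP=> /eqP->; case/orP=> /eqP->; rewrite !inE.
- case/orP=> /eqP->; case/orP=> /eqP-> // E; last by case: pencil15_sym_neq.
  by case: pencil15_sym_neq; apply: formEquiv_sym.
- by move=> _ _ /pencil15_16_neq.
- by move=> _ _ /formEquiv_sym/pencil15_16_neq.
by move=> /eqP-> /eqP->.
Qed.

End PencilInvariants.

(** * The presented algebras *)

Section Presentations.
Variables (F : finFieldType) (char2 : 2%N \in [pchar F]).
Variable eta : F -> F.

Definition pa : 'I_4 := @Ordinal 4 0 isT.
Definition pb : 'I_4 := @Ordinal 4 1 isT.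
Definition pc : 'I_4 := @Ordinal 4 2 isT.
Definition pd : 'I_4 := @Ordinal 4 3 isT.

Lemma ord4P (P : 'I_4 -> Prop) : P pa -> P pb -> P pc -> P pd -> forall i, P i.
Proof.
move=> P0 P1 P2 P3 [[|[|[|[|//]]]] lti].
- by rewrite (_ : Ordinal lti = pa) //; apply: val_inj.
- by rewrite (_ : Ordinal lti = pb) //; apply: val_inj.
- by rewrite (_ : Ordinal lti = pc) //; apply: val_inj.
- by rewrite (_ : Ordinal lti = pd) //; apply: val_inj.
Qed.

Definition row4 (a b c d : F) : 'rV[F]_4 := \row_k nth 0 [:: a; b; c; d] k.

Lemma row4P (P : 'rV[F]_4 -> Prop) :
  (forall a b c d, P (row4 a b c d)) -> forall v, P v.
Proof.
move=> Prow v; suff -> : v = row4 (v 0 pa) (v 0 pb) (v 0 pc) (v 0 pd) by [].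
by apply/rowP; elim/ord4P; rewrite mxE.
Qed.

(** The list consists of 24 families, numbered from 0 in the order of the list; x
    is the parameter of the family, if it has one. *)
Definition presOf (k : nat) (x : F) : presentation4 F :=
  match k with
  | 0%N => A4_1
  | 1%N => A4_2
  | 2%N => A4_3 1
  | 3%N => A4_4 x
  | 4%N => A4_5
  | 5%N => A4_6
  | 6%N => A4_8 1 1
  | 7%N => A4_9 1 x
  | 8%N => A4_10 x
  | 9%N => A4_11
  | 10%N => A4_12
  | 11%N => A4_13
  | 12%N => A4_14
  | 13%N => A4_15
  | 14%N => A4_16
  | 15%N => A4_17 x
  | 16%N => A4_18 1
  | 17%N => A4_19 x
  | 18%N => A4_20
  | 19%N => A4_21 x
  | 20%N => A4_26 0 0 1
  | 21%N => A4_26 0 1 1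
  | 22%N => A4_26 0 x 1
  | _ => A4_26 (1 + (eta x)^-1) (x * (eta x)^-1) 1
  end.

(** If some basis vectors, selected by sigma, multiply into the span of the
    others, selected by tau, and the latter annihilate the algebra, then the
    presented algebra is the one of a tuple of forms. *)
Lemma pres_formAlg m n (r : presentation4 F) (B : 'I_n -> 'M[F]_m)
    (sigma : 'I_m -> 'I_4) (tau : 'I_n -> 'I_4) : (m + n)%N = 4%N ->
  (forall j, (exists i, sigma i = j) \/ (exists k, tau k = j)) ->
  (forall x y i, presMul r x y 0 (sigma i) = 0) ->
  (forall x y k, presMul r x y 0 (tau k) =
     bform (B k) (\row_i x 0 (sigma i)) (\row_i y 0 (sigma i))) ->
  nuIsomorphic (pres r) (formAlg B).
Proof.
move=> mn4 cover Msigma Mtau.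
pose h (x : pres r) : formAlg B := (\row_i x 0 (sigma i), \row_k x 0 (tau k)).
have lin_h : linear h.
  by move=> k x y; congr pair; apply/rowP=> i; rewrite !mxE.
pose hL := GRing.isLinear.Build _ _ _ _ h lin_h.
pose h' : {linear pres r -> formAlg B} := HB.pack h hL.
have inj_h : injective h'.
  move=> x y [/rowP Es /rowP Et]; apply/rowP=> j.
  by case: (cover j) => [[i <-]|[k <-]]; [move: (Es i)|move: (Et k)]; rewrite !mxE.
exists h'; split.
  apply: linear_inj_bij => //; rewrite !dimvf -[RHS]/(1 * m + 1 * n)%N.
  by rewrite !mul1n mn4.
move=> x y; congr pair; apply/rowP=> i; rewrite !mxE; first exact: Msigma.
exact: Mtau.
Qed.

End Presentations.

Ltac pres_coords :=
  rewrite /= /presMul !(big_cons, big_nil) /= !mxE /= ?mulr1n ?mulr0n.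

Section PresentationForms.
Variables (F : finFieldType) (char2 : 2%N \in [pchar F]).
Variable eta : F -> F.

Lemma presOf_ternary k x : k \in ternary_labels ->
  nuIsomorphic (pres (presOf eta k x)) (formAlg (fun _ : 'I_1 => ternary k x)).
Proof.
have cover3 (s : 'I_3 -> 'I_4) (t : 'I_4) : uniq [:: s o0; s o1; s o2; t] ->
    forall j, (exists i, s i = j) \/ (exists k : 'I_1, t = j).
  move=> us j; have sub : {subset [:: s o0; s o1; s o2; t] <= enum 'I_4}.
    by move=> i; rewrite mem_enum.
  have [|_ E] := uniq_min_size us sub; first by rewrite size_enum_ord.
  have := E j; rewrite mem_enum !inE => /or4P[]/eqP->;
    by [left; exists o0|left; exists o1|left; exists o2|right; exists 0].
pose s1 := fun i : 'I_3 => nth pa [:: pa; pc; pd] i.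
pose s2 := fun i : 'I_3 => nth pa [:: pa; pb; pd] i.
pose s3 := fun i : 'I_3 => nth pa [:: pa; pb; pc] i.
have ternaryP (r : presentation4 F) (M : 'M[F]_3) s t : uniq [:: s o0; s o1; s o2; t] ->
    (forall x0 x1 x2 x3 y0 y1 y2 y3,
       let x := row4 x0 x1 x2 x3 in let y := row4 y0 y1 y2 y3 in
       (forall i, presMul r x y 0 (s i) = 0) /\ presMul r x y 0 t =
       bform M (row3 (x 0 (s o0)) (x 0 (s o1)) (x 0 (s o2)))
         (row3 (y 0 (s o0)) (y 0 (s o1)) (y 0 (s o2)))) ->
    nuIsomorphic (pres r) (formAlg (fun _ : 'I_1 => M)).
  move=> us E; apply: (pres_formAlg (sigma := s) (tau := fun=> t)) => //.
  - exact: cover3.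
  - elim/row4P=> x0 x1 x2 x3; elim/row4P=> y0 y1 y2 y3.
    by have [] := E x0 x1 x2 x3 y0 y1 y2 y3.
  elim/row4P=> x0 x1 x2 x3; elim/row4P=> y0 y1 y2 y3 i.
  have [_ ->] := E x0 x1 x2 x3 y0 y1 y2 y3; congr (bform _ _ _);
    by rewrite [RHS]row3_eta; congr row3; rewrite [RHS]mxE.
rewrite !inE; case/orP=> [/eqP->|].
  apply: (ternaryP _ _ s1 pb) => // x0 x1 x2 x3 y0 y1 y2 y3 y z; split.
    by elim/ord3P; pres_coords; char2_ring char2 tt.
  by rewrite bform_mx3; pres_coords; char2_ring char2 tt.
have s2P (r : presentation4 F) M := ternaryP r M s2 pc isT.
have s3P (r : presentation4 F) M := ternaryP r M s3 pd isT.
(do 6?case/orP) => /eqP->;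
  first [ apply: s2P => x0 x1 x2 x3 y0 y1 y2 y3 y z; split;
            [elim/ord3P | rewrite bform_mx3]; pres_coords; char2_ring char2 tt
        | apply: s3P => x0 x1 x2 x3 y0 y1 y2 y3 y z; split;
            [elim/ord3P | rewrite bform_mx3]; pres_coords; char2_ring char2 tt].
Qed.

Lemma presOf_pencil k x : k \in iota 14 10 ->
  nuIsomorphic (pres (presOf eta k x))
    (formAlg (pencil (pencilC eta k x) (pencilD eta k x))).
Proof.
pose s := fun i : 'I_2 => nth pa [:: pa; pb] i.
pose t := fun i : 'I_2 => nth pa [:: pc; pd] i.
have cover j : (exists i, s i = j) \/ (exists i, t i = j).
  by elim/ord4P: j; [left; exists u0|left; exists u1|right; exists u0|right; exists u1].
have bform_row2 (a b c d x0 x1 y0 y1 : F) :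
    bform (mx2 a b c d) (\row_i nth 0 [:: x0; x1] i) (\row_i nth 0 [:: y0; y1] i) =
    (x0 * a + x1 * c) * y0 + (x0 * b + x1 * d) * y1.
  by rewrite /bform mxE sum2 2![(_ *m _) _ _]mxE !sum2 !mxE.
have row2E (y : 'rV[F]_4) : \row_i y 0 (s i) = \row_i nth 0 [:: y 0 pa; y 0 pb] i.
  by apply/rowP; elim/ord2P; rewrite !mxE.
have pencilP (r : presentation4 F) a b c d a' b' c' d' :
    (forall x0 x1 x2 x3 y0 y1 y2 y3,
       let x := row4 x0 x1 x2 x3 in let y := row4 y0 y1 y2 y3 in
       presMul r x y = row4 0 0 ((x0 * a + x1 * c) * y0 + (x0 * b + x1 * d) * y1)
        ((x0 * a' + x1 * c') * y0 + (x0 * b' + x1 * d') * y1)) ->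
    nuIsomorphic (pres r) (formAlg (pencil (mx2 a b c d) (mx2 a' b' c' d'))).
  move=> E; apply: (pres_formAlg (sigma := s) (tau := t)) => //;
    elim/row4P=> x0 x1 x2 x3; elim/row4P=> y0 y1 y2 y3; elim/ord2P;
    by rewrite E mxE //= !row2E bform_row2 ![row4 _ _ _ _ _ _]mxE.
by rewrite !inE; (do !case/orP) => /eqP->;
  apply: pencilP => x0 x1 x2 x3 y0 y1 y2 y3 y z;
  apply/rowP; elim/ord4P; pres_coords; char2_ring char2 tt.
Qed.

End PresentationForms.

(** * The powers of a nilpotent algebra *)

Section Powers.
Variables (F : fieldType) (A : nuAlgebra F).
Local Notation "x ** y" := (nuMul A x y) (at level 40, left associativity).

Lemma mulA0l y : 0 ** y = 0.
Proof. exact: linear0l. Qed.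
Lemma mulA0r x : x ** 0 = 0.
Proof. exact: linear0r. Qed.
Lemma mulADl x x' y : (x + x') ** y = x ** y + x' ** y.
Proof. exact: linearDl. Qed.
Lemma mulADr x y y' : x ** (y + y') = x ** y + x ** y'.
Proof. exact: linearDr. Qed.
Lemma mulAZl k x y : (k *: x) ** y = k *: (x ** y).
Proof. exact: linearZl_LR. Qed.
Lemma mulAZr k x y : x ** (k *: y) = k *: (x ** y).
Proof. exact: linearZr_LR. Qed.
Lemma mulA_suml (I : Type) (r : seq I) (P : pred I) f y :
  (\sum_(i <- r | P i) f i) ** y = \sum_(i <- r | P i) f i ** y.
Proof. by apply: (big_morph (fun x => x ** y)) => [x x'|]; rewrite ?mulADl ?mulA0l. Qed.
Lemma mulA_sumr (I : Type) (r : seq I) (P : pred I) f x :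
  x ** (\sum_(i <- r | P i) f i) = \sum_(i <- r | P i) x ** f i.
Proof. by apply: (big_morph (nuMul A x)) => [y y'|]; rewrite ?mulADr ?mulA0r. Qed.

Fixpoint powGens (n : nat) : seq A :=
  if n is n'.+1 then [seq x ** y | x <- powGens n', y <- vbasis fullv]
  else vbasis fullv.

(** [pow n] is the power A^(n+1), so that [pow 0] is the whole algebra. *)
Definition pow (n : nat) : {vspace A} := <<powGens n>>%VS.

Lemma mem_pow0 x : x \in pow 0.
Proof. by rewrite /pow /= (span_basis (vbasisP _)) memvf. Qed.

Lemma span_mul_sub (X Y : seq A) (W : {vspace A}) :
  (forall x y, x \in X -> y \in Y -> x ** y \in W) ->
  forall x y, x \in <<X>>%VS -> y \in <<Y>>%VS -> x ** y \in W.
Proof.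
move=> XYW x y /(@coord_span _ _ _ (in_tuple X))-> /(@coord_span _ _ _ (in_tuple Y))->.
rewrite mulA_suml memv_suml // => i _; rewrite mulA_sumr memv_suml // => j _.
by rewrite mulAZl mulAZr !memvZ // XYW // mem_nth.
Qed.

Lemma mem_powS n x y : x \in pow n -> x ** y \in pow n.+1.
Proof.
move=> xn; apply: (span_mul_sub _ xn (mem_pow0 y)) => u v un vn.
by apply: memv_span; apply: allpairs_f.
Qed.

Lemma powS_sub n (W : {vspace A}) :
  (forall x y, x \in pow n -> x ** y \in W) -> (pow n.+1 <= W)%VS.
Proof.
move=> nW; apply/span_subvP=> _ /allpairsP[[x y] [/= xn _ ->]].
exact/nW/memv_span.
Qed.

Lemma pow_decr n : (pow n.+1 <= pow n)%VS.
Proof.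
elim: n => [|n IHn]; first by apply/subvP => x _; apply: mem_pow0.
by apply: powS_sub => x y /(subvP IHn); apply: mem_powS.
Qed.

Lemma pow_stable n k : (pow n <= pow n.+1)%VS -> (pow n <= pow (n + k))%VS.
Proof.
move=> st; elim: k => [|k IHk]; first by rewrite addn0.
rewrite addnS; apply: subv_trans st _.
by apply: powS_sub => x y /(subvP IHk); apply: mem_powS.
Qed.

Lemma pow_nilpotent : nuNilpotent A -> exists n, pow n = 0%VS.
Proof.
case=> n nil; exists n; apply/eqP; rewrite -subv0; apply/span_subvP => x xn.
suff [y [s ->]] : exists y (s : n.-tuple A), x = foldl (nuMul A) y s.
  by rewrite nil mem0v.
elim: n {nil} x xn => [|n IHn] x; first by exists x, [tuple].
case/allpairsP=> [[u v] /= [/IHn[y [s ->]] _ ->]].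
by exists y, [tuple of rcons s v]; rewrite foldl_rcons.
Qed.

(** Two equal consecutive powers would be equal to all later ones, hence zero. *)
Lemma pow_strict n : nuNilpotent A -> pow n != 0%VS ->
  (\dim (pow n.+1) < \dim (pow n))%N.
Proof.
move=> /pow_nilpotent[N N0] n0.
rewrite ltn_neqAle (dimvS (pow_decr n)) andbT; apply: contra n0 => /eqP E.
have st : (pow n <= pow n.+1)%VS.
  by rewrite -(geq_leqif (dimv_leqif_sup (pow_decr n))) E.
have [leNn|/ltnW lenN] := leqP N n.
  suff sub k : (pow (N + k) <= pow N)%VS.
    by rewrite -subv0 -N0 -(subnKC leNn); apply: sub.
  elim: k => [|k IHk]; first by rewrite addn0.
  by rewrite addnS; apply: subv_trans (pow_decr _) IHk.
by rewrite -subv0 -N0 -(subnKC lenN); apply: pow_stable.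
Qed.

Hypothesis assocA : nuAssociative A.

Lemma pow_mul i j x y : x \in pow i -> y \in pow j -> x ** y \in pow (i + j).+1.
Proof.
elim: j x y => [|j IHj] x y xi yj; first by rewrite addn0 mem_powS.
have xx : x \in <<[:: x]>>%VS by rewrite memv_span ?mem_head.
apply: (span_mul_sub _ xx yj).
move=> u v; rewrite inE => /eqP->{u} /allpairsP[[u w] /= [uj _ ->]].
by rewrite assocA addnS mem_powS // IHj // memv_span.
Qed.

Lemma pow_mul_eq0 N i j x y : pow N = 0%VS -> (N <= (i + j).+1)%N ->
  x \in pow i -> y \in pow j -> x ** y = 0.
Proof.
move=> N0 leN xi yj; apply/eqP; rewrite -memv0 -N0.
have := pow_mul xi yj; rewrite -(subnKC leN).
elim: (_ - N)%N => [|k IHk]; rewrite ?addn0 // addnS.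
by move=> /(subvP (pow_decr _)).
Qed.

End Powers.

(** * Algebras in which all products of three elements vanish *)

Section ClassTwo.
Variables (F : fieldType) (A : nuAlgebra F).
Hypotheses (assocA : nuAssociative A) (pow2 : pow A 2 = 0%VS).
Local Notation "x ** y" := (nuMul A x y) (at level 40, left associativity).

Lemma class2_formAlg m n : \dim (pow A 1) = n -> nuDim A = (m + n)%N ->
  exists B : 'I_n -> 'M[F]_m, formFree B /\ nuIsomorphic A (formAlg B).
Proof.
move=> dimU dimA; pose U := pow A 1.
have dimW : \dim (U^C)%VS = m by rewrite dimv_compl dimU [\dim _]dimA addnK.
have [X basisX] : exists X : n.-tuple A, basis_of U X.
  by rewrite -dimU; exists (vbasis U); apply: vbasisP.
have [Y basisY] : exists Y : m.-tuple A, basis_of (U^C)%VS Y.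
  by rewrite -dimW; exists (vbasis _); apply: vbasisP.
have XU k : X`_k \in U.
  have [kn|nk] := ltnP k n; last by rewrite nth_default ?size_tuple ?mem0v.
  by apply: (basis_mem basisX); rewrite mem_nth ?size_tuple.
have mulU x y : x ** y \in U by apply: mem_powS; apply: mem_pow0.
have Ux u x : u \in U -> u ** x = 0.
  by move=> uU; apply/eqP; rewrite -memv0 -pow2 mem_powS.
have xU u x : u \in U -> x ** u = 0.
  move=> uU; apply/eqP; rewrite -memv0 -pow2.
  by apply: (@pow_mul _ _ assocA 0 1) => //; apply: mem_pow0.
pose B (k : 'I_n) := \matrix_(i < m, j < m) coord X k (Y`_i ** Y`_j).
have mulY (i j : 'I_m) : Y`_i ** Y`_j = \sum_k B k i j *: X`_k.
  have YU : Y`_i ** Y`_j \in <<X>>%VS by rewrite (span_basis basisX).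
  rewrite {1}(coord_span YU).
  by apply: eq_bigr => k _; rewrite mxE.
exists B; split.
  (* A linear relation between the forms is a linear function on A^2 that
     vanishes on all products. *)
  move=> t E; pose phi v : F^o := \sum_k t 0 k * coord X k v.
  have lin_phi : linear phi.
    move=> c v w; rewrite /phi scaler_sumr -big_split; apply: eq_bigr => k _ /=.
    by rewrite linearP mulrDr /GRing.scale /= mulrCA.
  pose phiL := GRing.isLinear.Build _ _ _ _ phi lin_phi.
  pose phi' : {linear A -> F^o} := HB.pack phi phiL.
  have phiY i j : phi' (Y`_(i : 'I_m) ** Y`_(j : 'I_m)) = 0.
    have /matrixP/(_ i j) := E; rewrite summxE !mxE => E0.
    by rewrite -[RHS]E0 /= /phi; apply: eq_bigr => k _; rewrite !mxE.
  have phiM x y : phi' (x ** y) = 0.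
    have decomp v : v \in (U^C + U)%VS by rewrite addvC addv_complf memvf.
    have /memv_addP[w wY [u uX ->]] := decomp x.
    have /memv_addP[w' wY' [u' uX' ->]] := decomp y.
    rewrite mulADl (Ux _ _ uX) addr0 mulADr (xU _ _ uX') addr0.
    move: wY wY'; rewrite -(span_basis basisY) => /coord_span-> /coord_span->.
    rewrite mulA_suml linear_sum big1 // => i _.
    rewrite mulA_sumr linear_sum big1 // => j _.
    by rewrite mulAZl mulAZr !linearZ phiY /= !scaler0.
  have /subvP Uker : (U <= lker (linfun phi'))%VS.
    by apply: powS_sub => x y _; rewrite memv_ker lfunE phiM.
  apply/rowP=> k; have := Uker _ (XU k); rewrite memv_ker lfunE /= /phi (bigD1 k) //=.
  rewrite (coord_free k k (basis_free basisX)) eqxx mulr1 big1 ?addr0 => [/eqP->|l lk].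
    by rewrite mxE.
  by rewrite (coord_free _ _ (basis_free basisX)) eq_sym (negPf lk) mulr0.
pose g (z : formAlg B) : A := \sum_i z.1 0 i *: Y`_i + \sum_k z.2 0 k *: X`_k.
have lin_g : linear g.
  move=> c z w; rewrite /g scalerDr addrACA !scaler_sumr -!big_split /=.
  by congr (_ + _); apply: eq_bigr => i _; rewrite !mxE scalerDl scalerA.
pose gL := GRing.isLinear.Build _ _ _ _ g lin_g.
pose g' : {linear formAlg B -> A} := HB.pack g gL.
apply: nuIso_sym; exists g'; split.
  apply: linear_inj_bij; last first.
    by rewrite [RHS]dimA !dimvf -[LHS]/(1 * m + 1 * n)%N !mul1n.
  apply: raddf_inj => -[x u] /= E.
  have xY : \sum_i x 0 i *: Y`_i \in (U^C)%VS.
    rewrite -(span_basis basisY) memv_suml // => i _.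
    by rewrite memvZ // memv_span ?mem_nth ?size_tuple.
  have uX : \sum_k u 0 k *: X`_k \in U by rewrite memv_suml // => k _; rewrite memvZ.
  have xu0 : \sum_i x 0 i *: Y`_i = 0.
    apply/eqP; rewrite -memv0 -(capv_compl U) memv_cap xY andbT.
    by move/eqP: E; rewrite /g /= addr_eq0 => /eqP->; rewrite memvN.
  have u0 : \sum_k u 0 k *: X`_k = 0 by move: E; rewrite /g /= xu0 add0r.
  congr pair; apply/rowP=> i; rewrite mxE.
    by have /freeP/(_ (fun j => x 0 j)) := basis_free basisY; apply.
  by have /freeP/(_ (fun j => u 0 j)) := basis_free basisX; apply.
move=> [x u] [y v] /=; rewrite {1}/g /= big1 ?add0r => [|i _]; last first.
  by rewrite mxE scale0r.
have gX (w : 'rV[F]_n) : \sum_(k < n) w 0 k *: X`_k \in U.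
  by rewrite memv_suml // => k _; rewrite memvZ.
rewrite /g /= mulADl (Ux _ _ (gX u)) addr0 mulADr (xU _ _ (gX v)) addr0.
rewrite mulA_suml.
under [RHS]eq_bigr => i _.
  rewrite mulA_sumr; under eq_bigr => j _.
    rewrite mulAZl mulAZr mulY !scaler_sumr; over.
  rewrite exchange_big; over.
rewrite exchange_big /=; apply: eq_bigr => k _; rewrite mxE bformE scaler_suml.
apply: eq_bigr => i _; rewrite scaler_suml; apply: eq_bigr => j _.
by rewrite !scalerA; congr (_ *: _); ring.
Qed.
End ClassTwo.

(** * Algebras with a nonzero product of three elements *)

Lemma line_add_sub (F : fieldType) (W : vectType F) (U V : {vspace W}) p :
  p \in V -> p \notin U -> (U <= V)%VS -> (\dim V <= (\dim U).+1)%N ->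
  forall x, x \in V -> exists k, exists2 u, u \in U & x = k *: p + u.
Proof.
move=> pV pU UV dimV x xV.
have p0 : p != 0 by apply: contraNneq pU => ->; apply: mem0v.
suff : x \in (<[p]> + U)%VS.
  by case/memv_addP=> _ /vlineP[k ->] [u uU ->]; exists k, u.
have -> // : (<[p]> + U)%VS = V; apply/eqP.
rewrite eqEdim subv_add -memvE pV UV /= (leq_trans dimV) //.
rewrite dimv_disjoint_sum ?dim_vline ?p0 //; apply/eqP; rewrite -subv0.
apply/subvP=> y; rewrite memv_cap memv0 => /andP[/vlineP[k ->]].
by rewrite rpredZeq (negPf pU) orbF => /eqP->; rewrite scale0r.
Qed.

Lemma sum4 (V : nmodType) (f : 'I_4 -> V) : \sum_i f i = f pa + f pb + f pc + f pd.
Proof.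
rewrite !big_ord_recl big_ord0 addr0 !addrA.
by congr (_ + _ + _ + _); congr f; apply: val_inj.
Qed.

Ltac table_entries :=
  elim/ord4P; elim/ord4P; rewrite /= !(big_cons, big_nil) !xpair_eqE /=
    ?sum4 ?mxE /= ?(mulr0, mulr1, addr0, add0r, scale0r, scale1r).

Section Table.
Variables (F : finFieldType) (A : nuAlgebra F).
Local Notation "x ** y" := (nuMul A x y) (at level 40, left associativity).

Lemma iso_of_table (r : presentation4 F) (a b c d : A) :
  free [:: a; b; c; d] -> nuDim A = 4%N ->
  (forall i j, let e k := nth 0 [:: a; b; c; d] (k : 'I_4) in
     e i ** e j = \sum_(q <- r | q.1 == (i, j)) \sum_k q.2 0 k *: e k) ->
  nuIsomorphic A (pres r).
Proof.
move=> free_e dimA; set e := fun k : 'I_4 => _ => table.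
pose g (x : pres r) : A := \sum_i x 0 i *: e i.
have lin_g : linear g.
  move=> k x y; rewrite /g scaler_sumr -big_split; apply: eq_bigr => i _ /=.
  by rewrite !mxE scalerDl scalerA.
pose gL := GRing.isLinear.Build _ _ _ _ g lin_g.
pose g' : {linear pres r -> A} := HB.pack g gL.
apply: nuIso_sym; exists g'; split.
  apply: linear_inj_bij; last by rewrite [RHS]dimA dimvf.
  apply: raddf_inj => x E; apply/rowP=> i; rewrite mxE.
  have /freeP/(_ (fun j => x 0 j)) := (free_e : free (in_tuple [:: a; b; c; d])); apply.
  by rewrite -[RHS]E; apply: eq_bigr.
have rowE (x : pres r) : x = \sum_i x 0 i *: (delta_mx 0 i : pres r).
  exact: row_sum_delta.
move=> x y; rewrite {1}[x]rowE {1}[y]rowE.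
rewrite (mulA_suml (A := pres r)) linear_sum [RHS]mulA_suml; apply: eq_bigr => i _.
rewrite (mulA_sumr (A := pres r)) linear_sum [RHS]mulA_sumr; apply: eq_bigr => j _.
have -> : nuMul (pres r) (x 0 i *: delta_mx 0 i) (y 0 j *: delta_mx 0 j) =
    x 0 i *: (y 0 j *: nuMul (pres r) (delta_mx 0 i) (delta_mx 0 j)).
  exact: etrans (mulAZl _ _ _) (congr1 _ (mulAZr _ _ _)).
rewrite [RHS]mulAZl [in RHS]mulAZr [e i ** e j]table 2![in LHS]linearZ /=.
congr (_ *: (_ *: _)); rewrite -[g _]/(g' (presMul r _ _)) linear_sum.
rewrite [RHS]big_mkcond; apply: eq_bigr => -[[i' j'] v] _.
rewrite linearZ /= !mxE !eqxx /= xpair_eqE.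
by case: eqP => _; case: eqP => _; rewrite ?(mulr1, mulr0, scale1r, scale0r).
Qed.

Hypotheses (assocA : nuAssociative A) (nilA : nuNilpotent A) (dimA : nuDim A = 4%N).

Lemma pow_eq0 n x : pow A n = 0%VS -> x \in pow A n -> x = 0.
Proof. by move=> ->; rewrite memv0 => /eqP. Qed.

Definition pow_gen n p := p \in pow A n /\ (pow A n <= <[p]> + pow A n.+1)%VS.

Lemma pow_gen_mul n p a : pow_gen 0 a -> pow_gen n p -> pow_gen n.+1 (p ** a).
Proof.
move=> [_ /subvP gen_a] [pn /subvP gen_p]; split; first exact: mem_powS.
apply: powS_sub => x y /gen_p/memv_addP[_ /vlineP[k ->] [w wn ->]].
have /gen_a/memv_addP[_ /vlineP[l ->] [v v1 ->]] := mem_pow0 y.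
rewrite mulADl mulADr mulAZl mulAZr -addrA; apply: memv_add.
  by rewrite !memvZ ?memv_line.
apply: memvD; last exact: mem_powS.
by rewrite mulAZl memvZ // -[n.+2](congr1 succn (addn1 n)) pow_mul.
Qed.

Lemma pow_gen_dim n p : pow_gen n p -> (\dim (pow A n) <= (\dim (pow A n.+1)).+1)%N.
Proof.
case=> _ /dimvS/leq_trans; apply.
apply: leq_trans (dimv_add_leqif _ _) _.
by rewrite dim_vline -[leqRHS]add1n leq_add2r leq_b1.
Qed.

Lemma pow_gen_notin n p : pow_gen n p -> pow A n != 0%VS -> p \notin pow A n.+1.
Proof.
move=> [pn gen_p] /(pow_strict nilA); apply: contraTN => pn1.
rewrite -leqNgt dimvS // (subv_trans gen_p) // subv_add subvv andbT -memvE //.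
Qed.

(** A is spanned modulo A^2 by one element a, hence each power is spanned modulo
    the next one by a power of a, and a, a^2, a^3, a^4 is a basis. *)
Lemma uniserial : \dim (pow A 1) = 3%N -> nuIsomorphic A (pres A4_15).
Proof.
move=> dim1; have dim0 : \dim (pow A 0) = 4%N.
  by rewrite -dimA; congr (\dim _); apply/vspaceP=> x; rewrite mem_pow0 memvf.
have [a a1] : exists a, a \notin pow A 1.
  pose v := vpick (pow A 1)^C; exists v; apply/negP=> v1.
  have : v \in (pow A 1 :&: (pow A 1)^C)%VS by rewrite memv_cap v1 memv_pick.
  rewrite capv_compl memv0 vpick0 -dimv_eq0 dimv_compl.
  by rewrite -[\dim {:A}]/(nuDim A) dimA dim1.
have gen0 : pow_gen 0 a.
  split; first exact: mem_pow0; apply/subvP=> x x0.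
  have [|k [u u1 ->]] := line_add_sub (mem_pow0 a) a1 (pow_decr A 0) _ x0.
    by rewrite dim0 dim1.
  by rewrite memv_add ?memvZ ?memv_line.
have gen1 := pow_gen_mul gen0 gen0; have gen2 := pow_gen_mul gen0 gen1.
have gen3 := pow_gen_mul gen0 gen2.
have nz n k : \dim (pow A n) = k.+1 -> pow A n != 0%VS.
  by move=> E; rewrite -dimv_eq0 E.
have dropS n k p : pow_gen n p -> \dim (pow A n) = k.+1 -> \dim (pow A n.+1) = k.
  move=> gen_p E; apply/eqP; rewrite eqn_leq -ltnS -[X in (_ < X)%N]E.
  by rewrite (pow_strict nilA (nz _ _ E)) -ltnS -E (pow_gen_dim gen_p).
have dim2 := dropS _ _ _ gen1 dim1; have dim3 := dropS _ _ _ gen2 dim2.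
have pow4 : pow A 4 = 0%VS by apply/eqP; rewrite -dimv_eq0 (dropS _ _ _ gen3 dim3).
set b := a ** a in gen1; set c := b ** a in gen2; set d := c ** a in gen3.
have [[b1 _] [c2 _] [d3 _]] := And3 gen1 gen2 gen3.
have d2 := subvP (pow_decr A 2) _ d3.
have ab : a ** b = c by rewrite /c /b assocA.
have bb : b ** b = d by rewrite {2}/b assocA.
have ac : a ** c = d by rewrite /c assocA ab.
have z n m x y : (3 <= n + m)%N -> x \in pow A n -> y \in pow A m -> x ** y = 0.
  by move=> nm; apply: (pow_mul_eq0 assocA pow4).
have a0 := mem_pow0 a; apply: (iso_of_table (a := a) (b := b) (c := c) (d := d)) => //.
  rewrite !free_cons !span_cons span_nil !addv0 nil_free andbT; apply/and4P; split.
  - apply: contra a1; apply/subvP; rewrite !subv_add -!memvE b1.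
    by rewrite (subvP (pow_decr _ _) _ c2) (subvP (pow_decr _ _) _ d2).
  - apply: contra (pow_gen_notin gen1 (nz _ _ dim1)); apply/subvP.
    by rewrite !subv_add -!memvE c2 d2.
  - by apply: contra (pow_gen_notin gen2 (nz _ _ dim2)); apply/subvP; rewrite -memvE.
  by have := pow_gen_notin gen3 (nz _ _ dim3); rewrite pow4.
table_entries => {d2} //; by (eapply z; [| eassumption | eassumption]).
Qed.

(** The algebras with A^2 of dimension two and A^3 of dimension one, before the
    coefficients are scaled away. *)
Definition depth3 (eps zeta : F) : presentation4 F :=
  [:: (pa, pa, delta_mx 0 pb); (pa, pb, delta_mx 0 pd); (pb, pa, delta_mx 0 pd);
      (pa, pc, eps *: delta_mx 0 pd); (pc, pc, zeta *: delta_mx 0 pd)].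

(** Let x y z be nonzero.  Left multiplication by x does not annihilate any
    element of A^2 outside A^3, and x y is such an element.  If x x were in A^3,
    then (x x) y = x (x y) would be both zero and nonzero; so x x is outside A^3,
    and x (x x) is nonzero. *)
Lemma biserial_cube : \dim (pow A 1) = 2%N -> pow A 2 != 0%VS ->
  pow A 3 = 0%VS /\ exists a, a ** (a ** a) != 0.
Proof.
move=> dim1 pow2.
have nz1 : pow A 1 != 0%VS by rewrite -dimv_eq0 dim1.
have dim2 : \dim (pow A 2) = 1%N.
  have := pow_strict nilA nz1; rewrite dim1 ltnS leq_eqVlt ltnS leqn0 dimv_eq0.
  by rewrite (negPf pow2) orbF => /eqP.
have pow3 : pow A 3 = 0%VS.
  by apply/eqP; rewrite -dimv_eq0 -leqn0 -ltnS -[X in (_ < X)%N]dim2 pow_strict.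
split=> //.
have [x [y [z xyz]]] : exists x y z, (x ** y) ** z != 0.
  have /hasP[_ /allpairsP[[u z] /= [/allpairsP[[x y] [_ _ ->]] _ ->]] nz] :
      has (fun w => w != 0) (powGens A 2).
    apply: contraNT pow2 => /hasPn all0; rewrite -subv0; apply/span_subvP => w /all0.
    by rewrite negbK => /eqP->; apply: mem0v.
  by exists x, y, z.
have z3 n m u v :
    (3 <= (n + m).+1)%N -> u \in pow A n -> v \in pow A m -> u ** v = 0.
  exact: (pow_mul_eq0 assocA pow3).
have yz : y ** z \notin pow A 2.
  apply: contra xyz => yz2; rewrite -assocA.
  by rewrite (z3 0%N 2%N) ?mem_pow0.
have yz1 : y ** z \in pow A 1 by apply/mem_powS/mem_pow0.
have xP w : w \in pow A 1 -> w \notin pow A 2 -> x ** w != 0.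
  move=> w1 w2; have [|k [v v2 wE]] := line_add_sub yz1 yz (pow_decr A 1) _ w1.
    by rewrite dim1 dim2.
  have k0 : k != 0 by apply: contraNneq w2 => k0; rewrite wE k0 scale0r add0r.
  rewrite wE mulADr mulAZr (z3 0%N 2%N x v) ?mem_pow0 // addr0 assocA.
  by rewrite scaler_eq0 negb_or k0.
have xy1 : x ** y \in pow A 1 by apply/mem_powS/mem_pow0.
have xy2 : x ** y \notin pow A 2.
  by apply: contra xyz => xy2; rewrite (z3 2%N 0%N) ?mem_pow0.
exists x; apply: (xP (x ** x)); first exact/mem_powS/mem_pow0.
apply: contra (xP _ xy1 xy2) => xx2.
by rewrite assocA (z3 2%N 0%N) ?mem_pow0.
Qed.

(** Besides a, a^2, a^3 there is a fourth basis vector c.  Adding multiples of a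
    and a^2 to it gives c a^2 = 0 and then c a = 0; associativity now forces all
    other products with c into A^3. *)
Lemma biserial_basis : \dim (pow A 1) = 2%N -> pow A 2 != 0%VS ->
  exists a b c d eps zeta, free [:: a; b; c; d] /\
    [/\ [/\ a ** a = b, a ** b = d, a ** c = eps *: d & a ** d = 0],
        [/\ b ** a = d, b ** b = 0, b ** c = 0 & b ** d = 0],
        [/\ c ** a = 0, c ** b = 0, c ** c = zeta *: d & c ** d = 0] &
        [/\ d ** a = 0, d ** b = 0, d ** c = 0 & d ** d = 0]].
Proof.
move=> dim1 pow2; have [pow3 [a aaa]] := biserial_cube dim1 pow2.
set b := a ** a in aaa; set d := a ** b in aaa.
have z3 n m u v :
    (3 <= (n + m).+1)%N -> u \in pow A n -> v \in pow A m -> u ** v = 0.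
  exact: (pow_mul_eq0 assocA pow3).
have in0 := mem_pow0 (A := A).
have b1 : b \in pow A 1 by apply: mem_powS.
have d2 : d \in pow A 2 by rewrite /d /b assocA; apply: mem_powS.
have d1 := subvP (pow_decr A 1) _ d2.
have dim2 : \dim (pow A 2) = 1%N.
  have nz1 : pow A 1 != 0%VS by rewrite -dimv_eq0 dim1.
  have := pow_strict nilA nz1; rewrite dim1 ltnS leq_eqVlt ltnS leqn0 dimv_eq0.
  by rewrite (negPf pow2) orbF => /eqP.
have b2 : b \notin pow A 2.
  by apply: contra aaa => b2; rewrite /d (z3 0%N 2%N).
have a1 : a \notin pow A 1.
  by apply: contra b2 => a1; apply: mem_powS.
have pow2E x : x \in pow A 2 -> exists k, x = k *: d.
  move=> x2; have dP : d \notin pow A 3 by rewrite pow3 memv0.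
  have [|k [u u3 ->]] := line_add_sub d2 dP (pow_decr A 2) _ x2.
    by rewrite dim2 pow3 dimv0.
  by exists k; rewrite (pow_eq0 pow3 u3) addr0.
have pow1E x : x \in pow A 1 -> exists s t, x = s *: b + t *: d.
  move=> x1; have [|s [u /pow2E[t ->] ->]] := line_add_sub b1 b2 (pow_decr A 1) _ x1.
    by rewrite dim1 dim2.
  by exists s, t.
have d0 y : d ** y = 0 by apply: (z3 2%N 0%N).
have x0d y : y ** d = 0 by apply: (z3 0%N 2%N).
have ba : b ** a = d by rewrite /d /b assocA.
have bb : b ** b = 0 by apply: (z3 1%N 1%N).
(* Membership in A^3 of an element of A^2 is tested by multiplication with a. *)
have testr x : x \in pow A 1 -> x ** a = 0 -> exists k, x = k *: d.
  case/pow1E=> s [t ->]; rewrite mulADl !mulAZl d0 ba scaler0 addr0 => /eqP.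
  by rewrite scaler_eq0 (negPf aaa) orbF => /eqP->; exists t; rewrite scale0r add0r.
have [c0 c0P] : exists c0, c0 \notin (<[a]> + pow A 1)%VS.
  pose V := (<[a]> + pow A 1)%VS; exists (vpick V^C); apply/negP=> v1.
  have : vpick V^C \in (V :&: V^C)%VS by rewrite memv_cap v1 memv_pick.
  rewrite capv_compl memv0 vpick0 -dimv_eq0 dimv_compl -[\dim {:A}]/(nuDim A) dimA.
  rewrite subn_eq0 => /leq_trans/(_ (dimv_add_leqif _ _)).
  by rewrite dim1 dim_vline; case: (a != 0).
have [l c0b] : exists l, c0 ** b = l *: d.
  by apply: pow2E; rewrite /b assocA; apply: mem_powS; apply: mem_powS.
have [t c1a] : exists t, (c0 - l *: a) ** a = t *: d.
  apply: testr; first exact: mem_powS.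
  by rewrite -assocA mulADl -scaleNr mulAZl -/b c0b scaleNr subrr.
pose c := c0 - l *: a - t *: b.
have ca : c ** a = 0 by rewrite mulADl c1a -scaleNr mulAZl ba scaleNr subrr.
have cb : c ** b = 0 by rewrite /b assocA ca mulA0l.
have [eps ac] : exists k, a ** c = k *: d.
  by apply: testr; [exact: mem_powS | rewrite -assocA ca mulA0r].
have [zeta cc] : exists k, c ** c = k *: d.
  by apply: testr; [exact: mem_powS | rewrite -assocA ca mulA0r].
have bc : b ** c = 0 by rewrite /b -assocA ac mulAZr x0d scaler0.
exists a, b, c, d, eps, zeta; split; last by split.
have permE : perm_eq [:: a; b; c; d] [:: c; a; b; d] by apply/permP=> p /=; ring.
rewrite (perm_free permE) !free_cons !span_cons span_nil !addv0 nil_free andbT.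
apply/and4P; split.
- apply: contra c0P => cP.
  have -> : c0 = c + (l *: a + t *: b) by rewrite /c -[_ - _ - _]addrA -opprD subrK.
  have /subvP sub : (<[a]> + (<[b]> + <[d]>) <= <[a]> + pow A 1)%VS.
    by rewrite addvS // subv_add -!memvE b1 d1.
  apply: memvD; first exact: sub.
  by apply: memv_add; rewrite memvZ ?memv_line.
- by apply: contra a1; apply/subvP; rewrite subv_add -!memvE b1 d1.
- by apply: contra b2; apply/subvP; rewrite -memvE.
by rewrite memv0.
Qed.

Lemma biserial_iso : \dim (pow A 1) = 2%N -> pow A 2 != 0%VS ->
  nuIsomorphic A (pres A4_6) \/
  exists2 p, p != (0, 0) & nuIsomorphic A (pres (depth3 p.1 p.2)).
Proof.
move=> dim1 /(biserial_basis dim1)[a [b [c [d [eps [zeta [free_e tab]]]]]]].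
case: tab => [[aa ab ac ad] [ba bb bc bd] [ca cb cc cd] [da db dc dd]].
have [[eps0 zeta0]|p0] := eqVneq (eps, zeta) (0, 0); [left|right].
  rewrite eps0 scale0r in ac; rewrite zeta0 scale0r in cc.
  apply: (iso_of_table (a := a) (b := b) (c := d) (d := c)) => //; last by table_entries.
  rewrite (perm_free (_ : perm_eq _ [:: a; b; c; d])) //.
  by apply/permP=> p /=; ring.
exists (eps, zeta) => //.
apply: (iso_of_table (a := a) (b := b) (c := c) (d := d)) => //; by table_entries.
Qed.
End Table.

Section Depth3.
Variables (F : finFieldType) (char2 : 2%N \in [pchar F]) (eta : F -> F).

Lemma iso_diagonal (r r' : presentation4 F) (l : 'I_4 -> F) : (forall j, l j != 0) ->
  (forall x0 x1 x2 x3 y0 y1 y2 y3 j,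
     presMul r' (row4 (l pa * x0) (l pb * x1) (l pc * x2) (l pd * x3))
       (row4 (l pa * y0) (l pb * y1) (l pc * y2) (l pd * y3)) 0 j =
     l j * presMul r (row4 x0 x1 x2 x3) (row4 y0 y1 y2 y3) 0 j) ->
  nuIsomorphic (pres r) (pres r').
Proof.
move=> l0 E; pose f (x : pres r) : pres r' := \row_j (l j * x 0 j).
have lin_f : linear f.
  by move=> k x y; apply/rowP=> j; rewrite !mxE mulrDr mulrCA.
pose fL := GRing.isLinear.Build _ _ _ _ f lin_f.
pose f' : {linear pres r -> pres r'} := HB.pack f fL.
exists f'; split.
  apply: linear_inj_bij => // x y /rowP fxy; apply/rowP=> j.
  by apply: (mulfI (l0 j)); have := fxy j; rewrite !mxE.
have f_row4 x0 x1 x2 x3 :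
    f (row4 x0 x1 x2 x3) = row4 (l pa * x0) (l pb * x1) (l pc * x2) (l pd * x3).
  by apply/rowP; elim/ord4P; rewrite !mxE.
elim/row4P=> x0 x1 x2 x3; elim/row4P=> y0 y1 y2 y3.
by rewrite /= !f_row4; apply/rowP=> j; rewrite E [LHS]mxE.
Qed.

(** Multiplying the coordinates along a and c by l0 and l2 replaces eps and zeta by
    eps l0^2 / l2 and zeta l0^3 / l2^2.  Both can be made 0 or 1; if eps = 0, then
    this uses that zeta is a square. *)
Lemma depth3_NF p : p != (0, 0) -> exists2 k, k \in [:: 10; 11; 12]%N &
  nuIsomorphic (pres (depth3 p.1 p.2)) (pres (presOf eta k 0)).
Proof.
have diag k l0 l2 eps zeta : l0 != 0 -> l2 != 0 -> 
    (forall x0 x1 x2 x3 y0 y1 y2 y3 j, 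
      let l := fun j : 'I_4 => nth 0 [:: l0; l0 ^+ 2; l2; l0 ^+ 3] j in
     presMul (presOf eta k 0) (row4 (l pa * x0) (l pb * x1) (l pc * x2) (l pd * x3))
       (row4 (l pa * y0) (l pb * y1) (l pc * y2) (l pd * y3)) 0 j =
     l j * presMul (depth3 eps zeta) (row4 x0 x1 x2 x3) (row4 y0 y1 y2 y3) 0 j) ->
    nuIsomorphic (pres (depth3 eps zeta)) (pres (presOf eta k 0)).
  move=> l00 l20 E; apply: iso_diagonal E.
  by elim/ord4P => //=; rewrite expf_neq0.
case: p => eps zeta /=; have [->|eps0] := eqVneq eps 0.
  have [->|zeta0] := eqVneq zeta 0; first by rewrite eqxx.
  move=> _; exists 11%N => //; have [x x0 xz] := sqrt2_neq0 char2 zeta0.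
  apply: (diag _ 1 x); rewrite ?oner_neq0 // => x0' x1 x2 x3 y0 y1 y2 y3 j.
  elim/ord4P: j; rewrite /depth3 /pa /pb /pc /pd; pres_coords;
    char2_ring char2 (tt, esym xz).
move=> _; have [->|zeta0] := eqVneq zeta 0.
  exists 12%N => //; apply: (diag _ 1 eps); rewrite ?oner_neq0 //.
  move=> x0 x1 x2 x3 y0 y1 y2 y3 j.
  elim/ord4P: j; rewrite /depth3 /pa /pb /pc /pd; pres_coords; char2_ring char2 tt.
exists 10%N => //; apply: (diag _ (zeta / eps ^+ 2) (zeta ^+ 2 / eps ^+ 3));
  rewrite ?mulf_neq0 ?invr_eq0 ?expf_neq0 //.
have -> : zeta / eps ^+ 2 = zeta * eps^-1 ^+ 2 by rewrite exprVn.
have -> : zeta ^+ 2 / eps ^+ 3 = zeta ^+ 2 * eps^-1 ^+ 3 by rewrite exprVn.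
move=> x0 x1 x2 x3 y0 y1 y2 y3 j.
elim/ord4P: j; rewrite /depth3 /pa /pb /pc /pd; pres_coords;
  char2_ring char2 (tt, mulfV eps0).
Qed.
End Depth3.

(** * Invariants of algebras *)

Section Transport.
Variable F : fieldType.
Implicit Types A B : nuAlgebra F.

Lemma nuIso_assoc A B : nuIsomorphic A B -> nuAssociative A -> nuAssociative B.
Proof.
case/nuIsoP=> f [g [fK gK fM gM]] assocA x y z.
by apply: (can_inj gK); rewrite !gM assocA.
Qed.

Definition nuCommutative A := forall x y, nuMul A x y = nuMul A y x.

Definition null_product A n := forall x (s : n.-tuple A), foldl (nuMul A) x s = 0.

Definition special_square A := exists x,
  (forall y z, nuMul A x (nuMul A y z) = 0) /\ nuMul A x x <> 0.

Lemma nuIso_commutative A B : nuIsomorphic A B -> nuCommutative A -> nuCommutative B.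
Proof.
case/nuIsoP=> f [g [fK gK fM gM]] commA x y.
by apply: (can_inj gK); rewrite !gM commA.
Qed.

Lemma nuIso_null_product A B n :
  nuIsomorphic A B -> null_product A n -> null_product B n.
Proof.
case/nuIsoP=> f [g [fK gK fM gM]] nil x s.
apply: (can_inj gK); rewrite raddf0 -(nil (g x) (map_tuple g s)) /=.
by elim: (tval s) x => //= y s' IHs x; rewrite IHs gM.
Qed.

Lemma nuIso_nilpotent A B : nuIsomorphic A B -> nuNilpotent A -> nuNilpotent B.
Proof. by move=> iso [n nil]; exists n; apply: nuIso_null_product iso nil. Qed.

Lemma nuIso_special A B : nuIsomorphic A B -> special_square A -> special_square B.
Proof.
case/nuIsoP=> f [g [fK gK fM gM]] [x [xA2 xx]]; exists (f x); split=> [y z|xx0].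
  by apply: (can_inj gK); rewrite !gM fK xA2 raddf0.
by apply: xx; apply: (can_inj fK); rewrite fM xx0 raddf0.
Qed.

Lemma formAlg_null_product m n (B : 'I_n -> 'M[F]_m) : null_product (formAlg B) 2.
Proof.
move=> x [s /= /eqP]; case: s => [|y [|z []]] //= _.
by congr pair; apply/rowP=> k; rewrite !mxE /bform !mul0mx mxE.
Qed.

Lemma formAlg_assoc m n (B : 'I_n -> 'M[F]_m) : nuAssociative (formAlg B).
Proof.
move=> x y z; congr pair; apply/rowP=> k; rewrite !mxE /bform /=.
by rewrite trmx0 mulmx0 !mul0mx.
Qed.

End Transport.

Section DeepAlgebras.
Variables (F : finFieldType) (char2 : 2%N \in [pchar F]) (eta : F -> F).

Definition mulNF (k : nat) (x0 x1 x2 x3 y0 y1 y2 y3 : F) : 'rV[F]_4 :=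
  match k with
  | 5%N => row4 0 (x0 * y0) (x0 * y1 + x1 * y0) 0
  | 10%N => row4 0 (x0 * y0) 0 (x0 * y1 + x1 * y0 + x0 * y2 + x2 * y2)
  | 11%N => row4 0 (x0 * y0) 0 (x0 * y1 + x1 * y0 + x2 * y2)
  | 12%N => row4 0 (x0 * y0) 0 (x0 * y1 + x1 * y0 + x0 * y2)
  | 13%N => row4 0 (x0 * y0) (x0 * y1 + x1 * y0) (x1 * y1 + x0 * y2 + x2 * y0)
  | _ => 0
  end.

(** The families with a nonzero product of three elements. *)
Definition deep_labels : seq nat := [:: 5; 10; 11; 12; 13]%N.

Lemma nuMulE k x0 x1 x2 x3 y0 y1 y2 y3 : k \in 0%N :: deep_labels ->
  nuMul (pres (presOf eta k 0)) (row4 x0 x1 x2 x3) (row4 y0 y1 y2 y3) =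
  mulNF k x0 x1 x2 x3 y0 y1 y2 y3.
Proof.
rewrite !inE; (do !case/orP) => /eqP->; apply/rowP; elim/ord4P; pres_coords;
  by char2_ring char2 tt.
Qed.

Lemma row4_inj (a b c d a' b' c' d' : F) : row4 a b c d = row4 a' b' c' d' ->
  [/\ a = a', b = b', c = c' & d = d'].
Proof.
move/rowP=> E; split; [have := E pa|have := E pb|have := E pc|have := E pd];
  by rewrite !mxE.
Qed.

Lemma row4_0 : row4 0 0 0 0 = 0 :> 'rV[F]_4.
Proof. by apply/rowP; elim/ord4P; rewrite !mxE. Qed.

Lemma deep_assoc k : k \in 0%N :: deep_labels -> nuAssociative (pres (presOf eta k 0)).
Proof.
move=> kin; elim/row4P=> x0 x1 x2 x3; elim/row4P=> y0 y1 y2 y3.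
elim/row4P=> z0 z1 z2 z3.
move: kin; rewrite !inE; (do !case/orP) => /eqP->;
  do 4 rewrite ?nuMulE // /mulNF -?row4_0; by congr row4; ring.
Qed.

Lemma null_product13 : null_product (pres (presOf eta 13 0)) 4.
Proof.
move=> x [s /= /eqP]; case: s => [|y [|z [|t [|u []]]]] //= _; move: x y z t u.
elim/row4P=> x0 x1 x2 x3; elim/row4P=> y0 y1 y2 y3; elim/row4P=> z0 z1 z2 z3.
elim/row4P=> t0 t1 t2 t3; elim/row4P=> v0 v1 v2 v3.
by rewrite -row4_0; do 5 rewrite ?(@nuMulE 13) // /mulNF; congr row4; ring.
Qed.

Lemma null_product3 k : k \in [:: 0; 5; 10; 11; 12]%N ->
  null_product (pres (presOf eta k 0)) 3.
Proof.
move=> kin x [s /= /eqP]; case: s => [|y [|z [|t []]]] //= _; move: x y z t kin.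
elim/row4P=> x0 x1 x2 x3; elim/row4P=> y0 y1 y2 y3; elim/row4P=> z0 z1 z2 z3.
elim/row4P=> t0 t1 t2 t3; rewrite !inE; (do !case/orP) => /eqP->;
  by rewrite -row4_0; do 4 rewrite ?nuMulE // /mulNF -?row4_0; congr row4; ring.
Qed.

Lemma not_null_product3 : ~ null_product (pres (presOf eta 13 0)) 3.
Proof.
pose e : pres (presOf eta 13 0) := row4 1 0 0 0.
move/(_ e [tuple e; e; e]); rewrite /= /e; do 3 rewrite ?(@nuMulE 13) // /mulNF.
rewrite -row4_0 => /row4_inj[_ _ _ /eqP].
by rewrite !(mulr0, mul0r, mulr1, addr0, add0r) oner_eq0.
Qed.

Lemma not_null_product2 k : k \in deep_labels -> ~ null_product (pres (presOf eta k 0)) 2.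
Proof.
pose e : pres (presOf eta k 0) := row4 1 0 0 0.
move=> kin /(_ e [tuple e; e]); rewrite /= /e; move: kin {e}.
by rewrite !inE; (do !case/orP) => /eqP->; do 2 rewrite ?nuMulE // /mulNF;
  rewrite -row4_0 => /row4_inj[_ _ /eqP + /eqP];
  rewrite !(mulr0, mul0r, mulr1, addr0, add0r) oner_eq0.
Qed.

Lemma deep_commutative k : k \in [:: 5; 11]%N -> nuCommutative (pres (presOf eta k 0)).
Proof.
move=> + x y; elim/row4P: x => x0 x1 x2 x3; elim/row4P: y => y0 y1 y2 y3.
by rewrite !inE; (do !case/orP) => /eqP->; rewrite !nuMulE // /mulNF; congr row4; ring.
Qed.

Lemma deep_noncommutative k : k \in [:: 10; 12]%N -> ~ nuCommutative (pres (presOf eta k 0)).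
Proof.
move=> kin /(_ (row4 1 0 0 0) (row4 0 0 1 0)); move: kin.
by rewrite !inE; (do !case/orP) => /eqP->; rewrite !nuMulE // /mulNF => /row4_inj[_ _ _ /eqP];
  rewrite !(mulr0, mul0r, mulr1, addr0, add0r) oner_eq0.
Qed.

Lemma deep_special k : k \in [:: 10; 11]%N -> special_square (pres (presOf eta k 0)).
Proof.
move=> kin; exists (row4 0 0 1 0); split=> [y z|].
  move: kin; elim/row4P: y => x0 x1 x2 x3; elim/row4P: z => y0 y1 y2 y3.
  by rewrite !inE; (do !case/orP) => /eqP->; rewrite -row4_0;
    do 2 rewrite ?nuMulE // /mulNF; congr row4; ring.
by move: kin; rewrite !inE; (do !case/orP) => /eqP->; rewrite !nuMulE // /mulNF -row4_0 =>
  /row4_inj[_ _ _ /eqP]; rewrite !(mulr0, mul0r, mulr1, addr0, add0r) oner_eq0.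
Qed.

Lemma deep_not_special k : k \in [:: 5; 12]%N -> ~ special_square (pres (presOf eta k 0)).
Proof.
move=> + [x [xA2 xx]]; elim/row4P: x xA2 xx => x0 x1 x2 x3.
pose e := row4 1 0 0 0 : 'rV[F]_4.
move=> /(_ e e) + + kin; rewrite /e; move: kin; rewrite !inE; (do !case/orP) => /eqP->;
  do 2 rewrite ?nuMulE // /mulNF; rewrite -row4_0 => /row4_inj[_ _ E2 E3];
  move: E2 E3; rewrite !(mulr0, mul0r, mulr1, addr0, add0r) => E2 E3; case;
  rewrite ?E2 ?E3; congr row4; ring.
Qed.

(** Among these families, one has a nonzero product of four elements; commutativity
    and the existence of a special square tell the other four apart. *)
Lemma deep_label k k' : k \in deep_labels -> k' \in deep_labels ->
  nuIsomorphic (pres (presOf eta k 0)) (pres (presOf eta k' 0)) -> k = k'.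
Proof.
move=> kin kin' iso; have osi := nuIso_sym iso.
have [k13|k13] := eqVneq k 13%N; have [k13'|k13'] := eqVneq k' 13%N.
- by rewrite k13 k13'.
- case: not_null_product3; rewrite -k13; apply: nuIso_null_product osi _.
  by apply: null_product3; move: kin' k13'; rewrite !inE; (do !case/orP) => /eqP->.
- case: not_null_product3; rewrite -k13'; apply: nuIso_null_product iso _.
  by apply: null_product3; move: kin k13; rewrite !inE; (do !case/orP) => /eqP->.
have comm l l' : nuIsomorphic (pres (presOf eta l 0)) (pres (presOf eta l' 0)) ->
    l \in [:: 5; 11]%N -> l' \in [:: 10; 12]%N -> False.
  move=> iso' lin l'in; apply: (deep_noncommutative l'in).
  by apply: nuIso_commutative iso' _; apply: deep_commutative.
have special l l' : nuIsomorphic (pres (presOf eta l 0)) (pres (presOf eta l' 0)) ->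
    l \in [:: 10; 11]%N -> l' \in [:: 5; 12]%N -> False.
  move=> iso' lin l'in; apply: (deep_not_special l'in).
  by apply: nuIso_special iso' _; apply: deep_special.
move: kin kin' k13 k13' (comm _ _ iso) (comm _ _ osi) (special _ _ iso) (special _ _ osi).
by rewrite !inE; (do !case/orP) => /eqP->; (do !case/orP) => /eqP-> //= _ _ h1 h2 h3 h4;
  first [case: (h1 isT isT) | case: (h2 isT isT) | case: (h3 isT isT) | case: (h4 isT isT)].
Qed.
End DeepAlgebras.

(** * The classification *)

Section Assembly.
Variables (F : finFieldType) (char2 : 2%N \in [pchar F]).
Variables (gamma0 : F) (hgamma0 : gamma0 \notin [set t ^+ 2 + t | t : F]).
Variables (eta : F -> F) (heta : forall sigma : F,
  sigma != 0 -> sigma != 1 -> eta sigma \notin Hset sigma).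

Definition params (k : nat) : seq F :=
  if k \in iota 14 10 then pencil_params gamma0 k
  else if k == 8%N then [:: 0; gamma0]
  else if (k == 3%N) || (k == 7%N) then enum F else [:: 0].

Local Notation isPres A k x := (nuIsomorphic A (pres (presOf eta k x))).

Lemma labelsP (k : nat) : k \in iota 0 24 ->
  [|| k == 0%N, k \in ternary_labels, k \in deep_labels | k \in iota 14 10].
Proof. by rewrite !inE; (do !case/orP) => /eqP->. Qed.

Lemma formEquiv_ext m n (B B' : 'I_n -> 'M[F]_m) : B =1 B' -> formEquiv B B'.
Proof.
move=> E; have [P [T [uP uT EB]]] := formEquiv_refl B.
by exists P, T; split=> // k; rewrite -E EB.
Qed.

Lemma deep_presOf k x : k \in 0%N :: deep_labels -> presOf eta k x = presOf eta k 0.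
Proof. by rewrite !inE; (do !case/orP) => /eqP->. Qed.

Lemma deep_params k x : k \in 0%N :: deep_labels -> x \in params k -> x = 0.
Proof. by rewrite !inE; (do !case/orP) => /eqP->; rewrite inE => /eqP. Qed.

(** ** The algebras of the list *)

Lemma presOf_nilpotent k x : k \in iota 0 24 ->
  [/\ nuAssociative (pres (presOf eta k x)), nuNilpotent (pres (presOf eta k x)) &
      nuDim (pres (presOf eta k x)) = 4%N].
Proof.
move=> /labelsP kin.
suff [assoc nil] : nuAssociative (pres (presOf eta k x)) /\
    nuNilpotent (pres (presOf eta k x)).
  by split=> //; rewrite /nuDim dimvf.
have ofForm m n (B : 'I_n -> 'M[F]_m) : isPres (formAlg B) k x ->
    nuAssociative (pres (presOf eta k x)) /\ nuNilpotent (pres (presOf eta k x)).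
  move=> iso; split; first by apply: nuIso_assoc iso _; apply: formAlg_assoc.
  apply: nuIso_nilpotent iso _; exists 2%N; exact: formAlg_null_product.
have deep : k \in 0%N :: deep_labels ->
    nuAssociative (pres (presOf eta k x)) /\ nuNilpotent (pres (presOf eta k x)).
  move=> kd; rewrite deep_presOf //; split; first exact: deep_assoc.
  have [->|k13] := eqVneq k 13%N; first by exists 4%N; exact: null_product13.
  exists 3%N; apply: null_product3 => //.
  by move: kd k13; rewrite !inE; (do !case/orP) => /eqP->.
case/or4P: kin => kin.
- by apply: deep; rewrite (eqP kin).
- by apply: ofForm (nuIso_sym (presOf_ternary char2 eta x kin)).
- by apply: deep; rewrite inE kin orbT.
by apply: ofForm (nuIso_sym (presOf_pencil char2 eta x kin)).
Qed.

(** ** Every algebra occurs *)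

Lemma ternary_classification (M : 'M[F]_3) : M != 0 -> exists k x,
  [/\ k \in ternary_labels, x \in params k & similarForms M (ternary k x)].
Proof.
have [sym M0|nsym _] := eqVneq M^T M; last first.
  have [N [[delta ->]|[beta ->]|[alpha ain ->]|->] sim] :=
    nonsymmetric_NF char2 hgamma0 nsym.
  - by exists 3%N, delta; split; rewrite ?mem_enum.
  - by exists 7%N, beta; split; rewrite ?mem_enum.
  - by exists 8%N, alpha.
  by exists 9%N, 0; split; rewrite ?inE.
have entry i j : M i j = M j i by rewrite -{1}sym mxE.
move: M0; rewrite [M]mx3_eta (entry o1 o0) (entry o2 o0) (entry o2 o1) => M0.
have [N [->|->|->|->] sim] := symmetric_NF char2 M0.
- by exists 1%N, 0; split; rewrite ?inE.
- by exists 2%N, 0; split; rewrite ?inE.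
- by exists 4%N, 0; split; rewrite ?inE.
by exists 6%N, 0; split; rewrite ?inE.
Qed.

(** As the powers of A decrease strictly, A^2 has dimension at most three, and
    A^3 = 0 when that dimension is at most one.  In dimension two A^3 may vanish
    or not, and dimension three forces A to be generated by one element. *)
Lemma presOf_exhaustive (A : nuAlgebra F) :
  nuAssociative A -> nuNilpotent A -> nuDim A = 4%N ->
  exists k x, [/\ k \in iota 0 24, x \in params k & isPres A k x].
Proof.
move=> assocA nilA dimA.
have dim0 : \dim (pow A 0) = 4%N.
  by rewrite -dimA; congr (\dim _); apply/vspaceP=> x; rewrite mem_pow0 memvf.
have : (\dim (pow A 1) < 4)%N by rewrite -dim0 pow_strict // -dimv_eq0 dim0.
have [dim1 _|nz1] := eqVneq (\dim (pow A 1)) 0%N.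
  have pow2 : pow A 2 = 0%VS.
    apply/eqP; rewrite -subv0; move/eqP: dim1; rewrite dimv_eq0 => /eqP<-.
    exact: pow_decr.
  have [B [_ iso]] := class2_formAlg (m := 4) assocA pow2 dim1 dimA.
  exists 0%N, 0; split; rewrite ?inE //=; apply: nuIso_trans iso (nuIso_sym _).
  apply: (pres_formAlg (sigma := id) (tau := fun i : 'I_0 => pa)) => // [j|x y i|x y []//].
    by left; exists j.
  by rewrite /presMul big_nil mxE.
have [dim1 _|nz1'] := eqVneq (\dim (pow A 1)) 1%N.
  have pow2 : pow A 2 = 0%VS.
    apply/eqP; rewrite -dimv_eq0 -leqn0 -ltnS -[X in (_ < X)%N]dim1 pow_strict //.
    by rewrite -dimv_eq0 dim1.
  have [B [freeB iso]] := class2_formAlg (m := 3) assocA pow2 dim1 dimA.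
  have B0 : B 0 != 0.
    apply/eqP=> B0; have /rowP/(_ 0) : const_mx 1 = 0 :> 'rV[F]_1.
      by apply: freeB; rewrite big_ord1 B0 scaler0.
    by rewrite !mxE => /eqP; rewrite oner_eq0.
  have [k [x [kin xin /similar_formEquiv sim]]] := ternary_classification B0.
  exists k, x; split=> //; first by move: kin; rewrite !inE; (do !case/orP) => /eqP->.
  apply: nuIso_trans iso (nuIso_trans _ (nuIso_sym (presOf_ternary char2 eta x kin))).
  apply: formEquiv_iso; apply: formEquiv_trans sim.
  by apply: formEquiv_ext => i; rewrite ord1.
have [dim1 _|nz1''] := eqVneq (\dim (pow A 1)) 2%N.
  have [pow2|pow2] := eqVneq (pow A 2) 0%VS; last first.
    have [iso|[p p0 iso]] := biserial_iso assocA nilA dimA dim1 pow2.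
      by exists 5%N, 0; split; rewrite ?inE.
    have [k kin iso'] := depth3_NF char2 eta p0.
    exists k, 0; split; last exact: nuIso_trans iso iso'.
      by move: kin; rewrite !inE; (do !case/orP) => /eqP->.
    by move: kin; rewrite !inE; (do !case/orP) => /eqP->; rewrite inE.
  have [B [freeB iso]] := class2_formAlg (m := 2) assocA pow2 dim1 dimA.
  have extB : formEquiv B (pencil (B u0) (B u1)).
    by apply: formEquiv_ext; elim/ord2P.
  have [k [x [kin xin E]]] :=
    pencil_classification char2 hgamma0 heta (formFree_equiv extB freeB).
  exists k, x; split.
  - by move: kin; rewrite !inE; (do !case/orP) => /eqP->.
  - by rewrite /params kin.
  apply: nuIso_trans iso (nuIso_trans _ (nuIso_sym (presOf_pencil char2 eta x kin))).
  exact/formEquiv_iso/(formEquiv_trans extB E).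
move=> lt4; have dim1 : \dim (pow A 1) = 3%N.
  by move: lt4 nz1 nz1' nz1''; case: (\dim _) => [|[|[|[|]]]].
by exists 13%N, 0; split; rewrite ?inE //=; apply: uniserial.
Qed.

(** ** No algebra occurs twice *)

Lemma ternary_free k (x : F) : k \in ternary_labels ->
  formFree (fun _ : 'I_1 => ternary k x).
Proof.
move=> kin t; rewrite big_ord1 => /eqP; rewrite scaler_eq0 => /orP[/eqP t0|].
  by apply/rowP=> i; rewrite ord1 t0 mxE.
suff /negPf-> : ternary k x != 0 by [].
have -> : 0 = mx3 0 0 0 0 0 0 0 0 0 :> 'M[F]_3.
  by apply/matrixP; elim/ord3P; elim/ord3P; rewrite !mxE.
by move: kin; rewrite !inE; (do !case/orP) => /eqP->; rewrite mx3_eqE oner_eq0 ?andbF.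
Qed.

Lemma pencilNF_free k (x : F) : k \in iota 14 10 ->
  formFree (pencil (pencilC eta k x) (pencilD eta k x)).
Proof.
move=> kin; apply/formFree_pencil => t u.
have -> : 0 = mx2 0 0 0 0 :> 'M[F]_2.
  by apply/matrixP; elim/ord2P; elim/ord2P; rewrite !mxE.
by move: kin; rewrite !inE; (do !case/orP) => /eqP->; move/eqP;
  rewrite /= !scalemx2 addmx2 mx2_eqE => /and4P[/eqP E1 /eqP E2 /eqP E3 _];
  (have t0 : t = 0 by rewrite -[RHS]E1; ring);
  split=> //; first [rewrite -[RHS]E2 t0; ring | rewrite -[RHS]E3 t0; ring].
Qed.

(** This separates the algebras of one form from those of a pencil. *)
Definition rank1_products (A : nuAlgebra F) := exists d : A, forall x y : A,
  exists k, nuMul A x y = k *: d.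

Lemma nuIso_rank1 (A B : nuAlgebra F) :
  nuIsomorphic A B -> rank1_products A -> rank1_products B.
Proof.
case/nuIsoP=> f [g [fK gK fM gM]] [d dP]; exists (f d) => x y.
have [k E] := dP (g x) (g y); exists k.
by apply: (can_inj gK); rewrite gM E linearZ /= fK.
Qed.

Lemma ternary_rank1 (M : 'M[F]_3) : rank1_products (formAlg (fun _ : 'I_1 => M)).
Proof.
exists (0, const_mx 1) => x y; exists (bform M x.1 y.1).
rewrite -[RHS]/(_ *: 0, _ *: const_mx 1) scaler0; congr pair.
by apply/rowP=> i; rewrite !mxE mulr1.
Qed.

Lemma pencil_not_rank1 (C D : 'M[F]_2) :
  formFree (pencil C D) -> ~ rank1_products (formAlg (pencil C D)).
Proof.
(* A vector t orthogonal to w gives a linear relation between C and D. *)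
move=> free [[v w] vwP]; pose t : 'rV[F]_2 := \row_k (if k == u0 then w 0 u1 else - w 0 u0).
have wM x y : exists k, \row_l bform (pencil C D l) x y = k *: w.
  by have [k [_ E]] := vwP (x, 0) (y, 0); exists k.
have orth (s : 'rV[F]_2) : (forall i j, \sum_l s 0 l *
    bform (pencil C D l) (delta_mx 0 i) (delta_mx 0 j) = 0) -> s = 0.
  move=> sP; apply: free; apply/matrixP=> i j; rewrite summxE mxE -[RHS](sP i j).
  by apply: eq_bigr => l _; rewrite bform_delta mxE.
have t0 : t = 0.
  apply: orth => i j; have [k /rowP E] := wM (delta_mx 0 i) (delta_mx 0 j).
  have E' l : bform (pencil C D l) (delta_mx 0 i) (delta_mx 0 j) = k * w 0 l.
    by have := E l; rewrite !mxE.
  by rewrite sum2 !E' !mxE /=; ring.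
have w0 : w = 0.
  apply/rowP=> l; move/rowP: t0 => t0; have := t0 u0; have := t0 u1; rewrite !mxE /=.
  by move/eqP; rewrite oppr_eq0 => /eqP w0 w1; elim/ord2P: l.
have /rowP/(_ u0) : const_mx 1 = 0 :> 'rV[F]_2.
  apply: orth => i j; have [k /rowP E] := wM (delta_mx 0 i) (delta_mx 0 j).
  apply: big1 => l _; have := E l; rewrite w0 scaler0 !mxE => ->; exact: mulr0.
by rewrite !mxE => /eqP; rewrite oner_eq0.
Qed.

(** The families fall into four kinds: the zero multiplication, one form, a pencil,
    and a nonzero product of three elements.  Different kinds are separated by
    the vanishing of products and by the dimension of A^2. *)
Lemma presOf_unique k x k' x' : k \in iota 0 24 -> x \in params k ->
  k' \in iota 0 24 -> x' \in params k' ->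
  isPres (pres (presOf eta k x)) k' x' -> (k, x) = (k', x').
Proof.
move=> /labelsP kin xin /labelsP kin' xin' iso.
have null2 l y : (l == 0%N) || (l \in ternary_labels) || (l \in iota 14 10) ->
    null_product (pres (presOf eta l y)) 2.
  case/orP=> [/orP[/eqP->|lin]|lin].
  - move=> z [s /= /eqP]; case: s => [|u [|v []]] //= _.
    by rewrite /presMul !big_nil.
  - apply: nuIso_null_product (nuIso_sym (presOf_ternary char2 eta y lin)) _.
    exact: formAlg_null_product.
  apply: nuIso_null_product (nuIso_sym (presOf_pencil char2 eta y lin)) _.
  exact: formAlg_null_product.
have deep l y l' y' : nuIsomorphic (pres (presOf eta l y)) (pres (presOf eta l' y')) ->
    (l == 0%N) || (l \in ternary_labels) || (l \in iota 14 10) ->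
    l' \in deep_labels -> False.
  move=> iso' lin l'in; apply: (not_null_product2 char2 (eta := eta) l'in).
  have l'd : l' \in 0%N :: deep_labels by rewrite inE l'in orbT.
  rewrite -(deep_presOf y' l'd).
  exact: nuIso_null_product iso' (null2 _ _ lin).
have zero m z : nuIsomorphic (pres (presOf eta 0%N 0)) (pres (presOf eta m z)) ->
    (m \in ternary_labels) || (m \in iota 14 10) -> False.
  move=> iso' min; have null1 : null_product (pres (presOf eta m z)) 1.
    apply: nuIso_null_product iso' _ => v [s /= /eqP]; case: s => [|u []] //= _.
    by rewrite /presMul big_nil.
  have noForm p n (B : 'I_n.+1 -> 'M[F]_p) : formFree B ->
      nuIsomorphic (pres (presOf eta m z)) (formAlg B) -> False.
    move=> freeB /nuIso_null_product/(_ null1) nullB.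
    have /rowP/(_ ord0) : const_mx 1 = 0 :> 'rV[F]_n.+1.
      apply: freeB; apply: big1 => l _; apply/matrixP=> i j.
      rewrite !mxE mul1r -bform_delta.
      have [/rowP/(_ l)] := nullB (delta_mx 0 i, 0) [tuple (delta_mx 0 j, 0)].
      by rewrite !mxE.
    by rewrite !mxE => /eqP; rewrite oner_eq0.
  case/orP: min => min.
    exact: noForm _ _ _ (ternary_free min) (presOf_ternary char2 eta z min).
  exact: noForm _ _ _ (pencilNF_free min) (presOf_pencil char2 eta z min).
have mixed l y l' y' : nuIsomorphic (pres (presOf eta l y)) (pres (presOf eta l' y')) ->
    l \in ternary_labels -> l' \in iota 14 10 -> False.
  move=> iso' lin l'in; apply: (pencil_not_rank1 (pencilNF_free l'in)).
  apply: nuIso_rank1 (presOf_pencil char2 eta y' l'in) _; apply: nuIso_rank1 iso' _.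
  apply: nuIso_rank1 (nuIso_sym (presOf_ternary char2 eta y lin)) _.
  exact: ternary_rank1.
have osi := nuIso_sym iso.
case/or4P: kin => kin; case/or4P: kin' => kin'.
- have k0 := eqP kin; have k0' := eqP kin'; rewrite k0 k0' in xin xin' *.
  by rewrite (deep_params _ xin) // (deep_params _ xin').
- have k0 := eqP kin; rewrite k0 (deep_params _ xin) ?k0 // in iso.
  by case: (zero _ _ iso); rewrite kin'.
- by case: (deep _ _ _ _ iso _ kin'); rewrite kin.
- have k0 := eqP kin; rewrite k0 (deep_params _ xin) ?k0 // in iso.
  by case: (zero _ _ iso); rewrite kin' orbT.
- have k0 := eqP kin'; rewrite k0 (deep_params _ xin') ?k0 // in osi.
  by case: (zero _ _ osi); rewrite kin.
- have sim : similarForms (ternary k x) (ternary k' x').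
    apply/similar_formEquiv; apply: formEquiv_of_iso; try exact: ternary_free.
    apply: nuIso_trans (nuIso_sym (presOf_ternary char2 eta x kin)) _.
    exact: nuIso_trans iso (presOf_ternary char2 eta x' kin').
  apply: (ternary_unique char2 hgamma0 kin _ kin' _ sim).
    by move: kin xin; rewrite !inE; (do !case/orP) => /eqP->.
  by move: kin' xin'; rewrite !inE; (do !case/orP) => /eqP->.
- by case: (deep _ _ _ _ iso _ kin'); rewrite kin orbT.
- by case: (mixed _ _ _ _ iso kin kin').
- by case: (deep _ _ _ _ osi _ kin); rewrite kin'.
- by case: (deep _ _ _ _ osi _ kin); rewrite kin' orbT.
- have x0 : x = 0 by apply: deep_params xin; rewrite inE kin orbT.
  have x0' : x' = 0 by apply: deep_params xin'; rewrite inE kin' orbT.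
  rewrite x0 x0' in iso *; congr pair; exact: deep_label kin kin' iso.
- by case: (deep _ _ _ _ osi _ kin); rewrite kin' orbT.
- have k0 := eqP kin'; rewrite k0 (deep_params _ xin') ?k0 // in osi.
  by case: (zero _ _ osi); rewrite kin orbT.
- by case: (mixed _ _ _ _ osi kin' kin).
- by case: (deep _ _ _ _ iso _ kin'); rewrite kin orbT.
apply: (pencil_unique char2 hgamma0 heta kin _ kin').
- by rewrite /params kin in xin.
- by rewrite /params kin' in xin'.
apply: formEquiv_of_iso; try exact: pencilNF_free.
apply: nuIso_trans (nuIso_sym (presOf_pencil char2 eta x kin)) _.
exact: nuIso_trans iso (presOf_pencil char2 eta x' kin').
Qed.

End Assembly.

Section Listing.
Variables (F : fieldType) (I : eqType).

(** Enumerating the list by a duplicate-free list of labels makes positions and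
    labels interchangeable. *)
Lemma listsUpToIso_map (P : nuAlgebra F -> Prop) (pr : I -> presentation4 F) (s : seq I) :
  uniq s ->
  (forall i, i \in s -> P (pres (pr i))) ->
  (forall A, P A -> exists2 i, i \in s & nuIsomorphic A (pres (pr i))) ->
  (forall i j, i \in s -> j \in s ->
     nuIsomorphic (pres (pr i)) (pres (pr j)) -> i = j) ->
  listsUpToIso P [seq pr i | i <- s].
Proof.
move=> us sP sE sU; have nthE (k : 'I_(size [seq pr i | i <- s])) :
    exists i, [/\ i \in s, index i s = k &
      tnth (in_tuple [seq pr i | i <- s]) k = pr i].
  have ks : (k < size s)%N by rewrite -(size_map pr).
  case: s us sP sE sU k ks => [|i0 s] us _ _ _ k ks //.
  exists (nth i0 (i0 :: s) k); rewrite mem_nth // index_uniq // (tnth_nth (pr i0)).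
  by split=> //; rewrite (nth_map i0).
split=> [k|A PA]; first by have [i [si _ ->]] := nthE k; apply: sP.
have [i si iso] := sE A PA.
have ks : (index i s < size [seq pr i | i <- s])%N by rewrite size_map index_mem.
exists (Ordinal ks); split.
  have [j [sj jk ->]] := nthE (Ordinal ks).
  suff -> : j = i by [].
  by rewrite -(nth_index i sj) jk /= nth_index.
move=> k; have [j [sj jk ->]] := nthE k => iso'; apply: val_inj => /=.
by rewrite -jk; congr index; apply: sU => //; apply: nuIso_trans (nuIso_sym iso) iso'.
Qed.
End Listing.

Theorem proposition7p6 (F : finFieldType) (charF : 2%N \in [pchar F])
    (gamma0 : F) (hgamma0 : gamma0 \notin [set t ^+ 2 + t | t : F])
    (eta : F -> F)
    (heta : forall sigma : F, sigma != 0 -> sigma != 1 ->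
              eta sigma \notin Hset sigma) :
  listsUpToIso
    (fun A : nuAlgebra F => [/\ nuAssociative A, nuNilpotent A & nuDim A = 4%N])
    ([:: A4_1; A4_2; A4_3 1]
     ++ [seq A4_4 delta | delta : F]
     ++ [:: A4_5; A4_6; A4_8 1 1]
     ++ [seq A4_9 1 beta | beta : F]
     ++ [seq A4_10 alpha | alpha <- [:: 0; gamma0]]
     ++ [:: A4_11; A4_12; A4_13; A4_14; A4_15; A4_16]
     ++ [seq A4_17 delta | delta <- [:: 0; gamma0]]
     ++ [:: A4_18 1]
     ++ [seq A4_19 delta | delta <- [:: 0; gamma0]]
     ++ [:: A4_20]
     ++ [seq A4_21 delta | delta : F in [pred delta | delta != 1]]
     ++ [:: A4_26 0 0 1; A4_26 0 1 1]
     ++ [seq A4_26 0 sigma 1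
          | sigma : F in [pred sigma | (sigma != 0) && (sigma != 1)]]
     ++ [seq A4_26 (1 + (eta sigma)^-1) (sigma * (eta sigma)^-1) 1
          | sigma : F in [pred sigma | (sigma != 0) && (sigma != 1)]]).
Proof.
pose labels : seq (nat * F) :=
  [seq (k, x) | k <- iota 0 24, x <- params gamma0 k].
pose pr (l : nat * F) := presOf eta l.1 l.2.
have labelsE : [seq pr l | l <- labels] =
    [seq presOf eta k x | k <- iota 0 24, x <- params gamma0 k].
  by rewrite /labels map_allpairs.
set L := (X in listsUpToIso _ X).
have -> : L = [seq pr l | l <- labels].
  rewrite labelsE /L /image_mem.
  by rewrite /allpairs_dep /= ?cats0.
apply: listsUpToIso_map.
- apply: allpairs_uniq_dep => [||[k x] [k' x'] _ _ [-> ->]] //.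
  move=> k _; rewrite /params /pencil_params.
  have gamma0_neq0 : gamma0 != 0.
    by apply: contraNneq hgamma0 => ->; apply/imsetP; exists 0; rewrite // expr0n addr0.
  have pair_uniq : uniq [:: 0; gamma0] by rewrite /= inE eq_sym gamma0_neq0.
  by do 30 ?[case: ifP => // _ | case: k => [|k] //=]; rewrite ?enum_uniq.
- move=> _ /allpairsPdep[k [x [kin xin ->]]]; exact: presOf_nilpotent.
- move=> A [assocA nilA dimA].
  have [k [x [kin xin iso]]] := presOf_exhaustive charF hgamma0 heta assocA nilA dimA.
  by exists (k, x) => //; apply/allpairsPdep; exists k, x.
move=> _ _ /allpairsPdep[k [x [kin xin ->]]] /allpairsPdep[k' [x' [kin' xin' ->]]].
exact: (presOf_unique charF hgamma0 heta kin xin kin' xin').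
Qed.
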